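(* Let $G$ be a finite simple graph that is $\{\text{fork}, \text{antifork}\}$-free. Then $\mathrm{had}_2^+(G) \geq \chi(G)$.
   Context: Graphs are finite, loopless and without parallel edges. $\chi(G)$ denotes the chromatic number of $G$. For a set $S$ of graphs, $G$ is $S$-free if no induced subgraph of $G$ is isomorphic to a member of $S$. The fork is the 5-vertex graph obtained from the claw $K_{1,3}$ by subdividing one of its edges once; the antifork is the complement of the fork. An $H$-model in a graph $G$ is a collection $\{S_x : x\in V(H)\}$ of pairwise disjoint non-empty connected subsets of $V(G)$ (each $S_x$ induces a connected subgraph of $G$) such that there is an edge of $G$ between a vertex of $S_x$ and a vertex of $S_y$ whenever $xy\in E(H)$; the sets $S_x$ are called branch sets. An $H$-model is semi-small if at most one of its branch sets has size greater than $2$. $\mathrm{had}_2^+(G)$ is the maximum integer $t$ such that $G$ has a semi-small $K_t$-model. *)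

(* Defs.v *)
From mathcomp Require Import all_boot.

Set Implicit Arguments.
Unset Strict Implicit.
Unset Printing Implicit Defensive.

(* The vertex set may be empty. *)
Record graph := Graph {
  vertex :> finType;
  adj : rel vertex;
  adj_sym : symmetric adj;
  adj_irrefl : irreflexive adj
}.

Section Constructions.

Variable G : graph.

Definition compl_rel : rel G := fun x y => (x != y) && ~~ adj x y.

Lemma compl_rel_sym : symmetric compl_rel.
Proof. by move=> x y; rewrite /compl_rel eq_sym adj_sym. Qed.

Lemma compl_rel_irrefl : irreflexive compl_rel.
Proof. by move=> x; rewrite /compl_rel eqxx. Qed.

Definition compl : graph := Graph compl_rel_sym compl_rel_irrefl.

Variable A : {set G}.

Definition induced_rel : rel {x : G | x \in A} := fun x y => adj (val x) (val y).

Lemma induced_rel_sym : symmetric induced_rel.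
Proof. by move=> x y; rewrite /induced_rel adj_sym. Qed.

Lemma induced_rel_irrefl : irreflexive induced_rel.
Proof. by move=> x; rewrite /induced_rel adj_irrefl. Qed.

Definition induced : graph := Graph induced_rel_sym induced_rel_irrefl.

End Constructions.

Section EdgeList.

Variables (n : nat) (E : seq (nat * nat)).

Definition edge_list_rel : rel 'I_n := fun i j =>
  (i != j) && (((val i, val j) \in E) || ((val j, val i) \in E)).

Lemma edge_list_rel_sym : symmetric edge_list_rel.
Proof. by move=> i j; rewrite /edge_list_rel eq_sym orbC. Qed.

Lemma edge_list_rel_irrefl : irreflexive edge_list_rel.
Proof. by move=> i; rewrite /edge_list_rel eqxx. Qed.

Definition edge_list_graph : graph :=
  Graph edge_list_rel_sym edge_list_rel_irrefl.

End EdgeList.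

Section Complete.

Variable t : nat.

Definition complete_rel : rel 'I_t := fun i j => i != j.

Lemma complete_rel_sym : symmetric complete_rel.
Proof. by move=> i j; rewrite /complete_rel eq_sym. Qed.

Lemma complete_rel_irrefl : irreflexive complete_rel.
Proof. by move=> i; rewrite /complete_rel eqxx. Qed.

Definition complete : graph := Graph complete_rel_sym complete_rel_irrefl.

End Complete.

(* The claw with centre 0 and leaves 1, 2, 4, its edge 04 subdivided by 3. *)
Definition fork : graph := edge_list_graph 5 [:: (0, 1); (0, 2); (0, 3); (3, 4)].

Definition antifork : graph := compl fork.

Definition isomorphic (G H : graph) : Prop :=
  exists2 f : G -> H, bijective f & {mono f : x y / adj x y}.

Definition free_of (S : graph -> Prop) (G : graph) : Prop :=
  forall H : graph, S H -> forall A : {set G}, ~ isomorphic (induced A) H.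

Section ChromaticNumber.

Variable G : graph.

Definition proper_coloring (k : nat) (c : {ffun G -> 'I_k}) : bool :=
  [forall x, forall y, adj x y ==> (c x != c y)].

Definition colorable (k : nat) : bool :=
  [exists c : {ffun G -> 'I_k}, proper_coloring c].

Lemma ex_colorable : exists k, colorable k.
Proof.
exists #|G|; apply/existsP; exists [ffun x => enum_rank x].
apply/forallP=> x; apply/forallP=> y; apply/implyP=> xy; rewrite !ffunE.
by apply: contraTneq xy => /enum_rank_inj ->; rewrite adj_irrefl.
Qed.

Definition chi : nat := ex_minn ex_colorable.

End ChromaticNumber.

Section Models.

Variable G : graph.

Definition connected (A : {set G}) : bool :=
  [forall x : induced A, forall y : induced A, connect (@adj (induced A)) x y].

Definition is_model (H : graph) (S : {ffun H -> {set G}}) : bool :=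
  [&& [forall x, (S x != set0) && connected (S x)],
      [forall x, forall y, (x != y) ==> [disjoint S x & S y]]
    & [forall x, forall y, adj x y ==>
         [exists u in S x, exists v in S y, adj u v]]].

Definition semi_small (H : graph) (S : {ffun H -> {set G}}) : bool :=
  #|[set x | 2 < #|S x|]| <= 1.

Definition has_semi_small_clique_model (t : nat) : bool :=
  [exists S : {ffun complete t -> {set G}}, is_model S && semi_small S].

Lemma ex_semi_small_clique_model : exists t, has_semi_small_clique_model t.
Proof.
exists 0; apply/existsP; exists [ffun=> set0].
rewrite /is_model /semi_small; apply/andP; split; last first.
  by rewrite (leq_trans (max_card _)) // card_ord.
by apply/and3P; split; apply/forallP; case.
Qed.

Lemma semi_small_clique_model_bound t :
  has_semi_small_clique_model t -> t <= #|G|.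
Proof.
case/existsP=> S /andP[/and3P[/forallP ne /forallP dis _] _].
have memS i : exists x, x \in S i by apply/set0Pn; case/andP: (ne i).
pose f i := xchoose (memS i).
have f_inj : injective f.
  move=> i j fij; apply/eqP/negPn/negP=> nij.
  have /implyP/(_ nij)/pred0P/(_ (f i)) /= := forallP (dis i) j.
  by rewrite {2}fij !(xchooseP (memS _)).
by have := leq_card f f_inj; rewrite card_ord.
Qed.

Definition had2plus : nat :=
  ex_maxn ex_semi_small_clique_model semi_small_clique_model_bound.

End Models.

(* Main.v *)
Require Import Defs.
From mathcomp Require Import all_boot.
From mathcomp Require Import zify.

Set Implicit Arguments.
Unset Strict Implicit.
Unset Printing Implicit Defensive.

(** Write e for adjacency and f for non-adjacency of distinct vertices, and let
    G have no colouring with k colours; by induction on the number of vertices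
    it must be shown that G has a semi-small K_(k+1)-model
    ([noncolourable_model]).

    If some proper induced subgraph has no k-colouring, induction applies to
    it; so let G be critical.  If the complement of G is disconnected, G is a
    join of two smaller graphs; chromatic numbers add, and so do models, since
    two large branch sets, one on either side, can be traded for two edges
    across ([model_join]).  Otherwise G is prime: in a critical graph no
    vertex dominates another one that is not adjacent to it, and in an
    antifork-free graph a colouring of the outside of a module that contains an
    edge can be modified so as to extend over the module ([critical_prime]).

    Unless k = 0, the graph then contains an induced four-vertex path
    ([critical_P4]), and a prime fork- and antifork-free graph with such a path,
    or its complement, is the line graph of a triangle-free graph
    ([prime_line_like_or_co]).  In local terms: the neighbourhood of each
    vertex splits into two cliques without edges between them.

    If G is such a line graph, Vizing's argument, with fans and Kempe chains
    read inside G, gives a clique of size k ([vizing_clique]).  Such a clique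
    K is one short of what is needed, and the missing branch set is the whole
    outside of K: by criticality it is connected and every vertex of K has a
    neighbour in it ([clique_model]).  This is the only place where a branch
    set of size greater than 2 is created.

    If the complement is such a line graph ([co_line_like]) and there is no
    clique of size k, then G has at least 2k+2 vertices ([co_line_card]),
    because a stable set of size at least 3 and pairs of non-adjacent vertices
    can serve as colour classes; G has a matching with k+1 edges
    ([large_matching]); and as long as two of its edges have no edge between
    them, exchanging end-vertices with a third edge reduces the number of
    matching edges involved in this way ([fewer_conflicts]).  The final matching
    is a K_(k+1)-model all of whose branch sets have size 2. *)

(** * Connectedness, primality and line-like graphs *)

Section Linked.
Variables (T : finType) (r : rel T).

(** Connectedness of A, phrased by cuts rather than by paths, since its uses
    below are for cuts given by a predicate. *)
Definition linked (A : {set T}) := forall (B : {set T}) x y,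
  x \in A -> y \in A -> x \in B -> y \notin B ->
  exists u v, [/\ u \in A, v \in A, u \in B, v \notin B & r u v].

Lemma linked_sub (A B : {set T}) x : linked A -> x \in A -> x \in B ->
  (forall u v, u \in A -> v \in A -> u \in B -> r u v -> v \in B) ->
  A \subset B.
Proof.
move=> lA xA xB cl; apply/subsetP=> y yA; apply: contraT => yB.
have [u [v [uA vA uB vB ruv]]] := lA B x y xA yA xB yB.
by rewrite (cl u v) in vB.
Qed.

Hypothesis r_sym : symmetric r.

(** The component of p is a smallest subset of A that contains p and is closed
    under r inside A: a cut of it without crossing edges would yield a smaller
    one. *)
Lemma component (A : {set T}) p : p \in A -> exists W : {set T},
  [/\ W \subset A, p \in W, linked W &
      forall x y, x \in W -> y \in A -> r x y -> y \in W].
Proof.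
move=> pA.
pose P (W : {set T}) := [&& p \in W, W \subset A &
  [forall x in W, forall y in A, r x y ==> (y \in W)]].
have PA : P A.
  rewrite /P pA subxx; apply/forall_inP=> x xA; apply/forall_inP=> y yA.
  exact/implyP.
have [W /minsetP[/and3P[pW sWA cl] minW] _] := minset_exists PA.
have clW x y : x \in W -> y \in A -> r x y -> y \in W.
  by move=> xW yA; move: (forall_inP (forall_inP cl x xW) y yA) => /implyP.
exists W; split=> // B x y xW yW xB yB.
have key (C : {set T}) z : p \in C -> z \in W -> z \notin C ->
  exists u v, [/\ u \in W, v \in W, u \in C, v \notin C & r u v].
  move=> pC zW zC.
  have [/existsP[u /existsP[v /and5P[*]]]|no] := boolP [exists u, exists v,
     [&& u \in W, v \in W, u \in C, v \notin C & r u v]].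
    by exists u, v.
  case/negP: zC; suff /setP/(_ z) : C :&: W = W by rewrite inE zW andbT => ->.
  apply: minW; last exact: subsetIr.
  rewrite /P inE pC pW (subset_trans (subsetIr _ _) sWA) /=.
  apply/forall_inP=> u /setIP[uC uW]; apply/forall_inP=> v vA.
  apply/implyP=> ruv; have vW := clW _ _ uW vA ruv.
  rewrite inE vW andbT; apply: contraT => vC; case/negP: no.
  by apply/existsP; exists u; apply/existsP; exists v; apply/and5P.
have [pB|pB] := boolP (p \in B); first exact: key pB yW yB.
have [u [v [uW vW uB vB ruv]]] := key (~: B) x (ltac:(by rewrite inE)) xW
  (ltac:(by rewrite inE negbK)).
by exists v, u; rewrite r_sym; move: uB vB; rewrite !inE negbK.
Qed.

Lemma linked_add (A : {set T}) v p :
  linked A -> p \in A -> r v p -> linked (v |: A).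
Proof.
move=> lA pA rvp B x y xA yA xB yB.
have lift : (exists u w, [/\ u \in A, w \in A, u \in B, w \notin B & r u w]) ->
    exists u w, [/\ u \in v |: A, w \in v |: A, u \in B, w \notin B & r u w].
  by case=> u [w [uA wA uB wB ruw]]; exists u, w; split=> //; apply: setU1r.
have [pB|pB] := boolP (p \in B).
  case/setU1P: yA => [yv|yA]; last by apply: lift; apply: lA pA yA pB yB.
  by exists p, v; rewrite setU11 setU1r // pB -yv yB yv r_sym.
case/setU1P: xA => [xv|xA]; last by apply: lift; apply: lA xA pA xB pB.
by exists v, p; rewrite setU11 setU1r // pB -xv xB xv.
Qed.

End Linked.

Definition nonadj (T : finType) (e : rel T) : rel T :=
  fun x y => (x != y) && ~~ e x y.

Lemma nonadj_sym (T : finType) (e : rel T) :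
  symmetric e -> symmetric (nonadj e).
Proof. by move=> e_sym x y; rewrite /nonadj eq_sym e_sym. Qed.

(** The one inequality b != c is needed because b and c are twins in the fork;
    all other vertices are distinguished by the adjacencies. *)
Definition fork_free (T : finType) (e : rel T) := forall a b c d f,
  e a b -> e a c -> e a d -> e d f -> b != c ->
  ~~ e b c -> ~~ e b d -> ~~ e c d -> ~~ e a f -> ~~ e b f -> ~~ e c f -> False.

(** The antifork drawn as a kite: p, q, r, s span a diamond whose non-adjacent
    vertices are r and s, and t is a pendant vertex attached to r. *)
Definition kite_free (T : finType) (e : rel T) := forall p q r s t,
  e p q -> e p r -> e p s -> e q r -> e q s -> e r t ->
  ~~ e r s -> ~~ e p t -> ~~ e q t -> ~~ e s t -> False.

(** Prime for modular decomposition: no set of at least two vertices, other than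
    the whole vertex set, looks the same from each vertex outside it.  The vertex
    z records that A is proper. *)
Definition prime (T : finType) (e : rel T) := forall A : {set T}, forall z,
  1 < #|A| -> z \notin A ->
  exists v x y, [/\ v \notin A, x \in A, y \in A, e v x & ~~ e v y].

(** Among any three neighbours of a vertex the number of edges is odd: none would
    be a claw, two would be a diamond.  These are the line graphs of
    triangle-free graphs. *)
Definition line_like (T : finType) (e : rel T) := forall u x y z,
  e u x -> e u y -> e u z -> x != y -> y != z -> x != z ->
  e x y (+) e y z (+) e x z.

(** X selects one of the two cliques; no edges run between them. *)
Definition two_cliques (T : finType) (e : rel T) (A : {set T}) u :=
  exists X : {set T}, forall x y, x \in A -> y \in A -> e u x -> e u y ->
    x != y -> e x y = ((x \in X) == (y \in X)).

Lemma two_cliques_line_like (T : finType) (e : rel T) :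
  (forall u, two_cliques e setT u) -> line_like e.
Proof.
move=> tc u x y z ux uy uz nxy nyz nxz; have [X hX] := tc u.
rewrite (hX x y) ?(hX y z) ?(hX x z) ?in_setT //.
by case: (x \in X); case: (y \in X); case: (z \in X).
Qed.

(** * A connected, co-connected set missed by a vertex *)

Section Rooted.
Variables (T : finType) (e : rel T).
Hypotheses (e_sym : symmetric e) (e_irr : irreflexive e).
Hypotheses (forkF : fork_free e) (kiteF : kite_free e).

Ltac ad := solve [assumption | done | rewrite e_sym; assumption
                 | rewrite eq_sym; assumption].

(** The neighbours of v in K form a clique; for p among them, the neighbours of p
    in K that v misses are pairwise adjacent, because of the fork whose long arm
    ends in v and a.  Peeling off the neighbours of v, a component D of the rest
    hangs on one of them, p, in the same way as K hangs on v, with v in the place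
    of a; hence the induction. *)
Lemma rooted_two_cliques n (K : {set T}) v a : #|K| <= n ->
  linked e K -> e a v -> (forall x, x \in K -> ~~ e a x) ->
  (exists2 p, p \in K & e v p) ->
  (forall p p', p \in K -> p' \in K -> e v p -> e v p' -> p != p' -> e p p') ->
  (forall q p p', q \in K -> ~~ e v q -> p \in K -> p' \in K ->
     e v p -> e v p' -> e q p -> e q p' -> p = p') ->
  forall u, u \in K -> two_cliques e K u.
Proof.
elim: n K v a => [|n IHn] K v a leKn linkK av aK [p0 p0K vp0] cl at1 u uK.
  by move: leKn; rewrite leqn0 cards_eq0 => /eqP K0; rewrite K0 inE in uK.
have [vu|nvu] := boolP (e v u).
  exists [set x | e v x] => x y xK yK ux uy nxy; rewrite !inE.
  have [vx|nvx] := boolP (e v x); have [vy|nvy] := boolP (e v y).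
  - by rewrite cl.
  - apply: contraTF isT => xy.
    have := at1 y x u yK nvy xK uK vx vu; rewrite !(e_sym y) xy uy => /(_ isT isT) xu.
    by rewrite xu e_irr in ux.
  - apply: contraTF isT => xy.
    have := at1 x y u xK nvx yK uK vy vu; rewrite xy e_sym ux => /(_ isT isT) yu.
    by rewrite yu e_irr in uy.
  - rewrite eqxx; apply/idP; apply: contraT => nxy'; exfalso.
    by have [nax nay nau] := And3 (aK _ xK) (aK _ yK) (aK _ uK);
       apply: (forkF (a:=u) (b:=x) (c:=y) (d:=v) (f:=a)); ad.
pose Q := K :\: [set x | e v x].
have QE x : (x \in Q) = ~~ e v x && (x \in K) by rewrite !inE.
have uQ : u \in Q by rewrite QE nvu.
have [D [sDQ uD linkD clD]] := component e_sym uQ.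
have DK x : x \in D -> x \in K by move/(subsetP sDQ); rewrite QE => /andP[].
have Dv x : x \in D -> ~~ e v x by move/(subsetP sDQ); rewrite QE => /andP[].
have Dcl x y : x \in D -> y \in K -> e x y -> ~~ e v y -> y \in D.
  by move=> xD yK xy vy; apply: (clD x) => //; rewrite QE vy.
have fk p x y : p \in K -> e v p -> x \in K -> y \in K -> e p x -> e p y ->
    ~~ e v x -> ~~ e v y -> x != y -> e x y.
  move=> pK vp xK yK px py nvx nvy nxy; apply: contraT => nxy'; exfalso.
  have [nax nay nap] := And3 (aK _ xK) (aK _ yK) (aK _ pK).
  by apply: (forkF (a:=p) (b:=x) (c:=y) (d:=v) (f:=a)); ad.
have [/exists_inP[p pK /andP[vp up]]|nop] :=
    boolP [exists p in K, e v p && e u p].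
  have at1' q x y : q \in D -> x \in D -> y \in D -> ~~ e p q -> e p x ->
      e p y -> e q x -> e q y -> x = y.
    move=> qD xD yD npq px py qx qy; apply/eqP; apply: contraT => nxy; exfalso.
    have xy : e x y by apply: (fk p) => //; auto.
    have [nvx nvy nvq] := And3 (Dv _ xD) (Dv _ yD) (Dv _ qD).
    by apply: (kiteF (p:=x) (q:=y) (r:=p) (s:=q) (t:=v)); ad.
  have onlyp x : x \in K -> e u x -> e v x -> x = p.
    by move=> xK ux vx; apply: (at1 u).
  have inD x : x \in K -> e u x -> x != p -> x \in D.
    move=> xK ux nxp; apply: (Dcl u) => //; apply: contra nxp => vx.
    by apply/eqP/onlyp.
  exists (p |: [set x | e p x]) => x y xK yK ux uy nxy; rewrite !inE.
  have [xp|nxp] := eqVneq x p.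
    rewrite xp /=; have /negPf -> : y != p by rewrite -xp eq_sym.
    by case: (e p y).
  have [yp|nyp] := eqVneq y p.
    by rewrite yp /= (e_sym x); case: (e p x).
  have [xD yD] := (inD x xK ux nxp, inD y yK uy nyp).
  have [nvx nvy] := (Dv _ xD, Dv _ yD).
  have [px|npx] := boolP (e p x); have [py|npy] := boolP (e p y) => /=.
  - by apply: (fk p).
  - apply: contraTF isT => xy.
    by have := at1' y x u yD xD uD npy px (ltac:(ad)) (ltac:(ad)) (ltac:(ad));
       move=> xu; rewrite xu e_irr in ux.
  - apply: contraTF isT => xy.
    by have := at1' x y u xD yD uD npx py (ltac:(ad)) (ltac:(ad)) (ltac:(ad));
       move=> xu; rewrite xu e_irr in uy.
  - apply: contraT => nxy'; exfalso.
    by apply: (forkF (a:=u) (b:=x) (c:=y) (d:=p) (f:=v)); ad.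
have p0D : p0 \notin D by apply: contraL vp0 => /Dv.
have [x [p [xK pK xD pD xp]]] := linkK D u p0 uK p0K uD p0D.
have vp : e v p by apply: contraNT pD => nvp; apply: (Dcl x).
have ltD : #|D| < #|K|.
  apply: proper_card; apply/properP; split; last by exists p.
  by apply/subsetP=> y /DK.
have [||||X hX] := IHn D p v _ linkD vp Dv _ _ _ u uD.
- by rewrite -ltnS (leq_trans ltD).
- by exists x => //; rewrite e_sym.
- by move=> y z yD zD py pz nyz; apply: (fk p); auto.
- move=> q y z qD npq yD zD py pz qy qz.
  apply/eqP; apply: contraT => nyz; exfalso.
  have yz : e y z by apply: (fk p) => //; auto.
  have [nvx nvy nvq] := And3 (Dv _ yD) (Dv _ zD) (Dv _ qD).
  by apply: (kiteF (p:=y) (q:=z) (r:=p) (s:=q) (t:=v)); ad.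
exists X => y z yK zK uy uz nyz.
have inD w : w \in K -> e u w -> w \in D.
  move=> wK uw; apply: (Dcl u) => //; apply: contra nop => vw.
  by apply/exists_inP; exists w => //; rewrite vw.
by apply: hX; auto.
Qed.

End Rooted.

Section Anchor.
Variables (T : finType) (e : rel T).
Hypotheses (e_sym : symmetric e) (e_irr : irreflexive e).
Hypotheses (forkF : fork_free e) (kiteF : kite_free e) (primeP : prime e).

Ltac ad := solve [assumption | done | rewrite e_sym; assumption
                 | rewrite eq_sym; assumption].

Let ce_sym := nonadj_sym e_sym.

Definition mixed (K : {set T}) v :=
  [exists p in K, e v p] && [exists q in K, ~~ e v q].
Definition complete_to (K : {set T}) v := [forall p in K, e v p].
Definition anti_to (K : {set T}) v := [forall p in K, ~~ e v p].

Lemma anti_toP (K : {set T}) v x : anti_to K v -> x \in K -> ~~ e v x.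
Proof. by move/forall_inP; apply. Qed.
Lemma complete_toP (K : {set T}) v x : complete_to K v -> x \in K -> e v x.
Proof. by move/forall_inP; apply. Qed.

Lemma trichotomy (K : {set T}) v : ~~ mixed K v -> ~~ complete_to K v -> anti_to K v.
Proof.
rewrite /mixed /complete_to negb_forall_in negb_and => /orP[|/negP//].
by rewrite negb_exists_in.
Qed.

(** A mixed vertex can be added to K, which stays connected and co-connected.
    Here K is such that no vertex anticomplete to K survives an addition of this
    kind; then just one vertex is anticomplete to K, and none is complete to it. *)
Section Maximal.
Variable K : {set T}.
Hypotheses (linkK : linked e K) (colinkK : linked (nonadj e) K).
Hypothesis (cardK : 1 < #|K|).
Variable z0 : T.
Hypotheses (z0K : z0 \notin K) (z0A : anti_to K z0).
Hypothesis maxK : forall v z, v \notin K -> mixed K v -> z \notin K ->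
  anti_to K z -> e z v.

Lemma mixed_edge v : mixed K v ->
  exists p q, [/\ p \in K, q \in K, e v p, ~~ e v q & e p q].
Proof.
case/andP=> /exists_inP[p pK vp] /exists_inP[q qK vq].
have [||x [y [xK yK]]] := linkK (B := [set x | e v x]) pK qK.
- by rewrite inE.
- by rewrite inE.
by rewrite !inE => vx vy xy; exists x, y.
Qed.

(** Most contradictions below are of this kind: a set and the rest of K are
    completely joined, although K is co-connected. *)
Lemma coclosedF (B : {set T}) x y : x \in K -> y \in K -> x \in B -> y \notin B ->
  (forall u v, u \in K -> v \in K -> u \in B -> v \notin B -> e u v) -> False.
Proof.
move=> xK yK xB yB cpl; have [u [v [uK vK uB vB]]] := colinkK xK yK xB yB.
by rewrite /nonadj cpl // andbF.
Qed.

Lemma edge_of x : x \in K -> exists2 y, y \in K & e x y.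
Proof.
move=> xK; have /card_gt1P[u [v [uK vK nuv]]] := cardK.
have [y yK nyx] : exists2 y, y \in K & y != x.
  by have [ux|] := eqVneq u x; [exists v => //; rewrite -ux eq_sym | exists u].
have [||a [b [aK bK]]] := linkK (B := [set x]) xK yK.
- by rewrite inE.
- by rewrite inE.
by rewrite !inE => /eqP -> _ xb; exists b.
Qed.

(** Otherwise v, with the leaves a and p' and the long arm through p to q, is the
    centre of a fork. *)
Lemma same_nbr a v p p' q : anti_to K a -> e a v -> p \in K -> p' \in K ->
  q \in K -> e v p -> e v p' -> ~~ e v q -> ~~ e p p' -> e q p -> e q p'.
Proof.
move=> aA av pK p'K qK vp vp' vq npp' qp; apply: contraT => nqp'; exfalso.
have [nap nap' naq] := And3 (anti_toP aA pK) (anti_toP aA p'K) (anti_toP aA qK).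
apply: (forkF (a:=v) (b:=a) (c:=p') (d:=p) (f:=q)); try ad.
apply/eqP=> ap'; have [y yK p'y] := edge_of p'K.
by rewrite -ap' (negPf (anti_toP aA yK)) in p'y.
Qed.

(** If c were adjacent to z, the vertices of K missed by y would form a clique by
    the fork at c, and kites would make the vertices that y shares with q0
    complete to the rest of K. *)
Lemma complete_anti c y z : c \notin K -> complete_to K c -> y \notin K ->
  mixed K y -> ~~ e c y -> z \notin K -> anti_to K z -> ~~ e c z.
Proof.
move=> cK cC yK yM ncy zK zA; apply/negP=> cz.
have zy : e z y by apply: maxK.
have [p0 [q0 [p0K q0K yp0 yq0 pq0]]] := mixed_edge yM.
have Qcl q r : q \in K -> r \in K -> ~~ e y q -> ~~ e y r -> q != r -> e q r.
  move=> qK rK yq yr nqr; apply: contraT => nqr'; exfalso.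
  have [zq zr] := (anti_toP zA qK, anti_toP zA rK).
  have [cq cr] := (complete_toP cC qK, complete_toP cC rK).
  by apply: (forkF (a:=c) (b:=q) (c:=r) (d:=z) (f:=y)); ad.
have spread p q r : p \in K -> q \in K -> r \in K -> e y p -> ~~ e y q ->
    ~~ e y r -> e q p -> e q r -> e r p.
  move=> pK qK rK yp yq yr qp qr; apply: contraT => nrp; exfalso.
  have [cp cq cr] := And3 (complete_toP cC pK) (complete_toP cC qK) (complete_toP cC rK).
  by apply: (kiteF (p:=c) (q:=q) (r:=p) (s:=r) (t:=y)); ad.
apply: (@coclosedF [set x | e y x && e q0 x] p0 q0) => //.
- by rewrite inE yp0 e_sym.
- by rewrite inE e_irr andbF.
move=> u v uK vK; rewrite !inE => /andP[yu q0u].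
have [yv /= q0v|yv _] := boolP (e y v).
  by apply: contraT => nuv; rewrite (same_nbr zA zy uK vK q0K) in q0v.
have [<-|nq0v] := eqVneq q0 v; first by rewrite e_sym.
by rewrite e_sym; apply: (spread u q0) => //; apply: Qcl.
Qed.

Lemma exists_mixed : exists2 v, v \notin K & mixed K v.
Proof.
have [v [x [y [vK xK yK vx vy]]]] := primeP cardK z0K.
by exists v => //; apply/andP; split; apply/exists_inP; [exists x | exists y].
Qed.

(** Otherwise consider the vertices that are complete to K and see some
    anticomplete vertex: they are complete to everything else, so the remaining
    vertices form a module. *)
Lemma complete_not_anti c z : c \notin K -> complete_to K c ->
  z \notin K -> anti_to K z -> ~~ e c z.
Proof.
move=> cK cC zK zA; apply/negP=> cz.
pose P c := [&& c \notin K, complete_to K c &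
  [exists z, [&& z \notin K, anti_to K z & e c z]]].
have Pc : P c by rewrite /P cK cC; apply/existsP; exists z; rewrite zK zA.
have card1 : 1 < #|~: [set c | P c]|.
  apply: leq_trans cardK (subset_leq_card _).
  by apply/subsetP=> x xK; rewrite !inE /P xK.
have [|v [x [y]]] := primeP (z := c) card1; first by rewrite !inE Pc.
rewrite !inE negbK => -[/and3P[vK vC /existsP[w /and3P[wK wA vw]]] _ nPy _ nvy].
have yK : y \notin K by apply: contra nvy => /(complete_toP vC).
have ecomp u : u \notin K -> mixed K u -> e v u.
  move=> uK uM; apply: contraT => nvu.
  by rewrite (negPf (complete_anti vK vC uK uM nvu wK wA)) in vw.
have [yM|yM] := boolP (mixed K y); first by rewrite ecomp in nvy.
have [yC|yC] := boolP (complete_to K y).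
  have nyw : ~~ e y w.
    apply: contra nPy => yw; rewrite /P yK yC.
    by apply/existsP; exists w; rewrite wK wA.
  have [p pK] : exists p, p \in K.
    by case/card_gt1P: cardK => p [_ [pK _ _]]; exists p.
  have [q qK pq] := edge_of pK.
  have [vp vq] := (complete_toP vC pK, complete_toP vC qK).
  have [yp yq] := (complete_toP yC pK, complete_toP yC qK).
  have [wp wq] := (anti_toP wA pK, anti_toP wA qK).
  by apply: (kiteF (p:=p) (q:=q) (r:=v) (s:=y) (t:=w)); ad.
have yA := trichotomy yM yC.
have [u uK uM] := exists_mixed.
have [p [q [pK qK up uq pq]]] := mixed_edge uM.
have [vp vq] := (complete_toP vC pK, complete_toP vC qK).
have [yp yq] := (anti_toP yA pK, anti_toP yA qK).
have yu := maxK uK uM yK yA; have vu := ecomp u uK uM.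
by apply: (kiteF (p:=v) (q:=p) (r:=u) (s:=q) (t:=y)); ad.
Qed.

(** Anticomplete vertices are seen by no complete vertex and by all mixed ones;
    two of them would lie in a module. *)
Lemma anti_unique z : z \notin K -> anti_to K z -> z = z0.
Proof.
move=> zK zA; apply/eqP; apply: contraT => nz.
pose Z := [set z | (z \notin K) && anti_to K z].
have Z1 : 1 < #|Z|.
  by apply/card_gt1P; exists z, z0; rewrite !inE zK zA z0K z0A.
have [k kK] : exists p, p \in K.
  by case/card_gt1P: cardK => p [_ [pK _ _]]; exists p.
have [|v [x [y]]] := primeP (z := k) Z1; first by rewrite inE kK.
rewrite !inE => -[nvZ /andP[xK xA] /andP[yK yA] vx vy].
have vK : v \notin K by apply: contraL vx => vK; rewrite e_sym (anti_toP xA).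
have [vM|vM] := boolP (mixed K v).
  by rewrite e_sym maxK in vy.
have [vC|vC] := boolP (complete_to K v).
  by rewrite (negPf (complete_not_anti vK vC xK xA)) in vx.
by rewrite vK trichotomy in nvZ.
Qed.

(** A complete vertex c misses each mixed vertex v, by a kite with z0.  Then the
    neighbours of v in K are stable, and further kites with c show that the
    others are adjacent to all of them, which cuts K in the complement. *)
Lemma no_complete c : c \notin K -> ~~ complete_to K c.
Proof.
move=> cK; apply/negP=> cC.
have [v vK vM] := exists_mixed.
have zv := maxK vK vM z0K z0A.
have ncz : ~~ e c z0 by apply: complete_not_anti.
have [p0 [q0 [p0K q0K vp0 vq0 pq0]]] := mixed_edge vM.
have ncv : ~~ e c v.
  apply/negP=> cv.
  have [cp cq] := (complete_toP cC p0K, complete_toP cC q0K).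
  have [zp zq] := (anti_toP z0A p0K, anti_toP z0A q0K).
  by apply: (kiteF (p:=p0) (q:=c) (r:=v) (s:=q0) (t:=z0)); ad.
have stable p p' : p \in K -> p' \in K -> e v p -> e v p' -> ~~ e p p'.
  move=> pK p'K vp vp'; apply/negP=> pp'.
  have [cp cp'] := (complete_toP cC pK, complete_toP cC p'K).
  have [zp zp'] := (anti_toP z0A pK, anti_toP z0A p'K).
  by apply: (kiteF (p:=p) (q:=p') (r:=v) (s:=c) (t:=z0)); ad.
have spread p k k' : p \in K -> k \in K -> k' \in K -> e v p -> ~~ e v k ->
    ~~ e v k' -> e k p -> e k k' -> e k' p.
  move=> pK kK k'K vp vk vk' kp kk'; apply: contraT => nk'p; exfalso.
  have [cp ck ck'] := And3 (complete_toP cC pK) (complete_toP cC kK) (complete_toP cC k'K).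
  by apply: (kiteF (p:=c) (q:=k) (r:=p) (s:=k') (t:=v)); ad.
have same p p' q : p \in K -> p' \in K -> q \in K -> e v p -> e v p' ->
    ~~ e v q -> e q p -> e q p'.
  move=> pK p'K qK vp vp' vq qp.
  exact: (same_nbr z0A zv pK p'K qK vp vp' vq (stable p p' pK p'K vp vp') qp).
have all_p0 : K \subset [set x | e v x || e x p0].
  apply: (linked_sub linkK p0K); first by rewrite inE vp0.
  move=> u w uK wK; rewrite !inE; have [//|vw /=] := boolP (e v w).
  have [vu _ uw|vu /= up0 uw] := boolP (e v u); last exact: (spread p0 u).
  by apply: (same u); rewrite // e_sym.
apply: (@coclosedF [set x | e v x] p0 q0); rewrite ?inE //.
move=> u w uK wK; rewrite !inE => vu vw; rewrite e_sym; apply: (same p0) => //.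
by have := subsetP all_p0 w wK; rewrite inE (negPf vw).
Qed.

End Maximal.

(** Enlarge the given set by mixed vertices for as long as some vertex remains
    anticomplete to it. *)
Lemma exists_anchor n (K : {set T}) z : #|T| - #|K| <= n -> linked e K ->
  linked (nonadj e) K -> 1 < #|K| -> z \notin K -> anti_to K z ->
  exists (K' : {set T}) a, [/\ linked e K', linked (nonadj e) K', 1 < #|K'|,
    (a \notin K') && anti_to K' a &
    forall v, v \notin K' -> v != a -> e a v && mixed K' v].
Proof.
elim: n K z => [|n IHn] K z leKn lK clK K1 zK zA.
  have : #|K| < #|T| by rewrite -cardsT proper_card // properT; apply: contraNneq zK => ->; rewrite inE.
  by lia.
have [/existsP[v /existsP[w /and5P[vK vM wK wA nwv]]]|no] := boolP
   [exists v, exists w, [&& v \notin K, mixed K v, w \notin K, anti_to K w & ~~ e w v && (v != w)]].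
  have [/exists_inP[p pK vp] /exists_inP[q qK vq]] := andP vM.
  have cKv : #|v |: K| = #|K|.+1 by rewrite cardsU1 vK.
  case/andP: nwv => nwv nvw.
  apply: (IHn (v |: K) w); rewrite ?cKv.
  - by lia.
  - exact: (linked_add e_sym lK pK vp).
  - apply: (linked_add ce_sym clK qK); rewrite /nonadj vq andbT.
    by apply: contraNneq vK => ->.
  - exact: ltnW.
  - by rewrite in_setU1 negb_or eq_sym nvw.
  - apply/forall_inP=> x /setU1P[->//|]; exact: anti_toP.
have maxK v w : v \notin K -> mixed K v -> w \notin K -> anti_to K w -> e w v.
  move=> vK vM wK wA; apply: contraNT no => nwv.
  apply/existsP; exists v; apply/existsP; exists w; rewrite vK vM wK wA nwv /=.
  apply: contraTneq vM => ->; rewrite /mixed negb_and negb_exists_in.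
  by apply/orP; left.
exists K, z; split=> [//|//|//||v vK nvz]; first by rewrite zK.
have [vM|vM] := boolP (mixed K v); first by rewrite maxK.
have [vC|vC] := boolP (complete_to K v).
  by have := no_complete lK clK K1 zK zA maxK vK; rewrite vC.
have := anti_unique lK clK K1 zK zA maxK vK (trichotomy vM vC).
by move/eqP; rewrite (negPf nvz).
Qed.

End Anchor.

(** The situation reached: a vertex a, a core K that a misses, and a rim
    consisting of all other vertices, each of them adjacent to a and mixed on K.
    Every neighbourhood is now shown to split into two cliques. *)
Section Anchored.
Variables (T : finType) (e : rel T).
Hypotheses (e_sym : symmetric e) (e_irr : irreflexive e).
Hypotheses (forkF : fork_free e) (kiteF : kite_free e) (primeP : prime e).

Ltac ad := solve [assumption | done | rewrite e_sym; assumption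
                 | rewrite eq_sym; assumption].

Let ce_sym := nonadj_sym e_sym.

Variables (K : {set T}) (a : T).
Hypotheses (linkK : linked e K) (colinkK : linked (nonadj e) K).
Hypotheses (cardK : 1 < #|K|) (aK : a \notin K) (aA : anti_to e K a).
Hypothesis mixedY : forall v, v \notin K -> v != a -> e a v && mixed e K v.

Let anti x : x \in K -> ~~ e a x := @anti_toP _ e K a x aA.
Let coclosed := coclosedF colinkK.
Let edgeK := edge_of linkK cardK.

Definition rim v := (v \notin K) && (v != a).

Lemma rim_adj v : rim v -> e a v.
Proof. by case/andP=> vK va; case/andP: (mixedY vK va). Qed.

Lemma rim_mixed v : rim v -> mixed e K v.
Proof. by case/andP=> vK va; case/andP: (mixedY vK va). Qed.

Lemma rim_out v x : rim v -> x \in K -> v != x.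
Proof. by case/andP=> vK _ xK; apply: contraNneq vK => ->. Qed.

Lemma rim_same v p p' q : rim v -> p \in K -> p' \in K -> q \in K ->
  e v p -> e v p' -> ~~ e v q -> ~~ e p p' -> e q p -> e q p'.
Proof. by move/rim_adj; exact: (same_nbr e_sym forkF linkK cardK aA). Qed.

(** Let v in the rim split the module W of the core, seeing p but not q, with p
    and q non-adjacent.  Forks centred at vertices that are complete to W show
    that v sees all vertices of the core that miss W; these are then joined
    completely to the vertices that are complete to W, which cuts the core in
    the complement. *)
Lemma no_comodule (W : {set T}) k : W \subset K -> linked (nonadj e) W ->
  1 < #|W| -> k \in K -> k \notin W ->
  (forall r x y, r \in K -> r \notin W -> x \in W -> y \in W -> e r x -> e r y) ->
  False.
Proof.
move=> sWK clW W1 kK kW modW; have inK x := subsetP sWK x.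
have [v [x [y [vW xW yW vx vy]]]] := primeP W1 kW.
have Yv : rim v.
  rewrite /rim; apply/andP; split.
    by apply: contra vy => vK; apply: modW vx.
  by apply: contraTneq vx => ->; apply/anti/inK.
have av := rim_adj Yv.
have [||p [q [pW qW]]] := clW [set x | e v x] x y xW yW; rewrite ?inE //.
move=> vp vq /andP[_ npq].
have [pK qK] := (inK _ pW, inK _ qW).
have toT r t : r \in K -> r \notin W -> e r p -> t \in K -> t \notin W ->
    ~~ e t p -> e r t -> e v t.
  move=> rK rW rp tK tW tp rt; apply: contraT => vt; exfalso.
  have rq : e r q by apply: modW rp.
  have tq : ~~ e t q by apply: contra tp; apply: modW.
  have qt : q != t by apply: contraNneq tW => <-.
  have qp : q != p by apply: contraNneq vq => ->.
  have [ar aq at_] := And3 (anti rK) (anti qK) (anti tK).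
  have [vr|vr] := boolP (e v r).
    by apply: (forkF (a:=r) (b:=q) (c:=t) (d:=v) (f:=a)); ad.
  by apply: (forkF (a:=r) (b:=q) (c:=t) (d:=p) (f:=v)); ad.
have allT : K \subset [set x | [|| x \in W, e x p | e v x]].
  apply: (linked_sub linkK pK); first by rewrite inE pW.
  move=> u w uK wK; rewrite !inE.
  have [//|wW] := boolP (w \in W); have [//|wp /=] := boolP (e w p).
  have [uW _ uw|uW /=] := boolP (u \in W).
    by rewrite (modW w u p) // e_sym in wp.
  have [up _ uw|up /= vu uw] := boolP (e u p); first exact: (toT u).
  apply: contraT => vw; move: wp; rewrite (@rim_same v u p w) //; ad.
have [r rK /andP[rW rp]] : exists2 r, r \in K & (r \notin W) && e r p.
  have [u [r [uK rK uW rW ur]]] := linkK pK kK pW kW.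
  by exists r => //; rewrite rW (modW r u p) // e_sym.
apply: (coclosed (B := [set x | (x \in W) || ~~ e x p]) pK rK).
- by rewrite inE pW.
- by rewrite inE negb_or rW negbK.
move=> u w uK wK; rewrite !inE => uB; rewrite negb_or negbK => /andP[wW wp].
have [uW|uW] := boolP (u \in W); first by rewrite e_sym; apply: modW wp.
rewrite (negPf uW) /= in uB.
have vu : e v u by have := subsetP allT u uK; rewrite inE (negPf uW) (negPf uB).
rewrite e_sym; have [vw|vw] := boolP (e v w).
  apply: contraT => nwu; have wq : e q w by rewrite e_sym; apply: modW wp.
  by case/negP: uB; apply: (modW u q) => //; rewrite e_sym; apply: (@rim_same v w u q).
by apply: (@rim_same v p u w) => //; rewrite e_sym.
Qed.

(** By [rim_same] an anticomponent of the neighbours of v in the core is a module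
    of the core, so it is a single vertex. *)
Lemma rim_clique v p p' : rim v -> p \in K -> p' \in K -> e v p -> e v p' ->
  p != p' -> e p p'.
Proof.
move=> Yv pK p'K vp vp' npp'; apply: contraT => nadj_pp'; exfalso.
pose A := [set x in K | e v x].
have pA : p \in A by rewrite inE pK.
have [W [sWA pW clW closW]] := component ce_sym pA.
have sWK : W \subset K by apply/subsetP=> x /(subsetP sWA); rewrite inE => /andP[].
have vW x : x \in W -> e v x by move/(subsetP sWA); rewrite inE => /andP[].
have p'W : p' \in W.
  by apply: (closW p) => //; rewrite ?inE ?p'K // /nonadj npp'.
have [q qK vq] : exists2 q, q \in K & ~~ e v q.
  by have /andP[_ /exists_inP] := rim_mixed Yv.
apply: (@no_comodule W q) => //.
- by apply/card_gt1P; exists p, p'.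
- by apply: contra vq => /vW.
move=> r x y rK rW xW yW rx; apply: contraT => ry.
have [vr|vr] := boolP (e v r).
  have nyr : y != r by apply: contraNneq rW => <-.
  case/negP: rW; apply: (closW y) => //; first by rewrite inE rK.
  by rewrite /nonadj e_sym ry andbT.
have [||u [w [uW wW]]] := clW [set x | e r x] x y xW yW; rewrite ?inE //.
move=> ru rw /andP[nuw nadj_uw].
have [uK wK] := (subsetP sWK _ uW, subsetP sWK _ wW).
by rewrite (@rim_same v u w r Yv uK wK rK (vW u uW) (vW w wW) vr nadj_uw ru) in rw.
Qed.

Lemma rim_at1 v q p p' : rim v -> q \in K -> ~~ e v q -> p \in K -> p' \in K ->
  e v p -> e v p' -> e q p -> e q p' -> p = p'.
Proof.
move=> Yv qK vq pK p'K vp vp' qp qp'; apply/eqP; apply: contraT => npp'; exfalso.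
have pp' := rim_clique Yv pK p'K vp vp' npp'; have av := rim_adj Yv.
have [ap ap' aq] := And3 (anti pK) (anti p'K) (anti qK).
by apply: (kiteF (p:=p) (q:=p') (r:=v) (s:=q) (t:=a)); ad.
Qed.

Lemma rim_nbr_clique v p x y : rim v -> p \in K -> e v p -> x \in K -> y \in K ->
  e p x -> e p y -> ~~ e v x -> ~~ e v y -> x != y -> e x y.
Proof.
move=> Yv pK vp xK yK px py vx vy nxy; apply: contraT => nxy'; exfalso.
have [ap ax ay] := And3 (anti pK) (anti xK) (anti yK); have av := rim_adj Yv.
by apply: (forkF (a:=p) (b:=x) (c:=y) (d:=v) (f:=a)); ad.
Qed.

Lemma exists_rim : exists v, rim v.
Proof.
have [v vK vM] := exists_mixed primeP cardK aK.
exists v; rewrite /rim vK /=; apply: contraTneq vM => ->.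
rewrite /mixed negb_and negb_exists_in; apply/orP; left; exact: aA.
Qed.

Lemma core_two_cliques u : u \in K -> two_cliques e K u.
Proof.
have [v Yv] := exists_rim; have av := rim_adj Yv.
have /andP[/exists_inP[p pK vp] _] := rim_mixed Yv.
apply: (rooted_two_cliques e_sym e_irr forkF kiteF (leqnn _) linkK av).
- by move=> x xK; apply: anti.
- by exists p.
- by move=> x y *; apply: (rim_clique Yv).
- by move=> q x y *; apply: (rim_at1 Yv (q:=q)).
Qed.

Lemma rim_edge_cover v w p x : rim v -> rim w -> e v w -> p \in K -> e v p ->
  e w p -> x \in K -> e p x -> e v x || e w x.
Proof.
move=> Yv Yw vw pK vp wp xK px; apply: contraT; rewrite negb_or => /andP[vx wx].
have [ap ax] := (anti pK, anti xK); have [av aw] := (rim_adj Yv, rim_adj Yw).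
by exfalso; apply: (kiteF (p:=v) (q:=w) (r:=p) (s:=a) (t:=x)); ad.
Qed.

Lemma rim_edge_private v w p x t : rim v -> rim w -> e v w -> p \in K ->
  e v p -> e w p -> x \in K -> e v x -> ~~ e w x -> t \in K -> e x t -> e v t.
Proof.
move=> Yv Yw vw pK vp wp xK vx wx tK xt; apply: contraT => vt; exfalso.
have npx : p != x by apply: contraNneq wx => <-.
have px := rim_clique Yv pK xK vp vx npx.
have tp : ~~ e t p.
  apply: contra npx => tp; apply/eqP.
  by apply: (rim_at1 Yv tK vt pK xK vp vx tp); rewrite e_sym.
have wt : ~~ e w t.
  apply: contra tp => wt; apply: (rim_clique Yw) => //.
  by apply: contraNneq vt => ->.
by apply: (kiteF (p:=p) (q:=v) (r:=x) (s:=w) (t:=t)); ad.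
Qed.

(** If v and w had a common neighbour p in the core, kites with a and with w would
    propagate along the core and show that v and w together see all of it; p
    would then be adjacent to every other vertex of the core. *)
Lemma rim_edge_disjoint v w p : rim v -> rim w -> e v w -> p \in K ->
  e v p -> e w p -> False.
Proof.
move=> Yv Yw vw pK vp wp; have wv : e w v by rewrite e_sym.
have cover : K \subset [set x | e v x || e w x].
  apply: (linked_sub linkK pK); first by rewrite inE vp.
  move=> u t uK tK; rewrite !inE.
  have [vu _|vu /= wu] := boolP (e v u); last first.
    by move=> ut; rewrite (rim_edge_private Yw Yv wv pK wp vp uK wu vu tK ut) orbT.
  have [wu|wu] := boolP (e w u); first exact: rim_edge_cover.
  by move=> ut; rewrite (rim_edge_private Yv Yw vw pK vp wp uK vu wu tK ut).
have [x xK wx] : exists2 x, x \in K & ~~ e w x.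
  by have /andP[_ /exists_inP] := rim_mixed Yw.
have vx : e v x by have := subsetP cover x xK; rewrite inE (negPf wx) orbF.
have npx : p != x by apply: contraNneq wx => <-.
apply: (coclosed (B := [set p]) pK xK); rewrite ?inE ?eqxx ?(eq_sym x) //.
move=> u t uK tK; rewrite !inE => /eqP -> ntp.
have := subsetP cover t tK; rewrite inE => /orP[vt|wt].
  by apply: (rim_clique Yv) => //; rewrite eq_sym.
by apply: (rim_clique Yw) => //; rewrite eq_sym.
Qed.

(** Vertices of the rim that agree on the core and on a can only be told apart by
    a third vertex of the rim. *)
Lemma rim_separated v w : rim v -> rim w -> v != w ->
  (forall x, x \in K -> e v x = e w x) ->
  exists y, [/\ rim y, y != v, y != w &
    (e y v && ~~ e y w) || (e y w && ~~ e y v)].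
Proof.
move=> Yv Yw nvw vwK.
have cardA : 1 < #|[set v; w]| by rewrite cards2 nvw.
have [|y [x1 [x2]]] := primeP (z := a) cardA.
  rewrite !inE negb_or (eq_sym a) (eq_sym a).
  by case/andP: Yv => _ ->; case/andP: Yw => _ ->.
rewrite !inE negb_or => -[/andP[nyv nyw] x12 x22 yx1 yx2].
exists y; split=> //.
  rewrite /rim; apply/andP; split.
    apply: contraL yx1 => yK; move: yx2.
    by case/orP: x12 => /eqP->; case/orP: x22 => /eqP->; rewrite !(e_sym y) ?vwK // => /negPf->.
  apply: contraNneq yx2 => ->.
  by case/orP: x22 => /eqP->; apply: rim_adj.
case/orP: x12 yx1 => /eqP-> yx1; case/orP: x22 yx2 => /eqP-> yx2.
- by rewrite yx1 in yx2.
- by rewrite yx1 yx2.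
- by rewrite yx1 yx2 orbT.
- by rewrite yx1 in yx2.
Qed.

(** With two common neighbours p and p', [rim_at1] forces v and w to agree on the
    core; a rim vertex that separates them completes a kite on p and p'. *)
Lemma rim_nonedge_common v w p p' : rim v -> rim w -> v != w -> ~~ e v w ->
  p \in K -> p' \in K -> e v p -> e w p -> e v p' -> e w p' -> p = p'.
Proof.
move=> Yv Yw nvw vw pK p'K vp wp vp' wp'; apply/eqP; apply: contraT => npp'.
have pp' := rim_clique Yv pK p'K vp vp' npp'.
have sub v1 w1 x : rim v1 -> rim w1 -> e v1 p -> e w1 p -> e v1 p' -> e w1 p' ->
    x \in K -> e v1 x -> e w1 x.
  move=> Y1 Y2 vp1 wp1 vp1' wp1' xK vx; apply: contraT => wx.
  have nxp : x != p by apply: contraNneq wx => ->.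
  have nxp' : x != p' by apply: contraNneq wx => ->.
  case/eqP: npp'; apply: (rim_at1 Y2 xK wx pK p'K) => //.
    exact: (rim_clique Y1).
  exact: (rim_clique Y1).
have vwK x : x \in K -> e v x = e w x.
  by move=> xK; apply/idP/idP; apply: sub.
have [y [Yy nyv nyw sep]] := rim_separated Yv Yw nvw vwK.
wlog /andP[yv yw] : v w Yv Yw nvw vw vp wp vp' wp' vwK nyv nyw {sep sub} / e y v && ~~ e y w.
  move=> H; case/orP: sep => ?; first exact: (H v w).
  by apply: (H w v) => //; rewrite 1?eq_sym 1?e_sym // => x xK; rewrite vwK.
have yp : ~~ e y p by apply/negP=> yp; apply: (rim_edge_disjoint Yy Yv yv pK).
have yp' : ~~ e y p' by apply/negP=> yp'; apply: (rim_edge_disjoint Yy Yv yv p'K).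
by exfalso; apply: (kiteF (p:=p) (q:=p') (r:=v) (s:=w) (t:=y)); ad.
Qed.

Lemma rim_some v : rim v -> exists2 p, p \in K & e v p.
Proof. by move/rim_mixed/andP=> [/exists_inP]. Qed.

Lemma rim_single_clique v p : rim v -> p \in K ->
  (forall x, x \in K -> e v x = (x == p)) -> forall x y, x \in K -> y \in K ->
  e p x -> e p y -> x != y -> e x y.
Proof.
move=> Yv pK vP x y xK yK px py.
have np z : e p z -> z != p by move=> pz; apply: contraTneq pz => ->; rewrite e_irr.
have vp : e v p by rewrite vP.
by apply: (rim_nbr_clique Yv pK vp) => //; rewrite vP ?np.
Qed.

(** A kite with a shows that the ends of an induced path in the rim see the same
    vertices of the core, so there is just one by [rim_nonedge_common]. *)
Lemma rim_path_single y1 y2 y3 : rim y1 -> rim y2 -> rim y3 -> e y1 y2 ->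
  e y2 y3 -> ~~ e y1 y3 -> y1 != y3 -> exists2 p, p \in K &
  forall x, x \in K -> (e y1 x = (x == p)) * (e y3 x = (x == p)).
Proof.
have sub u1 u2 u3 x : rim u1 -> rim u2 -> rim u3 -> e u1 u2 -> e u2 u3 ->
    ~~ e u1 u3 -> x \in K -> e u1 x -> e u3 x.
  move=> Y1 Y2 Y3 e12 e23 e13 xK u1x; apply: contraT => u3x.
  have u2x : ~~ e u2 x.
    by apply/negP=> u2x; apply: (rim_edge_disjoint Y1 Y2 e12 xK).
  have ax := anti xK; have [a1 a2 a3] := And3 (rim_adj Y1) (rim_adj Y2) (rim_adj Y3).
  by exfalso; apply: (kiteF (p:=a) (q:=u2) (r:=u1) (s:=u3) (t:=x)); ad.
move=> Y1 Y2 Y3 e12 e23 e13 n13; have [p pK y1p] := rim_some Y1.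
have s13 x : x \in K -> e y1 x -> e y3 x by apply: (sub y1 y2 y3).
have s31 x : x \in K -> e y3 x -> e y1 x by apply: (sub y3 y2 y1) => //; ad.
exists p => // x xK; split.
  apply/idP/eqP=> [y1x|->//]; apply: (rim_nonedge_common Y1 Y3) => //; auto.
apply/idP/eqP=> [y3x|->]; last by auto.
apply: (rim_nonedge_common Y1 Y3) => //; auto.
Qed.

Lemma core_not_edge p r : p \in K -> r \in K ->
  (forall x, x \in K -> e p x -> x = r) -> (forall x, x \in K -> e r x -> x = p) ->
  False.
Proof.
move=> pK rK pN rN; have [y yK py] := edgeK pK.
have pr : e p r by rewrite -(pN y yK py).
have npr : r != p by apply: contraTneq pr => ->; rewrite e_irr.
apply: (coclosed (B := [set p]) pK rK); rewrite ?inE //.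
move=> u v uK vK; rewrite !inE => /eqP-> nvp.
have : K \subset [set p; r].
  apply: (linked_sub linkK pK); first by rewrite !inE eqxx.
  move=> x z xK zK; rewrite !inE => /orP[/eqP->|/eqP->].
    by move/(pN _ zK)->; rewrite eqxx orbT.
  by move/(rN _ zK)->; rewrite eqxx.
by move/subsetP/(_ v vK); rewrite !inE (negPf nvp) => /eqP->.
Qed.

(** The ends of an induced path in the rim have the same single neighbour p in the
    core.  A rim vertex separating them would see all neighbours of p, and this
    leaves room for a single edge in the core, which is not co-connected. *)
Lemma rim_P3_free y1 y2 y3 : rim y1 -> rim y2 -> rim y3 -> e y1 y2 ->
  e y2 y3 -> y1 != y3 -> e y1 y3.
Proof.
move=> Y1 Y2 Y3 e12 e23 n13; apply: contraT => e13; exfalso.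
have [p pK P13] := rim_path_single Y1 Y2 Y3 e12 e23 e13 n13.
have same x : x \in K -> e y1 x = e y3 x by move=> xK; rewrite !P13.
have [y4 [Y4 n41 n43 sep]] := rim_separated Y1 Y3 n13 same.
wlog /andP[e41 e43] : y1 y3 Y1 Y3 e12 e23 n13 e13 P13 n41 n43 {sep same} /
    e y4 y1 && ~~ e y4 y3.
  move=> H; case/orP: sep => ?; first exact: (H y1 y3).
  by apply: (H y3 y1) => //; rewrite 1?eq_sym 1?e_sym // => x xK; rewrite !P13.
have P1 x : x \in K -> e y1 x = (x == p) by move=> /P13[].
have P3 x : x \in K -> e y3 x = (x == p) by move=> /P13[].
have y1p : e y1 p by rewrite P1.
have y3p : e y3 p by rewrite P3.
have np z : e p z -> z != p by move=> pz; apply: contraTneq pz => ->; rewrite e_irr.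
have y4p : ~~ e y4 p by apply/negP=> y4p; apply: (rim_edge_disjoint Y4 Y1 e41 pK).
have y4N r : r \in K -> e p r -> e y4 r.
  move=> rK pr; apply: contraT => y4r; exfalso.
  have [r1 r3] : ~~ e y1 r /\ ~~ e y3 r by rewrite P1 // P3 // np.
  have n3r : r != y3 by rewrite eq_sym; apply: rim_out.
  by apply: (forkF (a:=p) (b:=r) (c:=y3) (d:=y1) (f:=y4)); ad.
have [r rK pr] := edgeK pK.
have n42 : y4 != y2 by apply: contraNneq e43 => ->.
have y4r := y4N r rK pr.
have [e42|e42] := boolP (e y4 y2).
  have [q qK Pq] := rim_path_single Y4 Y2 Y3 e42 e23 e43 n43.
  have := (Pq r rK).1; rewrite y4r -(Pq r rK).2 P3 // => /esym/eqP rp.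
  by rewrite rp e_irr in pr.
have n24 : y2 != y4 by rewrite eq_sym.
have [q qK Pq] := rim_path_single Y2 Y1 Y4 (ltac:(ad)) (ltac:(ad)) (ltac:(ad)) n24.
have P4 x : x \in K -> e y4 x = (x == q) by case/Pq.
have rq : r = q by apply/eqP; rewrite -P4.
have pN x : x \in K -> e p x -> x = r.
  by move=> xK px; rewrite rq; apply/eqP; rewrite -P4 // y4N.
apply: (core_not_edge pK rK pN) => x xK rx; apply/eqP; apply: contraT => nxp.
have : e p x.
  apply: (rim_single_clique Y4 rK) => //; first by move=> y yK; rewrite P4 // rq.
    by rewrite e_sym.
  by rewrite eq_sym.
by move/(pN x xK)=> xr; rewrite xr e_irr in rx.
Qed.

(** A neighbour in the core of one of the three is seen by a second one, because
    of a fork centred at a.  If all three share a neighbour, it is their only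
    one, and a fourth rim vertex that separates two of them would see it as well.
    If not, the neighbours shared by the pairs form a connected component of the
    core that is a single edge. *)
Lemma rim_no_stable3 y1 y2 y3 : rim y1 -> rim y2 -> rim y3 -> y1 != y2 ->
  y2 != y3 -> y1 != y3 -> ~~ e y1 y2 -> ~~ e y2 y3 -> ~~ e y1 y3 -> False.
Proof.
have two u1 u2 u3 x : rim u1 -> rim u2 -> rim u3 -> u2 != u3 -> ~~ e u1 u2 ->
    ~~ e u2 u3 -> ~~ e u1 u3 -> x \in K -> e u1 x -> e u2 x || e u3 x.
  move=> Y1 Y2 Y3 n23 e12 e23 e13 xK u1x; apply: contraT.
  rewrite negb_or => /andP[u2x u3x].
  have ax := anti xK; have [a1 a2 a3] := And3 (rim_adj Y1) (rim_adj Y2) (rim_adj Y3).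
  by exfalso; apply: (forkF (a:=a) (b:=u2) (c:=u3) (d:=u1) (f:=x)); ad.
move=> Y1 Y2 Y3 n12 n23 n13 e12 e23 e13.
have n32 : y3 != y2 by rewrite eq_sym.
have n31 : y3 != y1 by rewrite eq_sym.
have n21 : y2 != y1 by rewrite eq_sym.
have [/exists_inP[p pK /and3P[y1p y2p y3p]]|nocommon] :=
    boolP [exists p in K, [&& e y1 p, e y2 p & e y3 p]].
  have only u1 u2 u3 x : rim u1 -> rim u2 -> rim u3 -> u1 != u2 -> u2 != u3 ->
      u1 != u3 -> ~~ e u1 u2 -> ~~ e u2 u3 -> ~~ e u1 u3 -> e u1 p -> e u2 p ->
      e u3 p -> x \in K -> e u1 x = (x == p).
    move=> Z1 Z2 Z3 m12 m23 m13 f12 f23 f13 p1 p2 p3 xK.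
    apply/idP/eqP=> [u1x|->//].
    case/orP: (two u1 u2 u3 x Z1 Z2 Z3 m23 f12 f23 f13 xK u1x) => ux.
      exact: (rim_nonedge_common Z1 Z2).
    exact: (rim_nonedge_common Z1 Z3).
  have P1 x : x \in K -> e y1 x = (x == p) by apply: (only y1 y2 y3).
  have P2 x : x \in K -> e y2 x = (x == p) by apply: (only y2 y1 y3) => //; ad.
  have P3 x : x \in K -> e y3 x = (x == p) by apply: (only y3 y1 y2) => //; ad.
  have same x : x \in K -> e y1 x = e y2 x by move=> xK; rewrite P1 ?P2.
  have [y4 [Y4 n41 n42 sep]] := rim_separated Y1 Y2 n12 same.
  wlog /andP[e41 e42] : y1 y2 Y1 Y2 {same} sep P1 P2 n12 n23 n13 e12 e23 e13 n32 n31 n21 y1p y2p n41 n42 /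
      e y4 y1 && ~~ e y4 y2.
    move=> H; case/orP: (sep) => ?; first exact: (H y1 y2).
    by apply: (H y2 y1) => //; rewrite 1?orbC // e_sym.
  have n43 : y4 != y3 by apply: contraNneq e13 => <-; rewrite e_sym.
  have e43 : ~~ e y4 y3.
    apply: contra e13 => e43; apply: (rim_P3_free Y1 Y4 Y3) => //; ad.
  have [q qK y4q] := rim_some Y4.
  have qp : q = p.
    have := two y4 y2 y3 q Y4 Y2 Y3 n23 e42 e23 e43 qK y4q.
    by rewrite P2 // P3 // orbb => /eqP.
  by apply: (rim_edge_disjoint Y4 Y1 e41 qK) => //; rewrite qp.
have nc p : p \in K -> e y1 p -> e y2 p -> e y3 p -> False.
  by move=> pK *; case/negP: nocommon; apply/exists_inP; exists p => //; apply/and3P.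
have main u1 u2 u3 p s : rim u1 -> rim u2 -> rim u3 -> u1 != u2 -> u2 != u3 ->
    u1 != u3 -> ~~ e u1 u2 -> ~~ e u2 u3 -> ~~ e u1 u3 ->
    (forall q, q \in K -> e u1 q -> e u2 q -> e u3 q -> False) ->
    p \in K -> s \in K -> e u1 p -> e u2 p -> e u1 s -> e u3 s -> False.
  move=> Z1 Z2 Z3 m12 m23 m13 f12 f23 f13 nc' pK sK p1 p2 s1 s3.
  have nps : p != s by apply/eqP=> ps; apply: (nc' p) => //; rewrite ps.
  have ps := rim_clique Z1 pK sK p1 s1 nps.
  have no23 x : x \in K -> e u2 x -> e u3 x -> False.
    move=> xK x2 x3.
    have x1 : ~~ e u1 x by apply/negP=> x1; apply: (nc' x).
    have nxp : x != p by apply: contraNneq x1 => ->.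
    have nxs : x != s by apply: contraNneq x1 => ->.
    case/eqP: nps; apply: (rim_at1 Z1 xK x1) => //.
      exact: (rim_clique Z2).
    exact: (rim_clique Z3).
  have m21 : u2 != u1 by rewrite eq_sym.
  have m31 : u3 != u1 by rewrite eq_sym.
  have m32 : u3 != u2 by rewrite eq_sym.
  have P2 x : x \in K -> e u2 x = (x == p).
    move=> xK; apply/idP/eqP=> [x2|->//].
    case/orP: (two u2 u1 u3 x Z2 Z1 Z3 m13 (ltac:(ad)) f13 f23 xK x2) => [x1|x3].
      exact: (rim_nonedge_common Z1 Z2).
    by case: (no23 x).
  have P3 x : x \in K -> e u3 x = (x == s).
    move=> xK; apply/idP/eqP=> [x3|->//].
    case/orP: (two u3 u1 u2 x Z3 Z1 Z2 m12 (ltac:(ad)) f12 (ltac:(ad)) xK x3) => [x1|x2].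
      exact: (rim_nonedge_common Z1 Z3).
    by case: (no23 x).
  have P1 x : x \in K -> e u1 x -> (x == p) || (x == s).
    by move=> xK x1; rewrite -P2 // -P3 //; apply: (two u1 u2 u3).
  have near q q' : q \in K -> q' \in K -> e u1 q -> e u1 q' -> e q q' -> q != q' ->
      (forall x y, x \in K -> y \in K -> e q x -> e q y -> x != y -> e x y) ->
      (forall x, x \in K -> e u1 x -> (x == q) || (x == q')) ->
      forall x, x \in K -> e q x -> x = q'.
    move=> qK q'K q1 q1' qq' nqq' clq P1' x xK qx; apply/eqP; apply: contraT => nxq'.
    have nxq : x != q by apply: contraTneq qx => ->; rewrite e_irr.
    have x1 : ~~ e u1 x.
      by apply: contra nxq' => /(P1' x xK); rewrite (negPf nxq).
    case/eqP: nqq'; apply: (rim_at1 Z1 xK x1) => //; first by rewrite e_sym.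
    by apply: clq.
  apply: (core_not_edge pK sK).
    by apply: near => //; apply: (rim_single_clique Z2).
  apply: near => //; [by rewrite e_sym|by rewrite eq_sym| |].
    exact: (rim_single_clique Z3).
  by move=> x xK /(P1 x xK); rewrite orbC.
have [p pK y1p] := rim_some Y1; have [s sK y3s] := rim_some Y3.
have [t tK y2t] := rim_some Y2.
case/orP: (two y1 y2 y3 p Y1 Y2 Y3 n23 e12 e23 e13 pK y1p) => yp.
  case/orP: (two y3 y1 y2 s Y3 Y1 Y2 n12 (ltac:(ad)) e12 (ltac:(ad)) sK y3s) => ys.
    exact: (main y1 y2 y3 p s).
  by apply: (main y2 y1 y3 p s) => //; try ad; move=> q qK q1 q2 q3; apply: (nc q).
case/orP: (two y2 y1 y3 t Y2 Y1 Y3 n13 (ltac:(ad)) e13 e23 tK y2t) => yt.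
  by apply: (main y1 y3 y2 p t) => //; try ad; move=> q qK q1 q2 q3; apply: (nc q).
by apply: (main y3 y1 y2 p t) => //; try ad; move=> q qK q1 q2 q3; apply: (nc q).
Qed.

Lemma vertex_cases v : [|| v == a, v \in K | rim v].
Proof. by rewrite /rim; case: (v == a); case: (v \in K). Qed.

(** For u = a the two cliques come from [rim_P3_free] and [rim_no_stable3].  A
    vertex u of the core sees at most two rim vertices, which are non-adjacent,
    and each of them takes one of the two cliques of u in the core.  For u in the
    rim one clique lies in the core and the other contains a. *)
Lemma anchored_line_like : line_like e.
Proof.
apply: two_cliques_line_like => u.
have rimN x : e a x -> rim x.
  move=> ax; case/or3P: (vertex_cases x) => [/eqP xa|xK|//].
    by rewrite xa e_irr in ax.
  by rewrite (negPf (anti xK)) in ax.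
case/or3P: (vertex_cases u) => [/eqP->|uK|Yu].
- have [/existsP[w aw]|no] := boolP [exists w, e a w]; last first.
    exists set0 => x y _ _ ax; case/existsP: no; by exists x.
  exists [set x | (x == w) || e w x] => x y _ _ ax ay nxy; rewrite !inE.
  have [Yw Yx Yy] := And3 (rimN _ aw) (rimN _ ax) (rimN _ ay).
  have [xw|nxw] := eqVneq x w.
    have nyw : y != w by rewrite -xw eq_sym.
    by rewrite xw (negPf nyw) /=; case: (e w y).
  have [->|nyw] := eqVneq y w; first by rewrite /= e_sym; case: (e w x).
  have [wx|wx] := boolP (e w x); have [wy|wy] := boolP (e w y) => //=.
  - by apply: (rim_P3_free Yx Yw Yy) => //; rewrite e_sym.
  - by apply: contraNF wy => xy; apply: (rim_P3_free Yw Yx Yy) => //; rewrite eq_sym.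
  - apply: contraNF wx => xy; apply: (rim_P3_free Yw Yy Yx) => //; first by rewrite e_sym.
    by rewrite eq_sym.
  - apply: contraT => nxy'; exfalso.
    by apply: (rim_no_stable3 Yw Yx Yy) => //; rewrite eq_sym.
- have [X0 hX0] := core_two_cliques uK.
  have uN x : e u x -> x \in K \/ rim x.
    move=> ux; case/or3P: (vertex_cases x) => [/eqP xa|xK|Yx]; [|by left|by right].
    by rewrite e_sym xa (negPf (anti uK)) in ux.
  have [/existsP[v /andP[Yv uv]]|no] := boolP [exists v, rim v && e u v]; last first.
    have inK x : e u x -> x \in K.
      move=> ux; case: (uN x ux) => // Yx.
      by case/existsP: no; exists x; rewrite Yx.
    by exists X0 => x y _ _ ux uy; apply: hX0; auto.
  have vu : e v u by rewrite e_sym.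
  have at1 x y : x \in K -> y \in K -> e u x -> e u y -> e v x -> ~~ e v y -> ~~ e x y.
    move=> xK yK ux uy vx vy; apply/negP=> xy.
    have := rim_at1 Yv yK vy xK uK vx vu; rewrite !(e_sym y) xy uy => /(_ isT isT) xu.
    by rewrite xu e_irr in ux.
  have inKK x y : x \in K -> y \in K -> e u x -> e u y -> x != y ->
      e x y = (e v x == e v y).
    move=> xK yK ux uy nxy.
    have [vx|vx] := boolP (e v x); have [vy|vy] := boolP (e v y) => /=.
    - exact: (rim_clique Yv).
    - by apply/negbTE/at1.
    - by rewrite e_sym; apply/negbTE/at1.
    - exact: (rim_nbr_clique Yv uK).
  (* With one rim neighbour v, this vertex joins the clique of the neighbours
     that it sees; with two, each of them determines a clique. *)
  have [/existsP[w /and3P[Yw uw nwv]]|no2] :=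
      boolP [exists w, [&& rim w, e u w & w != v]]; last first.
    exists (v |: [set x | e v x]) => x y _ _ ux uy nxy; rewrite !inE.
    have inK z : e u z -> z != v -> z \in K.
      move=> uz nzv; case: (uN z uz) => // Yz.
      by case/existsP: no2; exists z; rewrite Yz uz.
    have [xv|nxv] := eqVneq x v.
      have nyv : y != v by rewrite -xv eq_sym.
      by rewrite xv (negPf nyv) /=; case: (e v y).
    have [->|nyv] := eqVneq y v; first by rewrite /= e_sym; case: (e v x).
    by apply: inKK => //; apply: inK.
  have wu : e w u by rewrite e_sym.
  have vw : ~~ e v w by apply/negP=> vw; apply: (rim_edge_disjoint Yv Yw vw uK).
  have nvw : v != w by rewrite eq_sym.
  have uN' x : e u x -> [|| x \in K, x == v | x == w].
    move=> ux; case: (uN x ux) => [->//|Yx]; apply: contraT.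
    rewrite !negb_or => /and3P[_ nxv nxw]; exfalso.
    have [vx|vx] := boolP (e v x); first by apply: (rim_edge_disjoint Yv Yx vx uK); rewrite // e_sym.
    have [wx|wx] := boolP (e w x); first by apply: (rim_edge_disjoint Yw Yx wx uK); rewrite // e_sym.
    by apply: (rim_no_stable3 Yv Yw Yx) => //; rewrite eq_sym.
  have both x : x \in K -> e u x -> e v x -> ~~ e w x.
    move=> xK ux vx; apply/negP=> wx.
    have xu := rim_nonedge_common Yv Yw nvw vw xK uK vx wx vu wu.
    by rewrite xu e_irr in ux.
  have some x : x \in K -> e u x -> ~~ e v x -> e w x.
    move=> rK ur vr; apply: contraT => wr; exfalso; set r := x in rK ur vr wr.
    have single v1 w1 : rim v1 -> rim w1 -> e v1 u -> e w1 u -> ~~ e v1 r ->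
        ~~ e w1 r -> (forall x, x \in K -> e u x -> e v1 x -> ~~ e w1 x) ->
        forall x, x \in K -> e v1 x = (x == u).
      move=> Z1 Z2 u1 u2 r1 r2 both1 y yK; apply/idP/eqP=> [y1|->//].
      apply/eqP; apply: contraT => nyu; exfalso.
      have uy : e u y by apply: (rim_clique Z1) => //; rewrite eq_sym.
      have y2 := both1 y yK uy y1.
      have nry : r != y by apply: contraNneq r1 => ->.
      have ry : e r y by apply: (rim_nbr_clique Z2 uK u2 rK yK ur uy).
      case/eqP: nyu; apply: (rim_at1 Z1 rK r1 yK uK y1 u1 ry).
      by rewrite e_sym.
    have bothwv y : y \in K -> e u y -> e w y -> ~~ e v y.
      by move=> yK uy; apply: contraL => vy; apply: both.
    have Pv := single v w Yv Yw vu wu vr wr both.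
    have Pw := single w v Yw Yv wu vu wr vr bothwv.
    have nu z : e u z -> z != u by move=> uz; apply: contraTneq uz => ->; rewrite e_irr.
    have cov : K \subset [set z | (z == u) || e u z].
      apply: (linked_sub linkK uK); first by rewrite inE eqxx.
      move=> s t sK tK; rewrite !inE => /orP[/eqP->->|us st]; first by rewrite orbT.
      have [//|ntu /=] := eqVneq t u; apply: contraT => ut; exfalso.
      have [sv sw] : ~~ e v s /\ ~~ e w s by rewrite Pv // Pw // nu.
      have [tv tw] : ~~ e v t /\ ~~ e w t by rewrite Pv // Pw.
      by apply: (forkF (a:=u) (b:=v) (c:=w) (d:=s) (f:=t)); ad.
    apply: (coclosed (B := [set u]) uK rK); rewrite ?inE ?nu //.
    move=> s t sK tK; rewrite !inE => /eqP-> ntu.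
    by have := subsetP cov t tK; rewrite inE (negPf ntu).
  have wE x : x \in K -> e u x -> e w x = ~~ e v x.
    move=> xK ux; apply/idP/idP=> [|vx]; last exact: some.
    by apply: contraL => vx; apply: both.
  exists (v |: [set x in K | e v x]) => x y _ _ ux uy nxy; rewrite !inE.
  have [vK wK] : v \notin K /\ w \notin K by case/andP: Yv; case/andP: Yw.
  case/or3P: (uN' x ux) => [xK|/eqP xv|/eqP xw].
  + have nxv : x != v by apply: contraNneq vK => <-.
    rewrite (negPf nxv) xK /=.
    case/or3P: (uN' y uy) => [yK|/eqP yv|/eqP yw].
    * have nyv : y != v by apply: contraNneq vK => <-.
      by rewrite (negPf nyv) yK /=; apply: inKK.
    * by rewrite yv eqxx /= e_sym; case: (e v x).
    * by rewrite yw (negPf nwv) (negPf wK) /= e_sym wE //; case: (e v x).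
  + rewrite xv eqxx /=; case/or3P: (uN' y uy) => [yK|/eqP yv|/eqP yw].
    * have nyv : y != v by apply: contraNneq vK => <-.
      by rewrite (negPf nyv) yK /=; case: (e v y).
    * by rewrite xv yv eqxx in nxy.
    * by rewrite yw (negPf nwv) (negPf wK) /=; apply/negbTE.
  + rewrite xw (negPf nwv) (negPf wK) /=.
    case/or3P: (uN' y uy) => [yK|/eqP yv|/eqP yw].
    * have nyv : y != v by apply: contraNneq vK => <-.
      by rewrite (negPf nyv) yK /= wE //; case: (e v y).
    * by rewrite yv eqxx /= e_sym; apply/negbTE.
    * by rewrite xw yw eqxx in nxy.
- have au := rim_adj Yu.
  have uN x : e u x -> [|| x == a, (x \in K) && e u x | rim x].
    by move=> ux; rewrite ux andbT; apply: vertex_cases.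
  exists [set x in K | e u x] => x y _ _ ux uy nxy; rewrite !inE ux uy !andbT.
  have KY p w : p \in K -> rim w -> e u p -> e u w -> ~~ e p w.
    move=> pK Yw up uw; apply/negP=> pw.
    by apply: (rim_edge_disjoint Yu Yw uw pK up); rewrite e_sym.
  have rK w : rim w -> (w \in K) = false by case/andP=> /negbTE.
  case/or3P: (vertex_cases x) => [/eqP xa|xK|Yx];
    case/or3P: (vertex_cases y) => [/eqP ya|yK|Yy].
  + by rewrite xa ya eqxx in nxy.
  + by rewrite xa yK (negPf aK); apply/negbTE/anti.
  + by rewrite xa (negPf aK) (rK y) // rim_adj.
  + by rewrite ya xK (negPf aK) e_sym; apply/negbTE/anti.
  + by rewrite xK yK; apply: (rim_clique Yu).
  + by rewrite xK (rK y) //; apply/negbTE/KY.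
  + by rewrite ya (negPf aK) (rK x) // e_sym rim_adj.
  + by rewrite yK (rK x) // e_sym; apply/negbTE/KY.
  + by rewrite !rK //; apply: (rim_P3_free Yx Yu Yy) => //; rewrite e_sym.
Qed.

End Anchored.

(** This settles every prime graph in which some vertex misses a four-vertex path,
    since a path on four vertices is connected and co-connected. *)
Theorem prime_coanchor_line_like (T : finType) (e : rel T) (K : {set T}) z :
  symmetric e -> irreflexive e -> fork_free e -> kite_free e -> prime e ->
  linked e K -> linked (nonadj e) K -> 1 < #|K| -> z \notin K ->
  (forall x, x \in K -> ~~ e z x) -> line_like e.
Proof.
move=> e_sym e_irr forkF kiteF primeP lK clK K1 zK zA.
have [K' [a [lK' clK' K1' /andP[aK' aA'] mixY]]] :=
  exists_anchor e_sym e_irr forkF kiteF primeP (leqnn _) lK clK K1 zK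
    (introT forall_inP zA).
exact: (anchored_line_like e_sym e_irr forkF kiteF primeP lK' clK' K1' aK' aA' mixY).
Qed.

(** * Exhaustive search over small extensions of a configuration *)

(** Quantifiers by conditionals, so that evaluation stops at the first
    counterexample or witness even when arguments are computed eagerly. *)
Section LazyQuantifiers.
Variable A : Type.

Fixpoint lazy_all (a : A -> bool) (s : seq A) :=
  if s is x :: s' then if a x then lazy_all a s' else false else true.

Fixpoint lazy_has (a : A -> bool) (s : seq A) :=
  if s is x :: s' then if a x then true else lazy_has a s' else false.

Lemma lazy_allE a s : lazy_all a s = all a s.
Proof. by elim: s => //= x s ->; case: (a x). Qed.

Lemma lazy_hasE a s : lazy_has a s = has a s.
Proof. by elim: s => //= x s ->; case: (a x). Qed.

End LazyQuantifiers.

Section Matrices.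

(** The adjacency matrix of a list of vertices is stored above the diagonal: the
    row of a vertex lists its adjacencies to the vertices that come after it.  A
    new vertex is put in front, so it adds one row and changes no other. *)
Definition entry (m : seq (seq bool)) i j := nth false (nth [::] m i) (j - i).-1.

Definition sym_entry m i j :=
  if i < j then entry m i j else (j < i) && entry m j i.

Fixpoint minor (m : seq (seq bool)) (idx : seq nat) :=
  if idx is i :: idx' then map (entry m i) idx' :: minor m idx' else [::].

Fixpoint combs k (s : seq nat) : seq (seq nat) :=
  match k, s with
  | 0, _ => [:: [::]]
  | _.+1, [::] => [::]
  | k'.+1, x :: s' => map (cons x) (combs k' s') ++ combs k s'
  end.

Fixpoint rows_of k : seq (seq bool) :=
  if k is k'.+1 then map (cons true) (rows_of k') ++ map (cons false) (rows_of k')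
  else [:: [::]].

Variable bad : seq (seq bool) -> bool.

Definition ok_top (m : seq (seq bool)) :=
  lazy_all (fun s => ~~ bad (minor m s))
      (map (fun s => 0 :: s) (combs 4 (iota 1 (size m).-1))).

(** For a matrix whose first two vertices are new, submatrices that miss one of
    them have been tested before. *)
Definition ok_top2 (m : seq (seq bool)) :=
  lazy_all (fun s => ~~ bad (minor m s))
      (map (fun s => 0 :: 1 :: s) (combs 3 (iota 2 (size m).-2))).

Definition new_rows (m : seq (seq bool)) (rows : seq (seq bool)) :=
  [seq r <- map (cons true) rows ++ map (cons false) rows | ok_top2 (r :: m)].

Definition odd_matrix m := lazy_all (fun i =>
    lazy_all (fun t => if t is [:: j; k; l] then
        sym_entry m j k (+) sym_entry m k l (+) sym_entry m j l else true)
      (combs 3 (filter (sym_entry m i) (iota 0 (size m)))))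
  (iota 0 (size m)).

(** Here rows are the adjacency rows that a vertex outside the present list can
    still have.  The search adds up to k vertices in all ways that create no bad
    submatrix of order 5, and checks that all resulting graphs are line-like. *)
Fixpoint search k m rows : bool :=
  if odd_matrix m then
    if k is k'.+1 then
      lazy_all (fun r => let m' := r :: m in search k' m' (new_rows m' rows)) rows
    else true
  else false.

Variables (T : finType) (e : rel T).
Hypotheses (e_sym : symmetric e) (e_irr : irreflexive e).

Fixpoint adj_matrix (g : seq T) :=
  if g is v :: g' then map (e v) g' :: adj_matrix g' else [::].

Lemma size_adj_matrix g : size (adj_matrix g) = size g.
Proof. by elim: g => //= v g ->. Qed.

Lemma entry_adj_matrix x0 g i j : i < j -> j < size g ->
  entry (adj_matrix g) i j = e (nth x0 g i) (nth x0 g j).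
Proof.
rewrite /entry; elim: g i j => // v g IHg [|i] [|j] //= ltij ltj.
  by rewrite (nth_map x0).
by rewrite subSS IHg.
Qed.

Lemma sym_entry_adj_matrix x0 g i j : i < size g -> j < size g ->
  sym_entry (adj_matrix g) i j = e (nth x0 g i) (nth x0 g j).
Proof.
move=> lti ltj; rewrite /sym_entry; case: ltngtP => [ij|ji|->] /=.
- exact: entry_adj_matrix.
- by rewrite (entry_adj_matrix x0) // e_sym.
- by rewrite e_irr.
Qed.

Lemma minor_adj_matrix x0 g idx : sorted ltn idx -> all (gtn (size g)) idx ->
  minor (adj_matrix g) idx = adj_matrix (map (nth x0 g) idx).
Proof.
elim: idx => //= i idx IH srt /andP[lti lts].
rewrite IH ?(path_sorted srt) //; congr cons; rewrite -map_comp.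
apply/eq_in_map=> j jidx /=; apply: entry_adj_matrix.
  by move: (order_path_min ltn_trans srt) => /allP/(_ j jidx).
exact: (allP lts).
Qed.

Lemma combs_subseq k s t : t \in combs k s -> subseq t s /\ size t = k.
Proof.
elim: s k t => [|x s IHs] [|k] t //=; rewrite ?inE; try by move/eqP->.
rewrite mem_cat => /orP[/mapP[t' /IHs[sub sz] ->]|/IHs[sub sz]].
  by rewrite /= eqxx sz.
by split=> //; exact: (subseq_trans sub (subseq_cons s x)).
Qed.

Hypothesis bad5 : forall g, uniq g -> size g = 5 -> ~~ bad (adj_matrix g).

Lemma minor_ok (x0 : T) g idx : uniq g -> sorted ltn idx -> all (gtn (size g)) idx ->
  size idx = 5 -> ~~ bad (minor (adj_matrix g) idx).
Proof.
move=> Ug srt lts sz; rewrite (minor_adj_matrix x0) //.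
apply: bad5; last by rewrite size_map.
rewrite map_inj_in_uniq; first exact: sorted_uniq ltn_trans ltnn _ srt.
move=> i j /(allP lts) lti /(allP lts) ltj /eqP; rewrite nth_uniq //.
by move/eqP.
Qed.

Lemma iota_sub_sorted a k s t : t \in combs k (iota a s) ->
  [/\ sorted ltn t, all (fun i => a <= i < a + s) t & size t = k].
Proof.
case/combs_subseq=> sub sz; split=> //.
  exact: (subseq_sorted ltn_trans sub (iota_ltn_sorted _ _)).
by apply/allP=> i /(mem_subseq sub); rewrite mem_iota.
Qed.

Lemma ok_top_adj_matrix (g : seq T) : uniq g -> ok_top (adj_matrix g).
Proof.
case: g => [|x0 g] Ug //; rewrite /ok_top lazy_allE; apply/allP=> s /mapP[t].
rewrite size_adj_matrix /= => /iota_sub_sorted[srt bnd sz] ->.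
apply: (@minor_ok x0 (x0 :: g)) => //=; last by rewrite sz.
  rewrite path_min_sorted //; apply/allP=> i /(allP bnd) /=.
  by case/andP.
by apply/allP=> i /(allP bnd) /= /andP[_]; rewrite add1n.
Qed.

Lemma ok_top2_adj_matrix (g : seq T) : uniq g -> ok_top2 (adj_matrix g).
Proof.
case: g => [|x0 [|x1 g]] Ug //; rewrite /ok_top2 lazy_allE; apply/allP=> s /mapP[t].
rewrite size_adj_matrix /= => /iota_sub_sorted[srt bnd sz] ->.
apply: (@minor_ok x0 [:: x0, x1 & g]) => //=; last by rewrite sz.
  rewrite path_min_sorted //; apply/allP=> i /(allP bnd) /=.
  by case/andP.
by apply/allP=> i /(allP bnd) /= /andP[_].
Qed.

Lemma rows_of_bits k r : size r = k -> r \in rows_of k.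
Proof.
elim: k r => [|k IHk] [|[] r] //= [/IHk kr]; rewrite mem_cat.
  by rewrite map_f.
by rewrite (map_f (cons false) kr) orbT.
Qed.

Lemma mem_combs3 s i j l : subseq [:: i; j; l] s -> [:: i; j; l] \in combs 3 s.
Proof.
have mem0 t : [::] \in combs 0 t by case: t.
have mem1 a t : a \in t -> [:: a] \in combs 1 t.
  elim: t => //= b t IH; rewrite inE mem_cat => /orP[/eqP->|/IH->]; last by rewrite orbT.
  by rewrite (map_f (cons b)).
have mem2 a b t : subseq [:: a; b] t -> [:: a; b] \in combs 2 t.
  elim: t => //= c t IH; case: ifP => [/eqP->|_]; rewrite mem_cat; last by move/IH->; rewrite orbT.
  by rewrite sub1seq => /mem1 H; rewrite (map_f (cons c) H).
elim: s => //= c t IH; case: ifP => [/eqP->|_]; rewrite mem_cat; last by move/IH->; rewrite orbT.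
by move/mem2 => H; rewrite (map_f (cons c) H).
Qed.

Lemma odd_matrixP (x0 : T) g i j k l : odd_matrix (adj_matrix g) ->
  i < size g -> j < k < l -> l < size g ->
  e (nth x0 g i) (nth x0 g j) -> e (nth x0 g i) (nth x0 g k) ->
  e (nth x0 g i) (nth x0 g l) ->
  e (nth x0 g j) (nth x0 g k) (+) e (nth x0 g k) (nth x0 g l)
    (+) e (nth x0 g j) (nth x0 g l).
Proof.
move=> odd lti /andP[ltjk ltkl] ltl ij ik il.
have ltk := ltn_trans ltkl ltl; have ltj := ltn_trans ltjk ltk.
move: odd; rewrite /odd_matrix lazy_allE size_adj_matrix => /allP/(_ i).
rewrite mem_iota lti => /(_ isT); rewrite lazy_allE => /allP/(_ [:: j; k; l]).
rewrite !(sym_entry_adj_matrix x0) //; apply.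
apply: mem_combs3.
have -> : [:: j; k; l] = filter [in [:: j; k; l]] (filter (sym_entry (adj_matrix g) i) (iota 0 (size g))).
  apply: (irr_sorted_eq ltn_trans ltnn); first by rewrite /= ltjk ltkl.
    by rewrite -filter_predI; apply: sorted_filter (iota_ltn_sorted _ _); exact: ltn_trans.
  move=> a; rewrite !mem_filter mem_iota /= andbA; apply/idP/andP=> [aj|[/andP[]]//].
  rewrite aj; move: aj; rewrite !inE => /or3P[]/eqP->;
    by rewrite (sym_entry_adj_matrix x0).
exact: filter_subseq.
Qed.

(** The vertices vs are added one by one, each with the row that it has in the
    graph; a vertex already in the list costs nothing. *)
Lemma searchP k m rows (g : seq T) (vs : seq T) : search k m rows ->
  uniq g -> adj_matrix g = m -> (forall v, v \notin g -> map (e v) g \in rows) ->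
  size vs <= k ->
  exists g', [/\ odd_matrix (adj_matrix g'), uniq g', {subset g <= g'} &
    {subset vs <= g'}].
Proof.
elim: vs k m rows g => [|v vs IH] k m rows g.
  by case: k => [|k] /=; case: ifP => // odd _ Ug gm _ _; exists g; split; rewrite ?gm.
move=> srch Ug gm rowsP szvs.
have [vg|vg] := boolP (v \in g).
  have [g' [? ? gg' vsg']] := IH k m rows g srch Ug gm rowsP (ltnW szvs).
  exists g'; split=> // u; rewrite inE => /orP[/eqP->|/vsg'//]; exact: gg'.
case: k => //= k in srch szvs *.
move: srch; case: ifP => // _; rewrite lazy_allE => /allP/(_ _ (rowsP v vg)) srch.
have [||||g' [? ? gg' vsg']] := IH k _ _ (v :: g) srch.
- by rewrite /= vg.
- by rewrite /= gm.
- move=> u; rewrite inE negb_or => /andP[nuv ug].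
  rewrite mem_filter -gm; apply/andP; split.
    by apply: (@ok_top2_adj_matrix [:: u, v & g]); rewrite /= inE (negPf nuv) ug vg.
  rewrite mem_cat /=; case: (e u v); first by rewrite map_f ?rowsP.
  by rewrite (map_f (cons false)) ?rowsP ?orbT.
- exact: szvs.
exists g'; split=> // u; first by move=> ug; apply: gg'; rewrite inE ug orbT.
by rewrite inE => /orP[/eqP->|/vsg'//]; apply: gg'; rewrite inE eqxx.
Qed.

(** A violation of [line_like] involves four vertices, so extensions by four
    vertices decide the matter. *)
Lemma search_line_like m rows g : search 4 m rows -> uniq g -> adj_matrix g = m ->
  (forall v, v \notin g -> map (e v) g \in rows) -> line_like e.
Proof.
move=> srch Ug gm rowsP u x y z ux uy uz nxy nyz nxz.
have [g' [odd Ug' _ sub]] := searchP (vs := [:: u; x; y; z]) srch Ug gm rowsP isT.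
have {sub} [ug xg yg zg] : [/\ u \in g', x \in g', y \in g' & z \in g'].
  by split; apply: sub; rewrite !inE eqxx ?orbT.
wlog ltxy : x y {xg yg} xg yg ux uy nxy nxz nyz / index x g' < index y g'.
  move=> H; have [|ltyx|eqxy] := ltngtP (index x g') (index y g').
  - exact: H.
  - by rewrite (e_sym x y) -addbA (addbC (e y z)) addbA; apply: H => //; rewrite eq_sym.
  - by case/eqP: nxy; rewrite -(nth_index u xg) eqxy nth_index.
have key i j l : i \in g' -> j \in g' -> l \in g' -> e u i -> e u j -> e u l ->
    index i g' < index j g' < index l g' -> e i j (+) e j l (+) e i l.
  move=> ig jg lg ui uj ul lt.
  have := @odd_matrixP u g' (index u g') (index i g') (index j g') (index l g') odd.
  by rewrite !nth_index // !index_mem; apply.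
have [ltyz|ltzy|eqyz] := ltngtP (index y g') (index z g').
- by apply: key; rewrite ?ltxy.
- have [ltxz|ltzx|eqxz] := ltngtP (index x g') (index z g').
  + have := key x z y xg zg yg ux uz uy; rewrite ltxz => /(_ ltzy).
    by rewrite (e_sym z); case: (e x z); case: (e y z); case: (e x y).
  + have := key z x y zg xg yg uz ux uy; rewrite ltzx ltxy => /(_ isT).
    by rewrite (e_sym z x) (e_sym z y); case: (e x z); case: (e y z); case: (e x y).
  + by case/eqP: nxz; rewrite -(nth_index u xg) eqxz nth_index.
- by case/eqP: nyz; rewrite -(nth_index u yg) eqyz nth_index.
Qed.

End Matrices.

Definition degrees m := sort leq
  [seq count (sym_entry m i) (iota 0 (size m)) | i <- iota 0 (size m)].

Definition pattern_entry (E : seq (nat * nat)) i j := ((i, j) \in E) || ((j, i) \in E).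

Definition matches (m : seq (seq bool)) (E : seq (nat * nat)) (p : seq nat) :=
  lazy_all (fun i => lazy_all (fun j =>
    sym_entry m (nth 0 p i) (nth 0 p j) == pattern_entry E i j) (iota 0 5)) (iota 0 5).

(** Read as a graph on five vertices, here and below, this is the path with an
    isolated vertex. *)
Definition path4 := [:: (0, 1); (1, 2); (2, 3)].
Definition fork_edges := [:: (0, 1); (0, 2); (0, 3); (3, 4)].
Definition kite_edges := [:: (0, 1); (0, 2); (0, 3); (1, 2); (1, 3); (2, 4)].
Definition gem_edges := path4 ++ [:: (4, 0); (4, 1); (4, 2); (4, 3)].
Definition lollipop_edges := path4 ++ [:: (4, 0); (4, 1)].
Definition banner_edges := path4 ++ [:: (4, 0); (4, 2)].

(** The forbidden graphs on five vertices are recognised by their sorted degrees;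
    next to each degree sequence stand the graphs that have it.  The gem and the
    path with an isolated vertex are those in which a vertex is complete or
    anticomplete to a path. *)
Definition kinds4 := [:: ([:: 1; 1; 1; 2; 3], [:: fork_edges]);
  ([:: 1; 2; 3; 3; 3], [:: kite_edges]);
  ([:: 2; 2; 3; 3; 4], [:: gem_edges]);
  ([:: 0; 1; 1; 2; 2], [:: path4])].
(** In the lollipop and the banner a vertex sees exactly the first two, or exactly
    the first and the third, vertices of a path.  They share a degree sequence. *)
Definition kinds6 :=
  ([:: 1; 2; 2; 2; 3], [:: lollipop_edges; banner_edges]) :: kinds4.

Definition bad_kinds (ks : seq (seq nat * seq (seq (nat * nat)))) m :=
  let d := degrees m in lazy_has (fun k => d == k.1) ks.

Fixpoint all_matrices k : seq (seq (seq bool)) :=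
  if k is k'.+1 then flatten [seq [seq r :: m | r <- rows_of k'] | m <- all_matrices k']
  else [:: [::]].

Definition perms5 := Eval vm_compute in permutations (iota 0 5).

(** Justifies the recognition by degrees: all graphs on five vertices with one of
    these sequences are isomorphic to a listed one. *)
Lemma kinds6_matched : lazy_all (fun m => let d := degrees m in
    lazy_all (fun k => if d == k.1 then
      lazy_has (fun E => lazy_has (matches m E) perms5) k.2 else true) kinds6)
  (all_matrices 5).
Proof. by vm_compute. Qed.

Section Finite.
Variables (T : finType) (e : rel T).
Hypotheses (e_sym : symmetric e) (e_irr : irreflexive e).

Lemma adj_matrix_in g : adj_matrix e g \in all_matrices (size g).
Proof.
elim: g => //= v g IH; apply/flattenP.
exists [seq r :: adj_matrix e g | r <- rows_of (size g)].
  by apply/mapP; exists (adj_matrix e g).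
by apply/mapP; exists (map (e v) g) => //; apply: rows_of_bits; rewrite size_map.
Qed.

Definition avoids (E : seq (nat * nat)) := forall v : nat -> T,
  (forall i j, i < 5 -> j < 5 -> e (v i) (v j) = pattern_entry E i j) ->
  (forall i j, i < 5 -> j < 5 -> i != j -> v i != v j) -> False.

Lemma avoids_bad5 ks : {subset ks <= kinds6} ->
  (forall k E, k \in ks -> E \in k.2 -> avoids E) ->
  forall g, uniq g -> size g = 5 -> ~~ bad_kinds ks (adj_matrix e g).
Proof.
move=> sub av g Ug sz.
have [x0 _] : exists x0, x0 \in g by case: g sz {Ug} => // x g _; exists x; rewrite inE eqxx.
rewrite /bad_kinds lazy_hasE; apply/hasPn=> k kks; apply/negP=> dk.
have mg : adj_matrix e g \in all_matrices 5 by rewrite -sz adj_matrix_in.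
have := kinds6_matched; rewrite lazy_allE => /allP/(_ _ mg); cbv zeta.
set d := degrees _ in dk *; rewrite lazy_allE => /allP/(_ k (sub k kks)).
rewrite dk lazy_hasE => /hasP[E Ek]; rewrite lazy_hasE => /hasP[p].
have -> : perms5 = permutations (iota 0 5) by vm_compute.
rewrite mem_permutations /matches lazy_allE => pp mt.
have szp : size p = 5 by rewrite (perm_size pp) size_iota.
have Up : uniq p by rewrite (perm_uniq pp) iota_uniq.
have pi i : i < 5 -> nth 0 p i < size g.
  by move=> lti; rewrite sz; have := mem_nth 0 (s := p) (n := i);
     rewrite szp (perm_mem pp) mem_iota => /(_ lti).
apply: (av k E kks Ek (fun i => nth x0 g (nth 0 p i))) => i j lti ltj.
  rewrite -(sym_entry_adj_matrix e_sym e_irr) ?pi //.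
  have /allP/(_ i) := mt; rewrite mem_iota => /(_ lti); rewrite lazy_allE => /allP/(_ j).
  by rewrite mem_iota => /(_ ltj)/eqP.
by move=> nij; rewrite nth_uniq ?pi // nth_uniq ?szp.
Qed.

Hypotheses (forkF : fork_free e) (kiteF : kite_free e).

Lemma fork_avoids : avoids fork_edges.
Proof.
move=> v ev nv; apply: (forkF (a := v 0) (b := v 1) (c := v 2) (d := v 3) (f := v 4));
  by rewrite ?ev // nv.
Qed.

Lemma kite_avoids : avoids kite_edges.
Proof.
by move=> v ev nv; apply: (kiteF (p := v 0) (q := v 1) (r := v 2) (s := v 3) (t := v 4));
  rewrite ?ev.
Qed.

Definition is_P4 w x y z := [&& e w x, e x y, e y z, ~~ e w y, ~~ e w z & ~~ e x z].

Lemma P4_avoids E : (forall i j, i < 4 -> j < 4 -> pattern_entry E i j = pattern_entry path4 i j) ->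
  (forall w x y z v, is_P4 w x y z -> v \notin [:: w; x; y; z] ->
     map (e v) [:: w; x; y; z] = map (pattern_entry E 4) [:: 0; 1; 2; 3] -> False) ->
  avoids E.
Proof.
move=> Epath H v ev nv; apply: (H (v 0) (v 1) (v 2) (v 3) (v 4)).
- by rewrite /is_P4 !ev // !Epath.
- by rewrite !inE !negb_or !nv.
- by rewrite /= !ev.
Qed.

End Finite.

(** A path w, x, y, z together with a vertex v adjacent to w and x only, in the
    order v, z, y, x, w. *)
Definition red_matrix := [:: [:: false; false; true; true]; [:: true; false; false];
  [:: true; false]; [:: true]; [::]].

(** Here w and v are twins with respect to x, y and z; the added row belongs to a
    vertex that tells them apart, which is the reason for comparing its entries
    0 and 4. *)
Lemma red_search : lazy_all (fun row =>
    if nth false row 0 != nth false row 4 then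
    if ok_top (bad_kinds kinds4) (row :: red_matrix) then
      search (bad_kinds kinds4) 4 (row :: red_matrix)
      [seq r <- rows_of 6 | ok_top (bad_kinds kinds4) [:: r, row & red_matrix]]
    else true else true)
  (rows_of 5).
Proof. by vm_compute. Qed.

(** * Prime graphs: line-like or complement line-like *)

(** The configuration consists of a path and n vertices adjacent to exactly its two
    inner vertices; rows of that kind are left out, since n is 1 when there is
    such a vertex, and there is at most one by [mid_unique]. *)
Definition neutral_rows (n : bool) := [seq r <- rows_of (4 + n) |
  ok_top (bad_kinds kinds6) (r :: nseq n [:: false; true; true; false] ++
     [:: [:: true; false; false]; [:: true; false]; [:: true]; [::]])
  && (drop n r != [:: false; true; true; false])].

Lemma neutral_search n : search (bad_kinds kinds6) 4
  (nseq (n : bool) [:: false; true; true; false] ++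
     [:: [:: true; false; false]; [:: true; false]; [:: true]; [::]]) (neutral_rows n).
Proof. by case: n; vm_compute. Qed.

Section Dominating.
Variables (T : finType) (e : rel T).
Hypotheses (e_sym : symmetric e) (e_irr : irreflexive e).
Hypotheses (forkF : fork_free e) (kiteF : kite_free e) (primeP : prime e).
Hypothesis P4_dom : forall w x y z v, is_P4 e w x y z -> v \notin [:: w; x; y; z] ->
  has (e v) [:: w; x; y; z] && ~~ all (e v) [:: w; x; y; z].

Lemma dominating_avoids k E : k \in kinds4 -> E \in k.2 -> avoids e E.
Proof.
rewrite !inE => /or4P[]/eqP-> /=; rewrite inE => /eqP->.
- exact: fork_avoids.
- exact: kite_avoids.
- apply: P4_avoids => [[|[|[|[|i]]]] [|[|[|[|j]]]]//|w x y z v P4 vn] /= [vw vx vy vz].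
  by have := P4_dom P4 vn; rewrite /= vw vx vy vz.
- apply: P4_avoids => [//|w x y z v P4 vn] /= [vw vx vy vz].
  by have := P4_dom P4 vn; rewrite /= vw vx vy vz.
Qed.

Lemma bad4 g : uniq g -> size g = 5 -> ~~ bad_kinds kinds4 (adj_matrix e g).
Proof.
apply: avoids_bad5 => //; last exact: dominating_avoids.
by move=> k kk; rewrite /kinds6 in_cons kk orbT.
Qed.

Lemma P4_uniq w x y z : is_P4 e w x y z -> uniq [:: w; x; y; z].
Proof.
case/and5P=> wx xy yz wy /andP[wz xz]; have irr a b : e a b -> a != b by move=> ab; apply: contraTneq ab => ->; rewrite e_irr.
rewrite /= !inE !negb_or (irr _ _ wx) (irr _ _ xy) (irr _ _ yz) /= !andbT; apply/andP; split.
  apply/andP; split; first by apply: contraNneq wz => ->.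
  by apply: contraNneq xz => <-; rewrite e_sym.
by apply: contraNneq wz => <-.
Qed.

Lemma P4_matrix w x y z : is_P4 e w x y z -> adj_matrix e [:: z; y; x; w] =
  [:: [:: true; false; false]; [:: true; false]; [:: true]; [::]].
Proof.
case/and5P=> wx xy yz wy /andP[wz xz] /=.
rewrite (e_sym z y) (e_sym z x) (e_sym z w) (e_sym y x) (e_sym y w) (e_sym x w) wx xy yz.
by rewrite (negPf wy) (negPf wz) (negPf xz).
Qed.

(** Primality supplies the vertex that separates the twins w and v, and the search
    does the rest. *)
Lemma red_line_like w x y z v : is_P4 e w x y z -> v \notin [:: w; x; y; z] ->
  map (e v) [:: w; x; y; z] = [:: true; true; false; false] -> line_like e.
Proof.
move=> P4 vn vrow; have [vw vx vy vz] := vrow.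
have UP4 : uniq [:: v; z; y; x; w].
  have := rev_uniq [:: w; x; y; z]; rewrite (P4_uniq P4) [rev _]/= => U.
  by rewrite cons_uniq U andbT -mem_rev.
have mP4 := P4_matrix P4.
case/and5P: (P4) => wx xy yz wy /andP[wz xz].
have card2 : 1 < #|[set w; v]|.
  by move: vn; rewrite cards2 inE negb_or eq_sym => /andP[->].
have xn : x \notin [set w; v].
  rewrite !inE negb_or; apply/andP; split; first by apply: contraTneq wx => ->; rewrite e_irr.
  by apply: contraTneq vx => ->; rewrite e_irr.
have [t [a [b [tn aw bw ta tb]]]] := primeP card2 xn.
have tsplit : e t v != e t w.
  move: aw bw ta tb; rewrite !inE => /orP[]/eqP-> /orP[]/eqP->.
  - by move=> ->.
  - by move=> -> /negPf->.
  - by move=> -> /negPf->.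
  - by move=> ->.
have tU : uniq [:: t; v; z; y; x; w].
  rewrite cons_uniq UP4 andbT !inE !negb_or.
  move: tn; rewrite !inE negb_or => /andP[-> ->] /=; rewrite andbT.
  apply/and3P; split; apply: contraNneq tsplit => ->; rewrite e_sym ?vx ?vy ?vz.
  - by rewrite e_sym (negPf wz).
  - by rewrite e_sym (negPf wy).
  - by rewrite e_sym wx.
have bad := @bad4.
have mt : adj_matrix e [:: t; v; z; y; x; w] = map (e t) [:: v; z; y; x; w] :: red_matrix.
  by rewrite /red_matrix -mP4 /= vz vy vx vw.
have := red_search; rewrite lazy_allE => /allP/(_ (map (e t) [:: v; z; y; x; w])).
rewrite rows_of_bits // [nth _ _ 0]/= [nth _ _ 4]/= tsplit -mt.
rewrite (ok_top_adj_matrix bad tU) => /(_ isT) srch.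
apply: (search_line_like e_sym e_irr bad srch tU erefl) => u un.
rewrite mem_filter rows_of_bits // andbT mt -mt.
have := @ok_top_adj_matrix _ _ _ bad (u :: [:: t; v; z; y; x; w]).
by rewrite [uniq (u :: _)]cons_uniq un tU; apply.
Qed.

Hypothesis no_red : forall w x y z v, is_P4 e w x y z -> v \notin [:: w; x; y; z] ->
  map (e v) [:: w; x; y; z] <> [:: true; true; false; false].
Hypothesis no_blue : forall w x y z v, is_P4 e w x y z -> v \notin [:: w; x; y; z] ->
  map (e v) [:: w; x; y; z] <> [:: true; false; true; false].

Lemma bad6 g : uniq g -> size g = 5 -> ~~ bad_kinds kinds6 (adj_matrix e g).
Proof.
apply: avoids_bad5 => // k E; rewrite /kinds6 in_cons => /orP[/eqP->|]; last exact: dominating_avoids.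
rewrite /= !inE => /orP[]/eqP->.
- apply: P4_avoids => [[|[|[|[|i]]]] [|[|[|[|j]]]]//|w x y z v P4 vn] H.
  exact: no_red P4 vn H.
- apply: P4_avoids => [[|[|[|[|i]]]] [|[|[|[|j]]]]//|w x y z v P4 vn] H.
  exact: no_blue P4 vn H.
Qed.

(** The vertices adjacent to exactly the inner vertices of a path would form a
    module; all rows by which a vertex might split it are ruled out by forbidden
    graphs of order 5. *)
Lemma mid_unique w x y z n n' : is_P4 e w x y z -> n \notin [:: w; x; y; z] ->
  n' \notin [:: w; x; y; z] -> map (e n) [:: z; y; x; w] = [:: false; true; true; false] ->
  map (e n') [:: z; y; x; w] = [:: false; true; true; false] -> n = n'.
Proof.
move=> P4 nn n'n nrow n'row; apply/eqP; apply: contraT => nnn'; exfalso.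
pose mid v := (v \notin [:: w; x; y; z]) && (map (e v) [:: z; y; x; w] == [:: false; true; true; false]).
have card2 : 1 < #|[set v | mid v]|.
  apply/card_gt1P; exists n, n'; split=> //; rewrite inE /mid ?nn ?n'n.
    by rewrite nrow eqxx.
  by rewrite n'row eqxx.
have wn : w \notin [set v | mid v] by rewrite inE /mid inE eqxx.
have [t [a [b []]]] := primeP card2 wn; rewrite !inE.
move=> tn /andP[an /eqP arow] /andP[bn /eqP brow] ta tb.
have UP4 : uniq [:: z; y; x; w] by have := rev_uniq [:: w; x; y; z]; rewrite (P4_uniq P4).
have mP4 := P4_matrix P4.
have [tP4|tP4] := boolP (t \in [:: w; x; y; z]).
  move: ta tb; have [az ay ax aw] := arow; have [bz by_ bx bw] := brow.
  by move: tP4; rewrite !inE => /or4P[]/eqP->; rewrite !(e_sym _ a) !(e_sym _ b) ?az ?ay ?ax ?aw ?bz ?by_ ?bx ?bw.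
have atn : t != a by apply: contraTneq ta => ->; rewrite e_irr.
have btn : t != b by apply: contraNneq tn => ->; rewrite /mid bn brow eqxx.
have bad := @bad6.
have rev4 v : (v \in [:: z; y; x; w]) = (v \in [:: w; x; y; z]) by rewrite -mem_rev.
have okt c : mid c -> t != c -> ok_top (bad_kinds kinds6)
    ((e t c :: map (e t) [:: z; y; x; w]) :: [:: false; true; true; false] ::
       [:: [:: true; false; false]; [:: true; false]; [:: true]; [::]]).
  case/andP=> cn /eqP crow tc.
  rewrite -mP4 -crow; apply: (@ok_top_adj_matrix _ _ _ bad [:: t, c & [:: z; y; x; w]]).
  by rewrite (cons_uniq t) (cons_uniq c) UP4 in_cons negb_or tc !rev4 tP4 cn.
have := okt a (ltac:(by rewrite /mid an arow)) atn.
have := okt b (ltac:(by rewrite /mid bn brow)) btn.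
rewrite ta (negPf tb).
have nmid : map (e t) [:: z; y; x; w] != [:: false; true; true; false].
  by apply: contra tn => trow; rewrite /mid tP4 trow.
move: nmid; clear; rewrite [map _ _]/=.
by case: (e t z); case: (e t y); case: (e t x); case: (e t w).
Qed.

Lemma neutral_line_like w x y z : is_P4 e w x y z -> line_like e.
Proof.
move=> P4; have mP4 := P4_matrix P4.
have UP4 : uniq [:: z; y; x; w] by have := rev_uniq [:: w; x; y; z]; rewrite (P4_uniq P4).
have rev4 v : (v \in [:: z; y; x; w]) = (v \in [:: w; x; y; z]) by rewrite -mem_rev.
pose mid v := (v \notin [:: z; y; x; w]) && (map (e v) [:: z; y; x; w] == [:: false; true; true; false]).
have [n ng] : exists s : seq T, [/\ uniq (s ++ [:: z; y; x; w]),
   adj_matrix e (s ++ [:: z; y; x; w]) = nseq (size s == 1) [:: false; true; true; false] ++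
     [:: [:: true; false; false]; [:: true; false]; [:: true]; [::]],
   size s = (size s == 1) &
   forall v, v \notin s ++ [:: z; y; x; w] -> map (e v) [:: z; y; x; w] != [:: false; true; true; false]].
  have [/existsP[n /andP[nn /eqP nrow]]|no] := boolP [exists n, mid n].
    exists [:: n]; split=> //; first by rewrite cat_cons cons_uniq nn.
      by rewrite cat_cons [adj_matrix _ _]/= -/(adj_matrix e [:: z; y; x; w]) -mP4 -nrow.
    move=> v; rewrite cat_cons in_cons negb_or => /andP[vn vP4]; apply: contra vn => /eqP vrow.
    by apply/eqP; apply: (mid_unique P4); rewrite // -rev4.
  exists [::]; split=> // v vn; apply: contra no => vrow.
  by apply/existsP; exists v; rewrite /mid vn.
case: ng => Ug mg szn notmid; set b := (_ == _) in mg szn.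
apply: (search_line_like e_sym e_irr bad6 (neutral_search b) Ug mg) => v vn.
rewrite mem_filter rows_of_bits ?size_map ?size_cat ?szn ?andbT; last by rewrite addnC.
apply/andP; split; last first.
  by rewrite map_cat -szn drop_cat size_map ltnn subnn drop0; apply: notmid.
rewrite -mg; apply: (@ok_top_adj_matrix _ _ _ bad6 (v :: (n ++ [:: z; y; x; w]))).
by rewrite cons_uniq vn.
Qed.

End Dominating.

Section Complement.
Variables (T : finType) (e : rel T).
Hypotheses (e_sym : symmetric e) (e_irr : irreflexive e).

Lemma nonadjC x y : x != y -> ~~ nonadj e x y = e x y.
Proof. by rewrite /nonadj => ->; rewrite negbK. Qed.

Lemma nonadj_irr : irreflexive (nonadj e).
Proof. by move=> x; rewrite /nonadj eqxx. Qed.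

Lemma nonadjK x y : nonadj (nonadj e) x y = e x y.
Proof.
rewrite {1}/nonadj; have [->|nxy] := eqVneq x y; first by rewrite e_irr.
by rewrite nonadjC.
Qed.

Lemma nonadj_sep x y z : nonadj e x z -> ~~ nonadj e y z -> x != y.
Proof. by move=> xz; apply: contraNneq => <-. Qed.

(** The complement of the kite is the fork, with b, c, f, d as the diamond's
    vertices and a as the pendant one. *)
Lemma nonadj_fork_free : kite_free e -> fork_free (nonadj e).
Proof.
move=> kiteF a b c d f ab ac ad df nbc bc bd cd af bf cf.
have ne_ x y : nonadj e x y -> ~~ e x y by case/andP.
have cs := nonadj_sym e_sym.
have nbd : b != d by rewrite eq_sym; apply: nonadj_sep df bf.
have ncd : c != d by rewrite eq_sym; apply: nonadj_sep df cf.
have nbf : b != f by apply: contraNneq bd => ->; rewrite cs.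
have ncf : c != f by apply: contraNneq cd => ->; rewrite cs.
have naf : a != f by apply: contraNneq bf => <-; rewrite cs.
rewrite !nonadjC // in bc bd cd af bf cf.
apply: (kiteF b c f d a) => //.
- by rewrite e_sym.
- by rewrite e_sym ne_.
- by rewrite e_sym ne_.
- by rewrite e_sym ne_.
- by rewrite e_sym ne_.
Qed.

Lemma nonadj_kite_free : fork_free e -> kite_free (nonadj e).
Proof.
move=> forkF p q r s t pq pr ps qr qs rt rs pt qt st.
have ne_ x y : nonadj e x y -> ~~ e x y by case/andP.
have cs := nonadj_sym e_sym.
have nrs : r != s by apply: nonadj_sep rt st.
have npt : p != t by apply: contraNneq st => <-; rewrite cs.
have nqt : q != t by apply: contraNneq st => <-; rewrite cs.
have nst : s != t by apply: contraNneq pt => <-.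
rewrite !nonadjC // in rs pt qt st.
by apply: (forkF t p q s r); first [done | by rewrite e_sym | exact: ne_ | by rewrite e_sym ne_ | by case/andP: pq].
Qed.

Lemma nonadj_prime : prime e -> prime (nonadj e).
Proof.
move=> pr A z cA zA; have [v [x [y [vA xA yA vx vy]]]] := pr A z cA zA.
exists v, y, x; split=> //; first by rewrite /nonadj vy andbT; apply: contraNneq vA => ->.
by rewrite nonadjC //; apply: contraNneq vA => ->.
Qed.

(** The complement of the path w, x, y, z is the path x, z, w, y. *)
Lemma nonadj_P4 w x y z : is_P4 e w x y z -> is_P4 (nonadj e) x z w y.
Proof.
move=> P4; have := P4_uniq e_sym e_irr P4; case/and5P: P4 => wx xy yz wy /andP[wz xz].
rewrite /= !inE !negb_or !andbT => /and3P[/and3P[nwx nwy nwz] /andP[nxy nxz] nyz].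
rewrite /is_P4 /nonadj (e_sym z w) (e_sym x w) (e_sym z y) wx xy yz !andbF.
by rewrite xz wz wy nxz nwy (eq_sym z) nwz.
Qed.

End Complement.

Lemma P4_linked (T : finType) (r : rel T) w x y z : symmetric r ->
  r w x -> r x y -> r y z -> linked r (w |: (x |: (y |: [set z]))).
Proof.
move=> r_sym wx xy yz.
have l1 : linked r [set z].
  by move=> B u v /set1P-> /set1P-> ->.
have l2 := linked_add r_sym l1 (set11 z) yz.
have l3 := linked_add r_sym l2 (setU11 _ _) xy.
exact: (linked_add r_sym l3 (setU11 x _) wx).
Qed.

Section Structure.
Variables (T : finType) (e : rel T).
Hypotheses (e_sym : symmetric e) (e_irr : irreflexive e).
Hypotheses (forkF : fork_free e) (kiteF : kite_free e) (primeP : prime e).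

Lemma P4_set_linked w x y z : is_P4 e w x y z ->
  let K := w |: (x |: (y |: [set z])) in
  [/\ linked e K, linked (nonadj e) K & 1 < #|K|].
Proof.
move=> P4; case/and5P: (nonadj_P4 e_sym e_irr P4) => xz zw wy _ _.
case/and5P: (P4) => wx xy yz _ _ K; split; first exact: P4_linked.
  have -> : K = x |: (z |: (w |: [set y])).
    by apply/setP=> v; rewrite !inE; do !case: (_ == _).
  exact: P4_linked (nonadj_sym e_sym) xz zw wy.
apply/card_gt1P; exists w, x; rewrite !inE !eqxx ?orbT; split=> //.
by apply: contraTneq wx => ->; rewrite e_irr.
Qed.

Lemma undominated_line_like w x y z v : is_P4 e w x y z ->
  v \notin [:: w; x; y; z] -> ~~ has (e v) [:: w; x; y; z] -> line_like e.
Proof.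
move=> P4 vn; rewrite /= !negb_or => /and5P[vw vx vy vz _].
have [lK clK K1] := P4_set_linked P4.
apply: (prime_coanchor_line_like e_sym e_irr forkF kiteF primeP lK clK K1 (z := v)).
  by move: vn; rewrite !inE.
by move=> u; rewrite !inE => /or4P[]/eqP->.
Qed.

End Structure.

(** If some path has an anticomplete vertex, the graph is line-like, and dually for
    a complete vertex.  Otherwise every path is seen by each other vertex, but
    not completely.  If a vertex sees precisely the first two vertices of a path,
    the search started from its twin pair applies; the pattern first and third
    is the same in the complement.  If neither pattern occurs, few kinds of
    vertices are left around a path, and the search starts from the path
    itself. *)
Theorem prime_line_like_or_co (T : finType) (e : rel T) w x y z :
  symmetric e -> irreflexive e -> fork_free e -> kite_free e -> prime e ->
  is_P4 e w x y z -> line_like e \/ line_like (nonadj e).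
Proof.
move=> e_sym e_irr forkF kiteF primeP P4.
have ce_sym := nonadj_sym e_sym; have ce_irr := @nonadj_irr T e.
have cforkF := nonadj_fork_free e_sym kiteF.
have ckiteF := nonadj_kite_free e_sym forkF.
have cprimeP := nonadj_prime primeP.
pose some4 (P : T -> T -> T -> T -> T -> bool) := [exists a, exists b, exists c, exists d,
  exists v, [&& is_P4 e a b c d, v \notin [:: a; b; c; d] & P a b c d v]].
have some4P (P : T -> T -> T -> T -> T -> bool) : reflect (exists a b c d v, [/\ is_P4 e a b c d, v \notin [:: a; b; c; d] & P a b c d v]) (some4 P).
  apply: (iffP existsP) => [[a /existsP[b /existsP[c /existsP[d /existsP[v /and3P[*]]]]]]|].
    by exists a, b, c, d, v.
  case=> a [b [c [d [v [? ? ?]]]]]; exists a; apply/existsP; exists b; apply/existsP.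
  by exists c; apply/existsP; exists d; apply/existsP; exists v; apply/and3P.
have perm4 a b c d (v : T) : (v \in [:: b; d; a; c]) = (v \in [:: a; b; c; d]).
  by rewrite !inE; case: (v == a); case: (v == b); case: (v == c); case: (v == d).
have [/some4P[a [b [c [d [v [P vn no]]]]]]|dom] :=
    boolP (some4 (fun a b c d v => ~~ has (e v) [:: a; b; c; d])).
  by left; apply: undominated_line_like P vn no.
have [/some4P[a [b [c [d [v [P vn al]]]]]]|codom] :=
    boolP (some4 (fun a b c d v => all (e v) [:: a; b; c; d])).
  right; apply: (undominated_line_like ce_sym ce_irr cforkF ckiteF cprimeP (nonadj_P4 e_sym e_irr P) (v := v)).
    by rewrite perm4.
  move: al; rewrite /= andbT => /and4P[va vb vc vd].
  by rewrite /nonadj va vb vc vd !andbF.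
have P4_dom a b c d v : is_P4 e a b c d -> v \notin [:: a; b; c; d] ->
    has (e v) [:: a; b; c; d] && ~~ all (e v) [:: a; b; c; d].
  move=> P vn; apply/andP; split.
    by apply: contraNT dom => no; apply/some4P; exists a, b, c, d, v.
  by apply: contra codom => al; apply/some4P; exists a, b, c, d, v.
have [/some4P[a [b [c [d [v [P vn /eqP red]]]]]]|no_red] :=
    boolP (some4 (fun a b c d v => map (e v) [:: a; b; c; d] == [:: true; true; false; false])).
  by left; apply: (red_line_like e_sym e_irr forkF kiteF primeP P4_dom P vn red).
have coP4 a b c d : is_P4 (nonadj e) a b c d -> is_P4 e b d a c.
  by move/(nonadj_P4 ce_sym ce_irr); rewrite /is_P4 !nonadjK.
have [/some4P[a [b [c [d [v [P vn /eqP blue]]]]]]|no_blue] :=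
    boolP (some4 (fun a b c d v => map (e v) [:: a; b; c; d] == [:: true; false; true; false])).
  right; apply: (red_line_like ce_sym ce_irr cforkF ckiteF cprimeP _ (nonadj_P4 e_sym e_irr P) (v := v)).
  - move=> a' b' c' d' u /coP4 P' un.
    have un' : u \notin [:: b'; d'; a'; c'] by rewrite perm4.
    have := P4_dom _ _ _ _ _ P' un'; move: un; rewrite /nonadj /= !inE !negb_or.
    case/and4P=> -> -> -> ->; rewrite /=.
    by case: (e u a'); case: (e u b'); case: (e u c'); case: (e u d').
  - by rewrite perm4.
  - case: blue => /= va vb vc vd; move: vn; rewrite /nonadj va vb vc vd !inE !negb_or.
    by case/and4P=> -> -> -> ->.
left; apply: (neutral_line_like e_sym e_irr forkF kiteF primeP P4_dom _ _ P4).
  move=> a b c d v P vn row; case/negP: no_red.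
  by apply/some4P; exists a, b, c, d, v; rewrite row.
move=> a b c d v P vn row; case/negP: no_blue.
by apply/some4P; exists a, b, c, d, v; rewrite row.
Qed.

(** * Colourings and Vizing's theorem inside a line graph *)

(** Colourability of the subgraph induced by A.  Total functions to nat avoid
    dependent types when colourings are restricted and merged; values outside A
    are irrelevant. *)
Definition col (T : finType) (e : rel T) (A : {set T}) k :=
  exists c : T -> nat, (forall x, x \in A -> c x < k) /\
    (forall x y, x \in A -> y \in A -> e x y -> c x != c y).

Definition clique (T : finType) (e : rel T) (A : {set T}) :=
  forall x y, x \in A -> y \in A -> x != y -> e x y.

(** Vertex-critical of chromatic number k+1. *)
Definition critical (T : finType) (e : rel T) k :=
  ~ col e setT k /\ (forall A : {set T}, A != setT -> col e A k).

Lemma unused_colour (T : finType) (c : T -> nat) (A : {set T}) k : #|A| < k ->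
  exists2 b, b < k & forall x, x \in A -> c x != b.
Proof.
move=> Ak; have [/hasP[b]|no] := boolP (has (fun b => b \notin map c (enum A)) (iota 0 k)).
  rewrite mem_iota add0n => /= bk bA; exists b => // x xA.
  by apply: contraNneq bA => <-; apply: map_f; rewrite mem_enum.
have s : {subset iota 0 k <= map c (enum A)}.
  by move=> b bk; apply: contraT => bA; case/negP: no; apply/hasP; exists b.
by have := uniq_leq_size (iota_uniq 0 k) s; rewrite size_iota size_map -cardE leqNgt Ak.
Qed.

Lemma uniq_last_neq (T : eqType) (v a h : T) p1 p2 :
  uniq (v :: p1 ++ [:: a, h & p2]) -> last v p1 != h.
Proof.
rewrite -cat_cons cat_uniq => /and3P[_ /hasPn/(_ h) H _].
apply: contraNneq (H _) => [<-|]; first exact: mem_last.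
by rewrite !inE eqxx orbT.
Qed.

Lemma sub_path_targets (T : eqType) (r r' : rel T) y p :
  (forall u v, v \in p -> r u v -> r' u v) -> path r y p -> path r' y p.
Proof.
elim: p y => //= z p IH y H /andP[yz zp]; rewrite H ?mem_head //=.
by apply: IH => // u v vp; apply: H; rewrite inE vp orbT.
Qed.

Section TwoEnds.
Variables (T : finType) (r : rel T).
Hypothesis r_sym : symmetric r.

(** In a graph of maximum degree 2 a component is a path or a cycle, so it has at
    most two vertices of degree at most 1.  The degree bound is stated without
    counting. *)
Lemma three_ends v y y' :
  (forall z a b c, r z a -> r z b -> r z c -> [\/ a = b, b = c | a = c]) ->
  (forall a b, r v a -> r v b -> a = b) -> (forall a b, r y a -> r y b -> a = b) ->
  (forall a b, r y' a -> r y' b -> a = b) -> v != y -> v != y' -> y != y' ->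
  connect r v y -> connect r v y' -> False.
Proof.
move=> deg2 degv degy degy' nvy nvy' nyy' /connectP[q pq yq] /connectP[p0 pp0 y'p0].
case/shortenP: pp0 y'p0 => p pp Up _ y'p {p0}.
have closed a b : a \in v :: p -> r a b -> b \in v :: p.
  rewrite inE => /orP[/eqP->|ap] ab.
    case: p pp {Up} y'p => [|h p] /=; first by move=> _ E; rewrite E eqxx in nvy'.
    by case/andP=> vh _ _; rewrite (degv b h ab vh) !inE eqxx orbT.
  case/splitPr: ap pp Up y'p => p1 p2; rewrite cat_path /= => /and3P[_ pa p2p] Up y'p.
  have ap1 : r a (last v p1) by rewrite r_sym.
  have l1 : last v p1 \in v :: p1 ++ a :: p2.
    by have := mem_last v p1; rewrite !inE mem_cat => /orP[->//|->]; rewrite orbT.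
  case: p2 p2p Up y'p l1 => [|h p2] /= => [_|/andP[ah _]] Up y'p l1.
    move: y'p; rewrite last_cat /= => y'a.
    by rewrite (degy' b (last v p1)) // y'a.
  have h1 : h \in v :: p1 ++ [:: a, h & p2] by rewrite !(inE, mem_cat) eqxx !orbT.
  have nh : last v p1 != h := uniq_last_neq Up.
  by case: (deg2 a b (last v p1) h ab ap1 ah) => [->//|/eqP|->//]; rewrite (negPf nh).
have all_in : forall q z, z \in v :: p -> path r z q -> last z q \in v :: p.
  elim=> //= b s IH z zp /andP[zb pb]; apply: (IH b) => //; exact: closed zb.
have yp : y \in v :: p by rewrite yq; apply: all_in; rewrite ?mem_head.
move: yp; rewrite inE eq_sym (negPf nvy) /= => yp.
case/splitPr: yp pp Up y'p => p1 p2; rewrite cat_path /= => /and3P[_ pa p2p] Up y'p.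
case: p2 p2p Up y'p => [|h p2] /= => [_|/andP[ah _]] Up y'p.
  by move: y'p; rewrite last_cat /= => /esym/eqP; rewrite (negPf nyy').
have E := degy (last v p1) h (ltac:(by rewrite r_sym)) ah.
by have := uniq_last_neq Up; rewrite E eqxx.
Qed.

End TwoEnds.

Section Vizing.
Variables (T : finType) (e : rel T) (k : nat).
Hypotheses (e_sym : symmetric e) (e_irr : irreflexive e).
Hypothesis lineF : line_like e.

(** For line-like graphs: the maximal clique that contains the edge xa.  In the
    root graph it is the set of edges at the common end of x and a. *)
Definition star x a := x |: [set w | e x w & (w == a) || e a w].

(** In the root graph: an edge that does not contain a given vertex meets at most
    one edge at that vertex, as there are no triangles, and the other edges that
    an edge at this vertex meets share its far end. *)
Lemma line_like_star x a : e x a ->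
  [/\ clique e (star x a),
      forall w u v, w \notin star x a -> u \in star x a -> v \in star x a ->
        e w u -> e w v -> u = v,
      forall u v w, u \in star x a -> v \notin star x a -> w \notin star x a ->
        e u v -> e u w -> v != w -> e v w,
      x \in star x a & a \in star x a].
Proof.
move=> xa; set U := star x a; have xU : x \in U by rewrite !inE eqxx.
have irr u v : e u v -> u != v by move=> uv; apply: contraTneq uv => ->; rewrite e_irr.
have cliqueU : clique e U.
  have inN u v : e x u -> e x v -> (u == a) || e a u -> (v == a) || e a v -> u != v -> e u v.
    move=> xu xv /orP[/eqP->|au] /orP[/eqP->|av] nuv //.
    - by rewrite eqxx in nuv.
    - by rewrite e_sym.
    - have nua : u != a by rewrite eq_sym irr.
      by have := lineF xu xa xv nua (irr _ _ av) nuv; rewrite e_sym au av.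
  move=> u v; rewrite !inE => /orP[/eqP->|/andP[xu au]] /orP[/eqP->|/andP[xv av]] nuv //.
  - by rewrite eqxx in nuv.
  - by rewrite e_sym.
  - exact: inN.
have aU : a \in U by rewrite !inE xa eqxx orbT.
have at1U w u v : w \notin U -> u \in U -> v \in U -> e w u -> e w v -> u = v.
  move=> wU uU vU wu wv; apply/eqP; apply: contraT => nuv; case: (negP wU).
  have all_w z : z \in U -> e w z.
    move=> zU; have [->//|nzu] := eqVneq z u; have [->//|nzv] := eqVneq z v.
    have uz : e u z by apply: cliqueU; rewrite // eq_sym.
    have uv := cliqueU _ _ uU vU nuv.
    have uw : e u w by rewrite e_sym.
    have nzw : z != w by apply: contraNneq wU => <-.
    have nvw : v != w by apply: contraNneq wU => <-.
    have nvz : v != z by rewrite eq_sym.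
    have := lineF uv uz uw nvz nzw nvw.
    rewrite (cliqueU _ _ vU zU nvz) (e_sym v w) wv (e_sym z).
    by case: (e w z).
  by rewrite !inE e_sym !all_w // e_sym all_w ?orbT.
have cliqueO u v w : u \in U -> v \notin U -> w \notin U -> e u v -> e u w -> v != w -> e v w.
  move=> uU vU wU uv uw nvw.
  have [z [zU nzu]] : exists z, z \in U /\ z != u.
    have [->|] := eqVneq u x; first by exists a; rewrite eq_sym irr.
    by exists x; rewrite eq_sym.
  have uz : e u z by apply: cliqueU; rewrite // eq_sym.
  have out t : t \notin U -> e u t -> (t != z) * (e t z = false).
    move=> tU ut; split; first by apply: contraNneq tU => ->.
    apply: contraTF isT => tz; case/eqP: nzu; apply: (at1U t) => //.
    by rewrite e_sym.
  have [nvz vz] := out v vU uv; have [nwz wz] := out w wU uw.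
  by have := lineF uv uw uz nvw nwz nvz; rewrite vz wz !addbF.
by split.
Qed.

(** A partial colouring that leaves just the vertex x uncoloured. *)
Definition proper_off (x : T) (phi : T -> nat) :=
  (forall u, u != x -> phi u < k) /\
  (forall u v, u != x -> v != x -> e u v -> phi u != phi v).

(** U is the set of edges at one root vertex, with the uncoloured edge x among
    them; at1U and cliqueO are the properties of a star. *)
Section Fan.
Variable U : {set T}.
Hypothesis cliqueU : clique e U.
Hypothesis at1U : forall w u v, w \notin U -> u \in U -> v \in U ->
  e w u -> e w v -> u = v.
Hypothesis cliqueO : forall u v w, u \in U -> v \notin U -> w \notin U ->
  e u v -> e u w -> v != w -> e v w.

(** The colour c is absent at the far end of the root edge u. *)
Definition free_at (phi : T -> nat) u c := [forall w, (e u w && (w \notin U)) ==> (phi w != c)].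

Lemma free_atP phi u c w : free_at phi u c -> e u w -> w \notin U -> phi w != c.
Proof. by move=> /forallP/(_ w)/implyP H uw wU; apply: H; rewrite uw. Qed.

(** A fan step from u to v: u could be recoloured with the colour of v as far as
    its far end is concerned. *)
Definition fan (phi : T -> nat) x : rel T := fun u v =>
  [&& v \in U, v != x & free_at phi u (phi v)].

(** Shift colours along a fan: each member takes the colour of the next one, and
    the last one a colour b that is absent at both of its ends. *)
Lemma fan_shift x phi p b : proper_off x phi -> x \in U -> path (fan phi x) x p ->
  uniq (x :: p) -> b < k -> (forall w, w \in U -> w != x -> phi w != b) ->
  free_at phi (last x p) b -> col e setT k.
Proof.
elim: p x phi => [|y p IH] x phi [phik prop] xU /=.
  move=> _ _ bk bU bO; exists (fun z => if z == x then b else phi z); split=> [z _|u v _ _ uv].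
    by case: eqVneq => // nzx; apply: phik.
  have bN v' : e x v' -> v' != x -> phi v' != b.
    move=> xv' nv'; have [vU|vU] := boolP (v' \in U); first exact: bU.
    exact: free_atP bO xv' vU.
  have [Eu|nu] := eqVneq u x; have [Ev|nv] := eqVneq v x.
  - by rewrite Eu Ev e_irr in uv.
  - by rewrite eq_sym; apply: bN => //; rewrite -Eu.
  - by apply: bN => //; rewrite -Ev e_sym.
  - exact: prop.
case/andP=> /and3P[yU nyx fy] pp /andP[]; rewrite inE negb_or => /andP[nxy xp] Up bk bU bO.
pose phi' z := if z == x then phi y else phi z.
have phiE z : z != x -> phi' z = phi z by rewrite /phi' => /negPf->.
have phiO z : z \notin U -> phi' z = phi z.
  by move=> zU; apply: phiE; apply: contraNneq zU => ->.
have freeE u c : free_at phi u c -> free_at phi' u c.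
  by move=> fu; apply/forallP=> w; apply/implyP=> /andP[uw wU]; rewrite phiO // (free_atP fu).
apply: (IH y phi') => //.
- have phiN v : e x v -> v != x -> v != y -> phi y != phi v.
    move=> xv nvx nvy; have [vU|vU] := boolP (v \in U).
      by apply: prop => //; apply: cliqueU; rewrite // eq_sym.
    by rewrite eq_sym; apply: free_atP fy xv vU.
  split=> [u nuy|u v nuy nvy uv].
    by rewrite /phi'; case: eqVneq => [_|]; apply: phik.
  rewrite /phi'; have [Eu|nu] := eqVneq u x; have [Ev|nv] := eqVneq v x.
  + by rewrite Eu Ev e_irr in uv.
  + by apply: phiN => //; rewrite -Eu.
  + by rewrite eq_sym; apply: phiN => //; rewrite -Ev e_sym.
  + exact: prop.
- apply: sub_path_targets pp => u v vp /and3P[vU nvx fv].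
  rewrite /fan vU phiE ?freeE //= andbT.
  by apply: contraTneq Up => <-; rewrite /= vp.
- move=> w wU nwy; have [->|nw] := eqVneq w x; last by rewrite phiE // bU.
  by rewrite /phi' eqxx bU.
- exact: freeE.
Qed.

Hypothesis small : forall Q : {set T}, clique e Q -> #|Q| < k.

Definition star_out u := u |: [set w | e u w && (w \notin U)].

(** u with its neighbours outside U is the clique of the far end of u. *)
Lemma star_out_small u : u \in U -> #|star_out u| < k.
Proof.
move=> uU; apply: small => v w; rewrite !inE => /orP[/eqP->|/andP[uv vU]] /orP[/eqP->|/andP[uw wU]] nvw.
- by rewrite eqxx in nvw.
- by [].
- by rewrite e_sym.
- exact: (cliqueO uU).
Qed.

Variables (x : T) (phi : T -> nat).
Hypotheses (xU : x \in U) (prop : proper_off x phi).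
Hypothesis nocol : ~ col e setT k.

Let phik := prop.1.
Let phiP := prop.2.
Let F := fan phi x.

Lemma fan_connect_stuck u b : connect F x u -> b < k ->
  (forall w, w \in U -> w != x -> phi w != b) -> ~~ free_at phi u b.
Proof.
case/connectP=> p0 pp0 -> bk bU; case/shortenP: pp0 => p pp Up _.
by apply/negP=> fb; apply: nocol; apply: (fan_shift prop xU pp Up bk bU).
Qed.

Lemma connect_in_U u : connect F x u -> u \in U.
Proof.
case/connectP=> p; case/lastP: p => [_ ->//|p z]; rewrite rcons_path last_rcons.
by case/andP=> _ /and3P[zU _ _] ->.
Qed.

Lemma U_inj u v : u \in U -> v \in U -> u != x -> v != x -> phi u = phi v -> u = v.
Proof.
move=> uU vU nu nv E; apply/eqP; apply: contraT => nuv.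
by have := phiP nu nv (cliqueU uU vU nuv); rewrite E eqxx.
Qed.

(** Every member of the fan has a continuation, since a colour absent at its far
    end must occur in U: otherwise [fan_shift] would colour everything. *)
Lemma fan_next u : connect F x u -> exists2 v, F u v & v != u.
Proof.
move=> xu; have uU := connect_in_U xu.
have [b bk bN] := unused_colour phi (star_out_small uU).
have fb : free_at phi u b.
  apply/forallP=> w; apply/implyP=> /andP[uw wU]; apply: bN.
  by rewrite !inE uw wU orbT.
have [/exists_inP[v vU /andP[nvx /eqP vb]]|no] := boolP [exists v in U, (v != x) && (phi v == b)].
  exists v; first by rewrite /F /fan vU nvx vb.
  have ub : phi u != b by apply: bN; rewrite !inE eqxx.
  by apply: contraNneq ub => <-; rewrite vb.
have /negP[] : ~~ free_at phi u b; last by [].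
apply: fan_connect_stuck => // w wU nwx; apply: contra no => wb.
by apply/exists_inP; exists w; rewrite ?nwx.
Qed.

(** There are fewer possible targets than members of the fan, as x is a member
    but not a target; so two members continue with the same vertex v. *)
Lemma fan_collision : exists u u' v, [/\ connect F x u, connect F x u', u != u' &
  [/\ F u v, F u' v, v != u & v != u']].
Proof.
pose R := [set u | connect F x u].
pose g u := odflt x [pick v | F u v && (v != u)].
have gP u : u \in R -> F u (g u) && (g u != u).
  rewrite inE => /fan_next[v Fv nv]; rewrite /g; case: pickP => //= /(_ v).
  by rewrite Fv nv.
have [/dinjectiveP inj|] := boolP (dinjectiveb g R); last first.
  case/dinjectivePn=> u uR [u' /andP[nu' u'R] E].
  have := gP u uR; have := gP u' u'R; rewrite -E.
  case/andP=> F1 n1 /andP[F2 n2]; exists u, u', (g u).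
  by move: uR u'R; rewrite !inE eq_sym; split.
have : #|g @: R| = #|R| by apply: card_in_imset.
have : g @: R \subset R :\ x.
  apply/subsetP=> _ /imsetP[u uR ->]; have /andP[Fu _] := gP u uR.
  rewrite !inE; case/and3P: (Fu) => _ -> _ /=.
  by move: uR; rewrite inE => /connect_trans; apply; apply: connect1.
move/subset_leq_card => le E; move: le; rewrite E.
by rewrite [X in X <= _](cardsD1 x) inE connect0 add1n ltnn.
Qed.

Lemma connect_avoid (r : rel T) v a b : connect r a b ->
  connect (fun u w => r u w && (w != v)) a b \/
  connect (fun u w => r u w && (w != v)) v b.
Proof.
case/connectP=> p pp ->; elim: p a pp => [|z p IH] a /=; first by left; apply: connect0.
case/andP=> az /IH[zl|]; last by right.
have [E|nzv] := eqVneq z v; first by right; subst v.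
by left; apply: connect_trans zl; apply: connect1; rewrite az.
Qed.

Lemma connect_enter (r : rel T) v a : connect r a v -> a != v ->
  exists w, [/\ connect (fun u w => r u w && (w != v)) a w, r w v & w != v].
Proof.
case/connectP=> p pp Ev nav; rewrite {}Ev in nav *.
elim: p a pp nav => [|z p IH] a /=; first by rewrite eqxx.
case/andP=> az pz nal; have [E|nz] := eqVneq z (last z p).
  by exists a; split; [apply: connect0 | rewrite -E | ].
have [w [zw wl nwl]] := IH z pz nz; exists w; split=> //.
by apply: connect_trans zw; apply: connect1; rewrite az.
Qed.

(** Let d be the colour of v, and c a colour absent from U.  Swap c and d on the
    Kempe component D of v.  Its maximum degree is 2, and v as well as the
    c-coloured vertex at the far end of each fan member missing d has degree at
    most 1 in it.  By [three_ends] D contains such a vertex for at most one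
    member.  After the swap d is absent from U, and a fan that ends at another of
    these members can be shifted. *)
Lemma kempe_false : False.
Proof.
have [u1 [u2 [v [xu1 xu2 nu12 [F1 F2 nvu1 nvu2]]]]] := fan_collision.
pose d := phi v.
have [vU nvx fd1] := and3P F1; have [_ _ fd2] := and3P F2.
have vk : d < k by apply: phik.
have [|c ck cN] := unused_colour phi (A := U :\ x) (k := k).
  by apply: leq_ltn_trans (subset_leq_card (subD1set _ _)) (small cliqueU).
have cU w : w \in U -> w != x -> phi w != c.
  by move=> wU nwx; apply: cN; rewrite !inE nwx.
have ncd : c != d by rewrite eq_sym; apply: cU.
have ndc : d != c by rewrite eq_sym.
(* The Kempe graph of the colours c and d, away from x. *)
pose kap : rel T := fun a b => [&& e a b, a != x, b != x,
  (phi a == c) || (phi a == d) & (phi b == c) || (phi b == d)].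
have kap_sym : symmetric kap.
  by move=> a b; rewrite /kap e_sym; do !bool_congr.
have kapP a b : kap a b -> [/\ e a b, b != x & (phi a = c -> phi b = d) /\ (phi a = d -> phi b = c)].
  case/and5P=> ab na nb ca cb; split=> //; have nab := phiP na nb ab.
  by split=> E; case/orP: cb => /eqP Eb //; rewrite E Eb eqxx in nab.
have deg2 z a b w : kap z a -> kap z b -> kap z w -> [\/ a = b, b = w | a = w].
  move=> /kapP[za na [c1 d1]] /kapP[zb nb [c2 d2]] /[dup] zwk /kapP[zw nw [c3 d3]].
  have [Ea Eb] : phi a = phi b /\ phi b = phi w.
    case/and5P: zwk => _ _ _ /orP[]/eqP E _; first by rewrite c1 ?c2 ?c3.
    by rewrite d1 ?d2 ?d3.
  have [->|nab] := eqVneq a b; first by constructor 1.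
  have [->|nbw] := eqVneq b w; first by constructor 2.
  have [->|naw] := eqVneq a w; first by constructor 3.
  have nadj p q : p != x -> q != x -> phi p = phi q -> e p q = false.
    by move=> np nq E; apply: contraTF isT => /(phiP np nq); rewrite E eqxx.
  have := lineF za zb zw nab nbw naw.
  by rewrite !nadj // Ea.
have degv a b : kap v a -> kap v b -> a = b.
  move=> /kapP[va na [_ /(_ erefl) ca]] /kapP[vb nb [_ /(_ erefl) cb]].
  apply/eqP; apply: contraT => nab.
  have aU : a \notin U by apply/negP=> aU; case/eqP: (cU a aU na).
  have bU : b \notin U by apply/negP=> bU; case/eqP: (cU b bU nb).
  by have := phiP na nb (cliqueO vU aU bU va vb nab); rewrite ca cb eqxx.
have present s : connect F x s -> exists y, [/\ e s y, y \notin U & phi y = c].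
  move=> xs; have := fan_connect_stuck xs ck cU; rewrite negb_forall => /existsP[y].
  by rewrite negb_imply negbK => /andP[/andP[sy yU] /eqP yc]; exists y.
have degO s y a b : s \in U -> s != v -> free_at phi s d -> e s y -> y \notin U ->
    phi y = c -> kap y a -> kap y b -> a = b.
  move=> sU nsv fs sy yU yc /kapP[ya na [/(_ yc) da _]] /kapP[yb nb [/(_ yc) db _]].
  apply/eqP; apply: contraT => nab.
  have out z : e y z -> z != x -> phi z = d -> (z != s) * (e s z = false).
    move=> yz nzx zd; have nzs : z != s.
      by apply: contraNneq nsv => Ez; rewrite -Ez; apply/eqP/U_inj; rewrite // Ez.
    split=> //; apply: contraTF isT => sz.
    have [zU|zU] := boolP (z \in U).
      by case/eqP: nzs; apply: (at1U yU zU sU yz); rewrite e_sym.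
    by move: (free_atP fs sz zU); rewrite zd eqxx.
  have [nas sa] := out a ya na da; have [nbs sb] := out b yb nb db.
  have nsa : s != a by rewrite eq_sym.
  have nsb : s != b by rewrite eq_sym.
  have ys : e y s by rewrite e_sym.
  have := lineF ys ya yb nsa nab nsb.
  rewrite sa sb addbF => ab.
  by have := phiP na nb ab; rewrite da db eqxx.
pose D := [set z | connect kap v z].
(* D reaches the far end of at most one fan member that misses d. *)
have one s1 s2 y1 y2 : s1 \in U -> s2 \in U -> s1 != v -> s2 != v -> s1 != s2 ->
    free_at phi s1 d -> free_at phi s2 d -> e s1 y1 -> y1 \notin U -> phi y1 = c ->
    e s2 y2 -> y2 \notin U -> phi y2 = c -> y1 \in D -> y2 \in D -> False.
  move=> s1U s2U n1v n2v n12 f1 f2 sy1 y1U y1c sy2 y2U y2c; rewrite !inE.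
  apply: (three_ends kap_sym) => //.
  - move=> a b; exact: (degO s1).
  - move=> a b; exact: (degO s2).
  - by apply: contraNneq y1U => <-.
  - by apply: contraNneq y2U => <-.
  - apply: contraNneq n12 => E; apply/eqP; apply: (at1U y1U s1U s2U).
      by rewrite e_sym.
    by rewrite E e_sym.
have Dcl a b : a \in D -> kap a b -> b \in D.
  by rewrite !inE => va ab; apply: connect_trans va (connect1 ab).
have Dx z : z \in D -> z != x /\ (phi z == c) || (phi z == d).
  rewrite inE => /connectP[p]; case/lastP: p => [_ ->|p b].
    by rewrite nvx eqxx orbT.
  by rewrite rcons_path last_rcons => /andP[_ /and5P[_ _ ? _ ?]] ->.
pose psi z := if z \in D then (if phi z == c then d else c) else phi z.
have psiD z : z \in D -> (phi z = c /\ psi z = d) \/ (phi z = d /\ psi z = c).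
  move=> zD; have [_ /orP[]/eqP E] := Dx z zD; rewrite /psi zD E ?eqxx; first by left.
  by right; rewrite (negPf ndc).
have psiN z : z \notin D -> psi z = phi z by rewrite /psi => /negPf->.
have psi_prop : proper_off x psi.
  split=> [z nzx|a b na nb ab].
    have [zD|zD] := boolP (z \in D); last by rewrite psiN ?phik.
    by case: (psiD z zD) => -[_ ->].
  have nab := phiP na nb ab.
  have mixed_case a' b' : a' \in D -> b' \notin D -> e a' b' -> b' != x -> psi a' != psi b'.
    move=> aD bD ab' nb'; rewrite (psiN b') //.
    apply: contra bD => /eqP E; apply: (Dcl a') => //; have [na' ca'] := Dx _ aD.
    rewrite /kap ab' na' nb' ca' -E.
    by case: (psiD a' aD) => -[_ ->]; rewrite eqxx ?orbT.
  have [aD|aD] := boolP (a \in D); have [bD|bD] := boolP (b \in D).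
  - case: (psiD a aD) => -[pa ->]; case: (psiD b bD) => -[pb ->] //.
    + by rewrite pa pb eqxx in nab.
    + by rewrite pa pb eqxx in nab.
  - exact: mixed_case.
  - by rewrite eq_sym; apply: mixed_case; rewrite // e_sym.
  - by rewrite !psiN.
have vD : v \in D by rewrite inE connect0.
have UD z : z \in U -> z \in D -> z = v.
  move=> zU zD; have [nzx /orP[]/eqP E] := Dx z zD.
    by case/eqP: (cU z zU nzx).
  exact: U_inj.
have psiU z : z \in U -> z != x -> psi z != d.
  move=> zU nzx; have [zD|zD] := boolP (z \in D).
    by rewrite (UD z zU zD) /psi vD -/d (negPf ndc).
  rewrite psiN //; apply: contraNneq zD => E.
  by rewrite (U_inj zU vU nzx nvx E).
have freeS s y : s \in U -> free_at phi s d -> e s y -> y \notin U -> phi y = c ->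
    y \notin D -> free_at psi s d.
  move=> sU fs sy yU yc yD; apply/forallP=> z; apply/implyP=> /andP[sz zU].
  have zd := free_atP fs sz zU.
  have [zD|zD] := boolP (z \in D); last by rewrite psiN.
  case: (psiD z zD) => -[pz ->]; last by [].
  have [Ez|nzy] := eqVneq z y; first by rewrite -Ez zD in yD.
  have nzx : z != x by apply: contraNneq zU => ->.
  have nyx : y != x by apply: contraNneq yU => ->.
  by have := phiP nzx nyx (cliqueO sU zU yU sz sy nzy); rewrite pz yc eqxx.
pose F0 := fun a b => F a b && (b != v).
(* Fan steps that do not enter v survive the swap. *)
have sub0 : subrel F0 (fan psi x).
  move=> a b /andP[/and3P[bU nbx fb] nbv].
  have bD : b \notin D by apply: contra nbv => bD; apply/eqP/UD.
  rewrite /fan bU nbx psiN //=; apply/forallP=> z; apply/implyP=> /andP[az zU].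
  have [zD|zD] := boolP (z \in D); last by rewrite psiN ?(free_atP fb).
  case: (psiD z zD) => -[_ ->]; rewrite eq_sym; first by apply: contra nbv => /eqP E; apply/eqP/U_inj.
  exact: cU.
have sub0c a b : connect F0 a b -> connect (fan psi x) a b.
  by apply: connect_sub => {}a {}b ab; apply/connect1/sub0.
have finish s : connect (fan psi x) x s -> free_at psi s d -> False.
  case/connectP=> p0 pp0 ->; case/shortenP: pp0 => p pp Up _ fs.
  by apply: nocol; apply: (fan_shift psi_prop xU pp Up vk psiU fs).
have xv : connect F x v by apply: connect_trans xu1 (connect1 F1).
have nxv : x != v by rewrite eq_sym.
(* w is the member from which the fan first enters v.  If D misses the far end of
   w, shift from w; otherwise it misses the far end of another member missing
   d, and the fan still leads there, since the step from w to v survives too. *)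
have [w [xw Fwv nwv]] := connect_enter xv nxv.
have xwF : connect F x w.
  by apply: connect_sub xw => a b /andP[ab _]; apply: connect1.
have wU := connect_in_U xwF; have [_ _ fw] := and3P Fwv.
have [y [wy yU yc]] := present w xwF.
have [yD|yD] := boolP (y \in D); last first.
  by apply: (finish w (sub0c _ _ xw)); apply: freeS yD.
have [u [xu nuv nuw fu]] : exists u, [/\ connect F x u, u != v, u != w & free_at phi u d].
  have [Ew|nw] := eqVneq u1 w.
    by exists u2; split; rewrite // eq_sym // -Ew.
  by exists u1; split; rewrite // eq_sym.
have uU := connect_in_U xu; have [y' [uy' y'U y'c]] := present u xu.
have y'D : y' \notin D.
  by apply/negP=> y'D; apply: (one u w y' y) yD.
apply: (finish u); last exact: freeS y'D.
case: (connect_avoid v xu) => [|vu]; first exact: sub0c.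
apply: connect_trans (sub0c _ _ xw) (connect_trans _ (sub0c _ _ vu)).
apply: connect1; rewrite /fan vU nvx /=; apply/forallP=> z; apply/implyP=> /andP[wz zU].
have -> : psi v = c by rewrite /psi vD -/d (negPf ndc).
have [zD|zD] := boolP (z \in D).
  case: (psiD z zD) => -[pz ->] //.
  by move: (free_atP fw wz zU); rewrite pz /d eqxx.
rewrite psiN //; apply: contraNneq zD => pz.
have [->//|nzy] := eqVneq z y.
have nzx : z != x by apply: contraNneq zU => ->.
have nyx : y != x by apply: contraNneq yU => ->.
by have := phiP nzx nyx (cliqueO wU zU yU wz wy nzy); rewrite pz yc eqxx.
Qed.

End Fan.

(** Colour everything except one vertex x and fan around x inside one of the two
    maximal cliques of x. *)
Lemma vizing_clique : critical e k -> exists2 Q : {set T}, clique e Q & k <= #|Q|.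
Proof.
move=> [nocol crit].
have [|noQ] := boolP [exists Q : {set T}, (k <= #|Q|) && [forall x in Q, forall y in Q, (x != y) ==> e x y]].
  case/existsP=> Q /andP[kQ /forall_inP cQ]; exists Q => // x y xQ yQ.
  by apply/implyP; move: y yQ; apply/forall_inP/cQ.
have small Q : clique e Q -> #|Q| < k.
  move=> cQ; rewrite ltnNge; apply: contra noQ => kQ; apply/existsP; exists Q.
  rewrite kQ; apply/forall_inP=> x xQ; apply/forall_inP=> y yQ.
  by apply/implyP; apply: cQ.
exfalso.
have [x _|T0] := pickP (mem [set: T]); last first.
  by apply: nocol; exists (fun=> 0); split=> [x|x y]; rewrite -?[x \in _](T0 x) ?inE; move: (T0 x); rewrite /= inE.
have [|phi [phik phiP]] := crit (~: [set x]).
  by apply/eqP=> /setP/(_ x); rewrite !inE eqxx.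
have prop : proper_off x phi.
  by split=> [u nu|u v nu nv]; [apply: phik | apply: phiP]; rewrite !inE.
have k1 : 1 < k.
  have := small [set x]; rewrite cards1; apply.
  by move=> u v; rewrite !inE => /eqP-> /eqP->; rewrite eqxx.
have [/existsP[a xa]|nonbr] := boolP [exists a, e x a]; last first.
  apply: nocol; exists (fun z => if z == x then 0 else phi z); split=> [z _|u v _ _ uv].
    by case: eqVneq => [_|nz]; [apply: ltnW | apply: prop.1].
  have nx z : e x z = false by apply: contraNF nonbr => xz; apply/existsP; exists z.
  have [Eu|nu] := eqVneq u x; first by rewrite Eu nx in uv.
  have [Ev|nv] := eqVneq v x; first by rewrite Ev e_sym nx in uv.
  exact: prop.2.
have [cliqueU at1U cliqueO xU _] := line_like_star xa.
exact: (kempe_false cliqueU at1U cliqueO small xU prop nocol).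
Qed.

End Vizing.

(** * Critical graphs and models *)

Section Colourings.
Variables (T : finType) (e : rel T).
Hypotheses (e_sym : symmetric e) (e_irr : irreflexive e).

Lemma col_mono (A : {set T}) k k' : k <= k' -> col e A k -> col e A k'.
Proof.
by move=> lek [c [ck cP]]; exists c; split=> // x /ck xk; apply: leq_trans xk lek.
Qed.

Lemma col_sub (A B : {set T}) k : A \subset B -> col e B k -> col e A k.
Proof.
move=> /subsetP sAB [c [ck cP]]; exists c; split=> [x /sAB/ck//|x y /sAB xB /sAB].
exact: cP.
Qed.

Lemma col_union (A B : {set T}) a b : col e A a -> col e B b -> col e (A :|: B) (a + b).
Proof.
move=> [c [ca cP]] [d [db dP]].
have inB x : x \in A :|: B -> x \notin A -> x \in B by case/setUP=> // ->.
exists (fun x => if x \in A then c x else a + d x); split=> [x xAB|x y xAB yAB xy].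
  case: ifP => [/ca/leq_trans->//|/negbT /(inB x xAB)/db xb]; first exact: leq_addr.
  by rewrite ltn_add2l.
case: ifP => [xA|/negbT /(inB x xAB) xB]; case: ifP => [yA|/negbT /(inB y yAB) yB].
- exact: cP.
- by have := ca _ xA; lia.
- by have := ca _ yA; lia.
- by rewrite eqn_add2l dP.
Qed.

Lemma col_one (A : {set T}) : (forall x y, x \in A -> y \in A -> ~~ e x y) -> col e A 1.
Proof.
move=> st; exists (fun=> 0); split=> // x y xA yA.
by rewrite (negPf (st x y xA yA)).
Qed.

Lemma col_card (A : {set T}) : col e A #|A|.
Proof.
exists (fun x => index x (enum A)); split=> [x xA|x y xA yA xy].
  by rewrite cardE index_mem mem_enum.
apply: contraTneq xy => E.
have := nth_index x (s := enum A) (x := x); rewrite mem_enum xA => /(_ isT) Ex.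
have := nth_index x (s := enum A) (x := y); rewrite mem_enum yA => /(_ isT).
by rewrite -E Ex => ->; rewrite e_irr.
Qed.

(** The two sides of a join use disjoint sets of colours. *)
Lemma col_join (A B : {set T}) k : (forall x y, x \in A -> y \in B -> e x y) ->
  col e (A :|: B) k -> exists a b, [/\ a + b <= k, col e A a & col e B b].
Proof.
move=> AB [c [ck cP]].
have [k0|k0] := posnP k.
  have no x : x \in A :|: B -> False by move/ck; rewrite k0.
  exists 0, 0; split=> //; exists (fun=> 0); split=> [x xA|x y xA _ _];
    by case: (no x); rewrite inE xA ?orbT.
pose c' x : 'I_k := Ordinal (ltn_pmod (c x) k0).
have c'E x : x \in A :|: B -> c' x = c x :> nat by move=> /ck; rewrite /= => /modn_small.
have relabel (D : {set T}) : D \subset A :|: B -> col e D #|c' @: D|.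
  move/subsetP=> sD; exists (fun x => index (c' x) (enum (c' @: D))); split=> [x xD|x y xD yD xy].
    by rewrite cardE index_mem mem_enum imset_f.
  apply: contra (cP x y (sD x xD) (sD y yD) xy) => /eqP E.
  have mx : c' x \in enum (c' @: D) by rewrite mem_enum imset_f.
  have my : c' y \in enum (c' @: D) by rewrite mem_enum imset_f.
  rewrite -!c'E ?sD //; apply/eqP; congr nat_of_ord.
  by rewrite -(nth_index (c' x) mx) E nth_index.
exists #|c' @: A|, #|c' @: B|; split; [|apply: relabel; exact: subsetUl|apply: relabel; exact: subsetUr].
have -> : #|c' @: A| + #|c' @: B| = #|c' @: A :|: c' @: B|.
  rewrite cardsU -[LHS]subn0; congr (_ - _); apply/esym/eqP; rewrite cards_eq0.
  apply/eqP/setP=> i; rewrite !inE; apply/negbTE/negP=> /andP[/imsetP[x xA ->] /imsetP[y yB E]].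
  have xAB : x \in A :|: B by rewrite inE xA.
  have yAB : y \in A :|: B by rewrite inE yB orbT.
  have := cP x y xAB yAB (AB x y xA yB).
  by rewrite -!c'E // E eqxx.
by rewrite -[X in _ <= X]card_ord max_card.
Qed.

(** A vertex can take the colour of a non-adjacent vertex that dominates it. *)
Lemma critical_dominated k a v : critical e k -> a != v -> ~~ e a v ->
  (forall z, e a z -> e v z) -> False.
Proof.
move=> [nocol crit] nav eav dom.
have [|c [ck cP]] := crit (~: [set a]).
  by apply/eqP=> /setP/(_ a); rewrite !inE eqxx.
have cin x : x != a -> x \in ~: [set a] by rewrite !inE.
have vin : v \in ~: [set a] by rewrite cin // eq_sym.
apply: nocol; exists (fun x => if x == a then c v else c x); split=> [x _|x y _ _ xy].
  by case: eqVneq => [_|/cin/ck//]; apply: ck.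
have [Ex|nx] := eqVneq x a; have [Ey|ny] := eqVneq y a.
- by rewrite Ex Ey e_irr in xy.
- by apply: cP => //; [apply: cin | apply: dom; rewrite -Ex].
- by rewrite eq_sym; apply: cP => //; [apply: cin | apply: dom; rewrite -Ey e_sym].
- by apply: cP => //; apply: cin.
Qed.

End Colourings.

(** Branch sets are indexed by nat so that models can be cut and concatenated;
    only the indices below t count. *)
Definition model (T : finType) (e : rel T) (A : {set T}) t :=
  exists S : nat -> {set T},
  [/\ forall i, i < t -> [/\ S i \subset A, S i != set0 & linked e (S i)],
      forall i j, i < t -> j < t -> i != j -> [disjoint S i & S j],
      forall i j, i < t -> j < t -> i != j -> exists u v, [/\ u \in S i, v \in S j & e u v] &
      forall i j, i < t -> j < t -> 2 < #|S i| -> 2 < #|S j| -> i = j].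

(** * Complements of line graphs: the number of vertices *)

Section LongestPath.
Variables (T : finType) (r : rel T).
Hypothesis r_sym : symmetric r.

Definition path_in (W : {set T}) s := [&& uniq s, sorted r s & all [in W] s].

Lemma longest_path (W : {set T}) x : x \in W -> exists s,
  [/\ path_in W s, 0 < size s & forall s', path_in W s' -> size s' <= size s].
Proof.
move=> xW; pose P n := [exists s : n.-tuple T, path_in W s].
have P1 : exists n, P n.
  by exists 1; apply/existsP; exists [tuple x]; rewrite /path_in /= xW.
have leP n : P n -> n <= #|W|.
  case/existsP=> s /and3P[Us _ /allP sW]; rewrite -(size_tuple s) -(card_uniqP Us).
  by apply: subset_leq_card; apply/subsetP=> y /sW.
have inP s : path_in W s -> P (size s).
  by move=> ps; apply/existsP; exists (in_tuple s).
have [n /existsP[s ps] maxn] := ex_maxnP P1 leP.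
exists s; split=> //; last by move=> s' /inP/maxn; rewrite size_tuple.
by rewrite size_tuple; apply: (maxn 1); apply/existsP; exists [tuple x]; rewrite /path_in /= xW.
Qed.

Lemma sorted_cross (B : {set T}) s x y : sorted r s -> x \in s -> y \in s ->
  x \in B -> y \notin B -> exists u v, [/\ u \in s, v \in s, u \in B, v \notin B & r u v].
Proof.
elim: s x y => //= a s IH x y.
case: s IH => [|b s] IH; first by rewrite !inE => _ /eqP-> /eqP-> ->.
move=> /= /andP[ab ps]; have lift : (exists u v, [/\ u \in b :: s, v \in b :: s, u \in B, v \notin B & r u v]) ->
    exists u v, [/\ u \in [:: a, b & s], v \in [:: a, b & s], u \in B, v \notin B & r u v].
  by case=> u [v [us vs uB vB ruv]]; exists u, v; split=> //; rewrite inE ?us ?vs orbT.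
have [aB|aB] := boolP (a \in B); have [bB|bB] := boolP (b \in B).
- rewrite !(in_cons a) => _ /orP[/eqP->|ys] _ yB; first by rewrite aB in yB.
  by apply: lift; apply: (IH b y) => //; rewrite mem_head.
- by move=> _ _ _ _; exists a, b; rewrite !inE !eqxx orbT.
- by move=> _ _ _ _; exists b, a; rewrite !inE !eqxx orbT r_sym.
- rewrite !(in_cons a) => /orP[/eqP->|xs] _ xB _; first by rewrite xB in aB.
  by apply: lift; apply: (IH x b) => //; rewrite mem_head.
Qed.

End LongestPath.

Section Sumner.
Variables (T : finType) (r : rel T).
Hypotheses (r_sym : symmetric r) (r_irr : irreflexive r).
Hypothesis clawF : forall u x y z, r u x -> r u y -> r u z -> x != y -> y != z -> x != z ->
  ~~ r x y -> ~~ r y z -> ~~ r x z -> False.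

(** The first two vertices of a longest path can be removed: in a claw-free graph
    the first vertex has no neighbour off the path, and if the second one had
    such a neighbour, either a claw or a longer path would appear. *)
Lemma linked_remove_edge (W : {set T}) : linked r W -> 2 < #|W| ->
  exists u p, [/\ u \in W, p \in W, r u p & linked r (W :\ u :\ p)].
Proof.
move=> linkW W3.
have [x0 x0W] : exists x, x \in W by apply/set0Pn; rewrite -card_gt0; lia.
have [s [ps s0 maxs]] := longest_path r x0W.
have irr a b : r a b -> a != b by move=> ab; apply: contraTneq ab => ->; rewrite r_irr.
have head_closed h s' : path_in r W (h :: s') -> size (h :: s') = size s ->
    forall z, z \in W -> r h z -> z \in h :: s'.
  case/and3P=> Us srt al Esz z zW hz; apply: contraT => zs.
  have := maxs (z :: h :: s'); rewrite /path_in /= in Us srt al *.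
  have /= := zs; rewrite zs Us r_sym hz srt zW al /= -Esz /= => _ /(_ isT).
  by rewrite ltnn.
case: s s0 ps maxs head_closed => // u [|p [|pp rest]] _ ps maxs head_closed.
- have /and3P[_ _ /andP[uW _]] := ps.
  suff : W \subset [set u] by move/subset_leq_card; rewrite cards1; lia.
  apply: (linked_sub linkW uW); first exact: set11.
  move=> a b aW bW /set1P-> ub; have := head_closed u [::] ps erefl b bW ub.
  by rewrite !inE.
- have /and3P[Us /andP[up _] /and3P[uW pW _]] := ps.
  suff : W \subset [set u; p] by move/subset_leq_card; rewrite cards2; case: (u != p) => /=; lia.
  apply: (linked_sub linkW uW); first by rewrite !inE eqxx.
  have ps' : path_in r W [:: p; u].
    move: Us; rewrite /path_in /= !inE => /andP[npu _].
    by rewrite eq_sym npu r_sym up uW pW.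
  move=> a b aW bW; rewrite !inE => /orP[/eqP->|/eqP->].
    by move=> ub; have := head_closed u [:: p] ps erefl b bW ub; rewrite !inE.
  by move=> pb; have := head_closed p [:: u] ps' erefl b bW pb; rewrite !inE orbC.
have /and3P[] := ps; rewrite [sorted _ _]/= [all _ _]/= => Us /and3P[up ppp srt] /and4P[uW pW ppW restW].
exists u, p; split=> //.
have [nup nupp urest] : [/\ u != p, u != pp & u \notin rest].
  by move: Us; rewrite /= !inE !negb_or => /andP[/and3P[]].
have [nppp prest] : p != pp /\ p \notin rest.
  by move: Us; rewrite /= !inE !negb_or => /and3P[_ /andP[]].
have pprest : pp \notin rest by case/and4P: Us.
have Urest : uniq rest by case/and4P: Us.
have far_u w : w \in W -> w \notin [:: u, p, pp & rest] -> ~~ r u w.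
  move=> wW; apply: contra => uw; exact: head_closed ps erefl w wW uw.
have far_p w : w \in W -> w \notin [:: u, p, pp & rest] -> ~~ r p w.
  move=> wW ws; apply/negP=> pw.
  have := ws; rewrite !inE !negb_or => /and4P[nwu nwp nwpp wrest].
  have uw := far_u w wW ws.
  have wp : r w p by rewrite r_sym.
  have ppu : r p u by rewrite r_sym.
  have long a b : a != b -> a != p -> a != pp -> a \notin rest -> b != p -> b != pp ->
      b \notin rest -> a \in W -> b \in W -> r a p -> r p b -> r b pp -> False.
    move=> nab nap napp arest nbp nbpp brest aW bW ap pb bpp.
    have := maxs [:: a, p, b, pp & rest]; rewrite /path_in /= !inE !negb_or.
    rewrite nab nap napp arest (eq_sym p) nbp nppp prest nbpp brest pprest Urest.
    by rewrite ap pb bpp srt aW bW pW ppW restW ltnn => /(_ isT).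
  have nuw : u != w by rewrite eq_sym.
  have [wpp|wpp] := boolP (r w pp); first by apply: (long u w).
  have [upp|upp] := boolP (r u pp); first by apply: (long w u).
  exact: (clawF ppu pw ppp nuw nwpp nupp).
pose s' := pp :: rest.
have sW' z : z \in s' -> z \in W :\ u :\ p.
  move=> zs; rewrite !inE; apply/and3P; split.
  - by apply: contraTneq zs => ->; rewrite inE negb_or nppp.
  - by apply: contraTneq zs => ->; rewrite inE negb_or nupp.
  - by move: zs; rewrite inE => /orP[/eqP->//|/(allP restW)].
have sep (B : {set T}) y : y \in W :\ u :\ p -> y \in B -> [disjoint s' & B] ->
    exists a b, [/\ a \in W :\ u :\ p, b \in W :\ u :\ p, a \in B, b \notin B & r a b].
  move=> yW' yB dis; have yW : y \in W by move: yW'; rewrite !inE => /and3P[].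
  pose C := B :&: (W :\ u :\ p).
  have [||a [b [aW bW]]] := linkW C y u yW uW; rewrite ?inE ?eqxx ?andbF //.
    by rewrite yB; move: yW'; rewrite !inE.
  move=> /andP[aB /and3P[nap nau _]] bC ab; exists a, b.
  have as_ : a \notin s' by apply: contraL aB => as_; rewrite (disjointFr dis as_).
  have aout : a \notin [:: u, p, pp & rest] by rewrite in_cons negb_or nau in_cons negb_or nap.
  have nbu : b != u by apply: contraTneq ab => ->; rewrite r_sym far_u.
  have nbp : b != p by apply: contraTneq ab => ->; rewrite r_sym far_p.
  move: bC; rewrite nbp nbu bW !andbT => bB.
  by split=> //; rewrite !inE ?nau ?nap ?nbu ?nbp.
move=> B x y xW yW xB yB.
have [/existsP[a /andP[as_ aB]]|dis] := boolP [exists a, (a \in s') && (a \in B)]; last first.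
  apply: (sep B x) => //; apply/pred0P=> z /=; apply: contraNF dis => ?.
  by apply/existsP; exists z.
have [/existsP[b /andP[bs bB]]|dis] := boolP [exists b, (b \in s') && (b \notin B)].
  have [a' [b' [as' bs' aB' bB' ab']]] := sorted_cross r_sym (s := s') srt as_ bs aB bB.
  by exists a', b'; split=> //; apply: sW'.
have disC : [disjoint s' & ~: B].
  apply/pred0P=> z /=; rewrite in_setC; apply: contraNF dis => ?.
  by apply/existsP; exists z.
have yC : y \in ~: B by rewrite inE.
have [a' [b' [aW' bW' aB' bB' ab]]] := sep _ y yW yC disC.
exists b', a'; rewrite r_sym ab; split=> //; first by move: bB'; rewrite inE negbK.
by move: aB'; rewrite inE.
Qed.

End Sumner.

Section CoLine.
Variables (T : finType) (e : rel T) (k : nat).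
Hypotheses (e_sym : symmetric e) (e_irr : irreflexive e).
Let f := nonadj e.
Hypotheses (lineF : line_like f) (linkF : linked f setT) (crit : critical e k).

Let f_sym : symmetric f := nonadj_sym e_sym.
Let f_irr : irreflexive f. Proof. by move=> x; rewrite /f /nonadj eqxx. Qed.
Let nocol : ~ col e setT k := crit.1.

Let fN x y : f x y -> ~~ e x y. Proof. by case/andP. Qed.
Let fE x y : x != y -> e x y = ~~ f x y.
Proof. by rewrite /f /nonadj => ->; rewrite negbK. Qed.
Let f_neq x y : f x y -> x != y. Proof. by case/andP. Qed.

Lemma co_claw_free u x y z : f u x -> f u y -> f u z -> x != y -> y != z -> x != z ->
  ~~ f x y -> ~~ f y z -> ~~ f x z -> False.
Proof.
move=> ux uy uz nxy nyz nxz xy yz xz; have := lineF ux uy uz nxy nyz nxz.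
by rewrite (negPf xy) (negPf yz) (negPf xz).
Qed.

(** Remove adjacent vertices in pairs, keeping the graph f connected; each pair is
    a colour class for e. *)
Lemma linked_col (W : {set T}) : linked f W -> col e W #|W|.+1./2.
Proof.
have [n] := ubnP #|W|; elim: n W => // n IH W /ltnSE leW lW.
have [W3|W2] := ltnP 2 #|W|.
  have [u [p [uW pW up lW']]] := linked_remove_edge f_sym f_irr co_claw_free lW W3.
  have nup := f_neq up.
  have cW : #|W| = #|W :\ u :\ p|.+2.
    by rewrite (cardsD1 u) uW (cardsD1 p) !inE eq_sym nup pW.
  have cW' : col e (W :\ u :\ p) #|W :\ u :\ p|.+1./2 by apply: IH => //; lia.
  have cup : col e [set u; p] 1.
    apply: col_one => x y; rewrite !inE => /orP[]/eqP-> /orP[]/eqP->; rewrite ?e_irr //.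
      exact: fN.
    by rewrite e_sym fN.
  have := col_union cup cW'; rewrite cW add1n => c.
  apply: col_sub c; apply/subsetP=> z zW; rewrite !inE.
  by case: (z == u); case: (z == p) => //=; rewrite zW.
case: (ltngtP #|W| 1) => [|W2'|W1].
- rewrite ltnS leqn0 => /eqP W0; have -> : W = set0 by apply/eqP; rewrite -cards_eq0 W0.
  by exists (fun=> 0); split=> x; rewrite inE.
- have -> : #|W| = 2 by lia.
  have /cards2P[x [y [nxy EW]]] : #|W| == 2 by apply/eqP; lia.
  have xW : x \in W by rewrite EW !inE eqxx.
  have yW : y \in W by rewrite EW !inE eqxx orbT.
  have nyx : y \notin [set x] by rewrite inE eq_sym.
  have [a [b [_ bW aB bB ab]]] := lW [set x] x y xW yW (set11 x) nyx.
  move: aB bB; rewrite !inE => /eqP Ea bB; rewrite Ea in ab.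
  have Eb : b = y by move: bW; rewrite EW !inE (negPf bB) => /eqP.
  rewrite EW; have xb := ab.
  apply: col_one => u v; rewrite !inE => /orP[]/eqP-> /orP[]/eqP->; rewrite ?e_irr //.
    by rewrite -Eb fN.
  by rewrite e_sym -Eb fN.
- have c := col_card e_irr W.
  by move: c; rewrite W1.
Qed.

Section Star.
Variable S : {set T}.
Hypothesis cliqueS : clique f S.
Hypothesis cliqueO : forall u v w, u \in S -> v \notin S -> w \notin S ->
  f u v -> f u w -> v != w -> f v w.

Lemma star_stable x y : x \in S -> y \in S -> ~~ e x y.
Proof.
move=> xS yS; have [->|nxy] := eqVneq x y; first by rewrite e_irr.
by apply/fN/cliqueS.
Qed.

(** Suppose that the outside of S falls into W and R without f-edges between them.
    By cliqueO each vertex of S has its f-neighbours outside S on one side only;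
    let S1 be those on the side of W.  In e, then, W is completely joined to R
    and to the rest of S, and R is completely joined to W and S1.  Removing S1,
    or the rest of S, leaves a join with a k-colouring, so the two sides use
    disjoint sets of colours.  Adding up the four numbers of colours, either W
    with S1 and R with the rest of S use at most k colours together, or W, R and
    S do, as S is a single colour class. *)
Lemma star_complement_linked : linked f (~: S).
Proof.
move=> B x y xS yS xB yB.
have [/existsP[u /existsP[v /and5P[*]]]|no] := boolP [exists u, exists v,
   [&& u \in ~: S, v \in ~: S, u \in B, v \notin B & f u v]]; first by exists u, v.
have noF u v : u \notin S -> v \notin S -> u \in B -> v \notin B -> f u v -> False.
  move=> uS vS uB vB uv; case/negP: no; apply/existsP; exists u; apply/existsP.
  by exists v; rewrite !in_setC uS vS uB vB.
exfalso; rewrite !in_setC in xS yS.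
pose S1 := [set s in S | [exists w, [&& w \notin S, w \in B & f s w]]].
have S1B s w : s \in S1 -> w \notin S -> f s w -> w \in B.
  rewrite inE => /andP[sS /existsP[z /and3P[zS zB sz]]] wS sw; apply: contraT => wB.
  have nzw : z != w by apply: contraNneq wB => <-.
  by case: (noF z w zS wS zB wB (cliqueO sS zS wS sz sw nzw)).
have S2B s w : s \in S -> s \notin S1 -> w \notin S -> f s w -> w \notin B.
  move=> sS; rewrite inE sS /= negb_exists => /forallP sw wS fsw.
  by have := sw w; rewrite wS fsw andbT.
have [s1 s1S1] : exists s, s \in S1.
  have [u [v [_ _ uP vP uv]]] := linkF (B := [set z | (z \notin S) && (z \in B)]) (x := x) (y := y)
    (in_setT _) (in_setT _) (ltac:(by rewrite inE xS xB)) (ltac:(by rewrite inE (negPf yB) andbF)).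
  move: uP vP; rewrite !inE negb_and negbK => /andP[uS uB].
  have [vS _|vS /= vB] := boolP (v \in S); last by case: (noF u v).
  by exists v; rewrite inE vS; apply/existsP; exists u; rewrite uS uB f_sym.
have [s2 s2S s2S1] : exists2 s, s \in S & s \notin S1.
  have [u [v [_ _ uP vP uv]]] := linkF (B := [set z | (z \notin S) && (z \notin B)]) (x := y) (y := x)
    (in_setT _) (in_setT _) (ltac:(by rewrite inE yS yB)) (ltac:(by rewrite inE xB andbF)).
  move: uP vP; rewrite !inE negb_and !negbK => /andP[uS uB].
  have [vS _|vS /= vB] := boolP (v \in S); last by case: (noF v u); rewrite // f_sym.
  exists v => //; apply/negP=> vS1; case/negP: uB; apply: (S1B v) => //.
  by rewrite f_sym.
have s1S : s1 \in S by move: s1S1; rewrite inE => /andP[].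
pose W := ~: S :&: B; pose R := ~: S :\: B.
have joined (A C : {set T}) : ~: A = W :|: C -> A != set0 ->
    (forall u v, u \in W -> v \in C -> e u v) ->
    exists a b, [/\ a + b <= k, col e W a & col e C b].
  move=> EA A0 WC; apply: (col_join WC); rewrite -EA; apply: crit.2.
  by apply: contraNneq A0 => E; rewrite -[A]setCK E setCT.
have [a1 [b1 [ab1 cW cR2]]] : exists a b, [/\ a + b <= k, col e W a & col e (R :|: (S :\: S1)) b].
  apply: (joined S1).
  - apply/setP=> z; rewrite !in_setU in_setI !in_setD !in_setC.
    have [zS|zS] := boolP (z \in S); first by rewrite /= andbF andbT.
    by rewrite inE (negPf zS) /=; case: (z \in B).
  - by apply/set0Pn; exists s1.
  - move=> u v; rewrite !inE => /andP[uS uB] /orP[/andP[vB vS]|/andP[vS1 vS]].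
      have nuv : u != v by apply: contraNneq vB => <-.
      by rewrite fE //; apply/negP; apply: noF.
    have nuv : u != v by apply: contraNneq uS => ->.
    rewrite fE //; apply/negP=> uv.
    have vS1' : v \notin S1 by rewrite inE.
    by have := S2B v u vS vS1' uS (ltac:(by rewrite f_sym)); rewrite uB.
have [b2 [a2 [ab2 cR cW2]]] : exists b a, [/\ b + a <= k, col e R b & col e (W :|: S1) a].
  apply: col_join.
    move=> u v; rewrite !inE => /andP[uB uS] /orP[/andP[vS vB]|/andP[vS /existsP[w /and3P[wS wB vw]]]].
      have nuv : u != v by apply: contraNneq uB => ->.
      by rewrite fE // f_sym; apply/negP; apply: noF.
    have nuv : u != v by apply: contraNneq uS => ->.
    rewrite fE //; apply/negP=> uv; case/negP: uB; apply: (S1B v) => //; last by rewrite f_sym.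
    by rewrite inE vS; apply/existsP; exists w; rewrite wS wB.
  apply: (@col_sub _ _ _ (~: (S :\: S1))).
    apply/subsetP=> z; rewrite in_setC in_setD !in_setU in_setI in_setD !in_setC.
    by case: (z \in S); case: (z \in S1); case: (z \in B).
  apply: crit.2; apply/eqP=> /setP/(_ s2); rewrite in_setC in_setT => /negP; apply.
  by rewrite inE s2S1.
have cS : col e S 1 by apply: col_one; exact: star_stable.
have lek : k <= a1 + b2.
  rewrite leqNgt; apply/negP=> lt; apply: nocol.
  apply: (@col_mono _ _ _ (1 + (a1 + b2))); first by lia.
  have := col_union cS (col_union cW cR); apply: col_sub.
  by apply/subsetP=> z _; rewrite !in_setU in_setI in_setD in_setC; case: (z \in S); case: (z \in B).
apply: nocol; apply: (@col_mono _ _ _ (a2 + b1)); first by lia.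
have := col_union cW2 cR2; apply: col_sub.
apply/subsetP=> z _; rewrite in_setU; have [zS|zS] := boolP (z \in S).
  have [zS1|zS1] := boolP (z \in S1); first by rewrite in_setU zS1 orbT.
  by rewrite [X in _ || X]in_setU in_setD zS zS1 !orbT.
by rewrite !in_setU in_setI !in_setD in_setC (negPf zS) andbF; case: (z \in B); case: (z \in S1).
Qed.

(** S is one colour class of size at least 3 and the rest is coloured in pairs. *)
Lemma star_card : 2 < #|S| -> k.*2.+2 <= #|T|.
Proof.
move=> S3; have cC := linked_col star_complement_linked.
have cS : col e S 1 by apply: col_one; exact: star_stable.
have : k < 1 + #|~: S|.+1./2.
  rewrite ltnNge; apply/negP=> le; apply: nocol; apply: (col_mono le).
  by have := col_union cS cC; rewrite setUCr.
by have := cardsC S; lia.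
Qed.

End Star.

Lemma f_triangle_card x y z : f x y -> f y z -> f x z -> k.*2.+2 <= #|T|.
Proof.
move=> xy yz xz; have [clS _ clO xS yS] := line_like_star f_sym f_irr lineF xy.
have S3 : 2 < #|star f x y|.
  have zS : z \in star f x y by rewrite !inE xz yz !orbT.
  by apply/card_gt2P; exists x, y, z; split; split; rewrite ?f_neq // f_sym.
exact: (star_card clS clO S3).
Qed.

(** A claw-free graph f without triangles has maximum degree 2.  In a connected
    one, a proper subset W contains a vertex with an f-neighbour outside W, hence
    at most one inside; picking such vertices greedily gives half of W as a
    clique of e. *)
Lemma triangle_free_clique : (forall x y z, f x y -> f y z -> f x z -> False) ->
  exists2 Q : {set T}, clique e Q & k <= #|Q|.
Proof.
move=> tri.
have half n (W : {set T}) : #|W| < n -> W != setT -> exists I : {set T},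
    [/\ I \subset W, clique e I & #|W| <= #|I|.*2].
  elim: n W => // n IH W /ltnSE leW WT.
  have [->|[x0 x0W]] := set_0Vmem W.
    by exists set0; split; rewrite ?sub0set ?cards0 // => x y; rewrite inE.
  have [y0 y0W] : exists y, y \notin W.
    have : ~~ (setT \subset W) by rewrite subTset.
    by case/subsetPn=> y _ yW; exists y.
  have [w [z [_ _ wW zW wz]]] := linkF (in_setT x0) (in_setT y0) x0W y0W.
  pose N := [set u in W | f w u].
  have N1 : #|N| <= 1.
    rewrite leqNgt; apply/negP=> /card_gt1P[u [v]]; rewrite !inE.
    case=> /andP[uW wu] /andP[vW wv] nuv.
    have nuz : u != z by apply: contraNneq zW => <-.
    have nvz : v != z by apply: contraNneq zW => <-.
    have := lineF wu wv wz nuv nvz nuz.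
    have nf a b : f w a -> f w b -> f a b = false.
      by move=> wa wb; apply/negbTE/negP=> ab; apply: (tri w a b).
    by rewrite (nf u v) ?(nf v z) ?(nf u z).
  have sW' : W :\ w :\: N \subset W by apply/subsetP=> u; rewrite !inE => /and3P[].
  have cW : #|W| <= #|W :\ w :\: N|.+2.
    by rewrite (cardsD1 w) wW (cardsD (W :\ w) N); have := subset_leq_card (subsetIr (W :\ w) N); lia.
  have ltW : #|W :\ w :\: N| < #|W|.
    rewrite [X in _ < X](cardsD1 w) wW ltnS; apply: subset_leq_card; exact: subsetDl.
  have [||I [sI clI cI]] := IH (W :\ w :\: N).
  - exact: leq_trans ltW leW.
  - by apply/eqP=> E; have := in_setT w; rewrite -E !inE eqxx /= andbF.
  exists (w |: I); split.
  - by rewrite subUset sub1set wW (subset_trans sI).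
  - move=> u v /setU1P[->|uI] /setU1P[->|vI] nuv; last exact: clI.
    + by rewrite eqxx in nuv.
    + by have := subsetP sI v vI; rewrite !inE fE // => /and3P[+ _ vW]; rewrite vW.
    + by have := subsetP sI u uI; rewrite !inE e_sym fE 1?eq_sym // => /and3P[+ _ uW]; rewrite uW.
  - have wI : w \notin I by apply/negP=> /(subsetP sI); rewrite !inE eqxx /= andbF.
    by rewrite cardsU1 wI; lia.
have cT : k < #|T|.+1./2.
  have cT : col e setT #|T|.+1./2 by rewrite -cardsT; exact: linked_col linkF.
  by rewrite ltnNge; apply/negP=> le; apply: nocol (col_mono le cT).
have [v _] : exists v : T, v \in T.
  by have /card_gt0P[v vT] : 0 < #|T| by [lia]; exists v.
have [||I [_ clI cI]] := half #|T| (~: [set v]).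
- by have := cardsC [set v]; rewrite cards1; lia.
- by apply/eqP=> /setP/(_ v); rewrite !inE eqxx.
by exists I => //; have := cardsC [set v]; rewrite cards1; lia.
Qed.

Lemma co_line_card : (forall Q : {set T}, clique e Q -> #|Q| < k) -> k.*2.+2 <= #|T|.
Proof.
move=> small.
have [/existsP[x /existsP[y /existsP[z /and3P[xy yz xz]]]]|no] :=
  boolP [exists x, exists y, exists z, [&& f x y, f y z & f x z]].
  exact: f_triangle_card xy yz xz.
have [|Q clQ] := triangle_free_clique.
  move=> x y z xy yz xz; case/negP: no; apply/existsP; exists x; apply/existsP.
  by exists y; apply/existsP; exists z; rewrite xy yz xz.
by rewrite leqNgt small.
Qed.

End CoLine.

(** * Complements of line graphs: a matching without conflicts *)

Section Matchings.
Variables (T : finType) (e : rel T).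
Hypotheses (e_sym : symmetric e) (e_irr : irreflexive e).

Definition is_edge (X : {set T}) := [exists x, exists y, (X == [set x; y]) && e x y].
Definition matching (M : {set {set T}}) := trivIset M && [forall X in M, is_edge X].

Lemma is_edgeP (X : {set T}) : reflect (exists x y, X = [set x; y] /\ e x y) (is_edge X).
Proof.
apply: (iffP existsP) => [[x /existsP[y /andP[/eqP-> xy]]]|[x [y [-> xy]]]].
  by exists x, y.
by exists x; apply/existsP; exists y; rewrite eqxx.
Qed.

Lemma e_neq x y : e x y -> x != y.
Proof. by move=> xy; apply: contraTneq xy => ->; rewrite e_irr. Qed.

Lemma matching_edge M X : matching M -> X \in M -> exists x y, X = [set x; y] /\ e x y.
Proof. by case/andP=> _ /forall_inP H /H/is_edgeP. Qed.

Lemma matching_card2 M X : matching M -> X \in M -> #|X| = 2.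
Proof. by move=> mM /(matching_edge mM)[x [y [-> /e_neq xy]]]; rewrite cards2 xy. Qed.

Lemma matching_disjoint M X Y : matching M -> X \in M -> Y \in M -> X != Y -> [disjoint X & Y].
Proof. by case/andP=> /trivIsetP H _; apply: H. Qed.

Lemma matching_out M X Y x : matching M -> X \in M -> Y \in M -> X != Y -> x \in X -> x \notin Y.
Proof. by move=> mM XM YM nXY xX; rewrite (disjointFr (matching_disjoint mM XM YM nXY)). Qed.

Lemma matching_sub (M N : {set {set T}}) : N \subset M -> matching M -> matching N.
Proof.
move=> sNM /andP[tM /forall_inP eM]; rewrite /matching (trivIsetS sNM) //=.
by apply/forall_inP=> X /(subsetP sNM)/eM.
Qed.

Lemma matching_add M a b : matching M -> e a b -> a \notin cover M -> b \notin cover M ->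
  matching ([set a; b] |: M) /\ [set a; b] \notin M.
Proof.
move=> mM ab aM bM; have abM : [set a; b] \notin M.
  by apply: contra aM => abM; apply/bigcupP; exists [set a; b]; rewrite ?set21.
split=> //; apply/andP; split; last first.
  apply/forall_inP=> X /setU1P[->|XM]; first by apply/is_edgeP; exists a, b.
  by case/andP: mM => _ /forall_inP/(_ X XM).
have dis X : X \in M -> [disjoint [set a; b] & X].
  move=> XM; apply/pred0P=> z /=; rewrite !inE; apply/negP=> /andP[zab zX].
  by case/orP: zab => /eqP Ez; [case/negP: aM | case/negP: bM];
    apply/bigcupP; exists X; rewrite -?Ez.
apply/trivIsetP=> X Y /setU1P[->|XM] /setU1P[->|YM] nXY.
- by rewrite eqxx in nXY.
- exact: dis.
- by rewrite disjoint_sym; apply: dis.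
- exact: (matching_disjoint mM XM YM nXY).
Qed.

Lemma notin_coverD M X x : matching M -> X \in M -> x \in X -> x \notin cover (M :\ X).
Proof.
move=> mM XM xX; apply/negP=> /bigcupP[Y]; rewrite !inE => /andP[nYX YM] xY.
by move: (matching_out mM YM XM nYX xY); rewrite xX.
Qed.

Lemma cover_subD (M N : {set {set T}}) x : N \subset M -> x \notin cover M -> x \notin cover N.
Proof.
move=> /subsetP sNM; apply: contra => /bigcupP[X XN xX].
by apply/bigcupP; exists X => //; apply: sNM.
Qed.

Lemma cover_add M (A : {set T}) x : x \notin A -> x \notin cover M -> x \notin cover (A |: M).
Proof.
move=> xA xM; apply/negP=> /bigcupP[X /setU1P[->|XM] xX]; first by rewrite xX in xA.
by case/negP: xM; apply/bigcupP; exists X.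
Qed.

End Matchings.

Section Family.
Variables (T : finType) (e : rel T).
Hypotheses (e_sym : symmetric e) (e_irr : irreflexive e).

Lemma linked1 (x : T) : linked e [set x].
Proof. by move=> B y z /set1P-> /set1P-> xB; rewrite xB. Qed.

Lemma linked2 x y : e x y -> linked e [set x; y].
Proof. by move=> xy; apply: (linked_add e_sym (p := y)) => //; [apply: linked1|rewrite inE]. Qed.

Lemma model_family (A : {set T}) (F : {set {set T}}) t : t <= #|F| ->
  (forall X, X \in F -> [/\ X \subset A, X != set0 & linked e X]) ->
  (forall X Y, X \in F -> Y \in F -> X != Y -> [disjoint X & Y]) ->
  (forall X Y, X \in F -> Y \in F -> X != Y -> exists u v, [/\ u \in X, v \in Y & e u v]) ->
  (forall X Y, X \in F -> Y \in F -> 2 < #|X| -> 2 < #|Y| -> X = Y) ->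
  model e A t.
Proof.
move=> tF hF hd ha hs; pose S i := nth set0 (enum F) i.
have SF i : i < t -> S i \in F.
  by move=> it; rewrite -mem_enum mem_nth // -cardE (leq_trans it).
have inj i j : i < t -> j < t -> S i = S j -> i = j.
  move=> it jt /eqP; rewrite nth_uniq ?enum_uniq -?cardE ?(leq_trans it) ?(leq_trans jt) //.
  by move/eqP.
have neq i j : i < t -> j < t -> i != j -> S i != S j.
  by move=> it jt; apply: contraNneq => /inj-> .
exists S; split.
- by move=> i it; apply/hF/SF.
- by move=> i j it jt nij; apply: hd; rewrite ?SF ?neq.
- by move=> i j it jt nij; apply: ha; rewrite ?SF ?neq.
- by move=> i j it jt bi bj; apply: inj => //; apply: hs; rewrite ?SF.
Qed.

End Family.

Section CoLine.
Variables (T : finType) (e : rel T) (k : nat).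
Hypotheses (e_sym : symmetric e) (e_irr : irreflexive e).
Let f := nonadj e.
Hypotheses (lineF : line_like f) (nocol : ~ col e setT k).
Hypothesis small : forall Q : {set T}, clique e Q -> #|Q| < k.
Hypothesis cardT : k.*2.+2 <= #|T|.

Let f_sym : symmetric f := nonadj_sym e_sym.
Let f_irr : irreflexive f. Proof. by move=> x; rewrite /f /nonadj eqxx. Qed.
Let fN x y : f x y -> ~~ e x y. Proof. by case/andP. Qed.
Let eN x y : e x y -> f x y = false. Proof. by move=> xy; rewrite /f /nonadj xy andbF. Qed.
Let fE x y : x != y -> e x y = ~~ f x y.
Proof. by rewrite /f /nonadj => ->; rewrite negbK. Qed.
Let f_neq x y : f x y -> x != y. Proof. by case/andP. Qed.

(** Suppose that a maximum matching M has at most k edges, so that two vertices u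
    and u' are unmatched.  Since no augmentation is possible, each edge of M has
    an end that both u and u' miss.  These ends, together with the unmatched
    vertices, are stable in e, and what remains has at most one vertex from each
    edge of M: with a colour for the stable set this colours G too cheaply,
    whether the remainder is a clique or not. *)
Lemma large_matching : exists2 M : {set {set T}}, matching e M & k < #|M|.
Proof.
have m0 : matching e set0.
  apply/andP; split; first by apply/trivIsetP=> X; rewrite inE.
  by apply/forall_inP=> X; rewrite inE.
case: (arg_maxnP (fun M : {set {set T}} => #|M|) m0) => M mM maxM.
exists M => //; rewrite ltnNge; apply/negP=> leM.
have cM : #|cover M| = #|M|.*2.
  case/andP: (mM) => /eqP <- _.
  rewrite (eq_bigr (fun=> 2)); last by move=> X XM; apply: matching_card2 mM XM.
  by rewrite sum_nat_const muln2.
have /card_gt1P[u [u' [uU u'U nuu']]] : 1 < #|~: cover M|.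
  by have := cardsC (cover M); lia.
rewrite !inE in uU u'U.
have no_edge x y : x \notin cover M -> y \notin cover M -> ~~ e x y.
  move=> xM yM; apply/negP=> xy; have [m' nM] := matching_add mM xy xM yM.
  by have := maxM _ m'; rewrite /= cardsU1 nM add1n ltnn.
have fuu' : f u u' by rewrite /f /nonadj nuu' no_edge.
have fu'u : f u' u by rewrite f_sym.
have noaug X a b v v' : X \in M -> X = [set a; b] -> a != b -> v \notin cover M ->
    v' \notin cover M -> v != v' -> e v a -> e v' b -> False.
  move=> XM EX nab vM v'M nvv' va v'b.
  have sN : M :\ X \subset M by apply: subsetDl.
  have aX : a \in X by rewrite EX !inE eqxx.
  have bX : b \in X by rewrite EX !inE eqxx orbT.
  have inM z : z \in X -> z \in cover M by move=> zX; apply/bigcupP; exists X.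
  have mN := matching_sub sN mM.
  have aN := notin_coverD mM XM aX; have bN := notin_coverD mM XM bX.
  have [m1 n1] := matching_add mN va (cover_subD sN vM) aN.
  have v'N : v' \notin cover ([set v; a] |: M :\ X).
    apply: cover_add (cover_subD sN v'M); rewrite !inE negb_or eq_sym nvv'.
    by apply: contraNneq v'M => ->; apply: inM.
  have bN' : b \notin cover ([set v; a] |: M :\ X).
    apply: cover_add bN; rewrite !inE negb_or (eq_sym b a) nab andbT.
    by apply: contraNneq vM => <-; apply: inM.
  have [m2 n2] := matching_add m1 v'b v'N bN'.
  have := maxM _ m2; rewrite /= cardsU1 n2 cardsU1 n1.
  by rewrite (cardsD1 X M) XM !add1n ltnn.
have touch X : X \in M -> exists2 z, z \in X & f z u && f z u'.
  move=> XM; have [a [b [EX ab]]] := matching_edge mM XM.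
  have nab := e_neq e_irr ab; have nba : b != a by rewrite eq_sym.
  have aX : a \in X by rewrite EX !inE eqxx.
  have bX : b \in X by rewrite EX !inE eqxx orbT.
  have out v z : v \notin cover M -> z \in X -> v != z.
    by move=> vM zX; apply: contraNneq vM => ->; apply/bigcupP; exists X.
  have nua := out u a uU aX; have nub := out u b uU bX.
  have nu'a := out u' a u'U aX; have nu'b := out u' b u'U bX.
  have h1 : f u a || f u' b.
    apply: contraT; rewrite negb_or -!fE // => /andP[ua u'b].
    by case: (noaug X a b u u').
  have h2 : f u b || f u' a.
    apply: contraT; rewrite negb_or -!fE // => /andP[ub u'a].
    by case: (noaug X b a u u'); rewrite // EX setUC.
  have [fa|nfa] := boolP (f a u && f a u'); first by exists a.
  have [fb|nfb] := boolP (f b u && f b u'); first by exists b.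
  exfalso; rewrite !(f_sym a) in nfa; rewrite !(f_sym b) in nfb.
  have fab : f a b = false by rewrite eN.
  have [fua|fua] := boolP (f u a).
    have fu'a : f u' a = false by apply/negbTE; rewrite fua in nfa.
    rewrite fu'a orbF in h2; have fu'b : f u' b = false by apply/negbTE; rewrite h2 in nfb.
    by have := lineF fuu' fua h2 nu'a nab nu'b; rewrite fu'a fab fu'b.
  rewrite (negPf fua) /= in h1.
  have fub : f u b = false by apply/negbTE; rewrite h1 andbT in nfb.
  rewrite fub /= in h2.
  by have := lineF fu'u h2 h1 nua nab nub; rewrite (negPf fua) fab fub.
pose S := [set z | [|| z == u, z == u' | f z u && f z u']].
have stS x y : x \in S -> y \in S -> ~~ e x y.
  rewrite !inE => xS yS; have [->|nxy] := eqVneq x y; first by rewrite e_irr.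
  apply: fN; case/or3P: xS => [/eqP Ex|/eqP Ex|/andP[xu xu']];
    case/or3P: yS => [/eqP Ey|/eqP Ey|/andP[yu yu']]; rewrite ?Ex ?Ey //.
  - by rewrite Ex Ey eqxx in nxy.
  - by rewrite f_sym.
  - by rewrite Ex Ey eqxx in nxy.
  - by rewrite f_sym.
  - have nu'x : u' != x by rewrite eq_sym f_neq.
    have nu'y : u' != y by rewrite eq_sym f_neq.
    have fux : f u x by rewrite f_sym.
    have fuy : f u y by rewrite f_sym.
    have := lineF fuu' fux fuy nu'x nxy nu'y.
    by rewrite (f_sym u' x) xu' (f_sym u' y) yu'; case: (f x y).
have cX : #|~: S| <= #|M|.
  pose g x := pblock M x.
  have inM x : x \notin S -> x \in cover M.
    move=> xS; apply: contraT => xM; case/negP: xS; rewrite inE.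
    have [//|nxu] := eqVneq x u; have [//|nxu'] := eqVneq x u' => /=.
    by rewrite /f /nonadj nxu nxu' !no_edge.
  have trM : trivIset M by case/andP: mM.
  rewrite -(card_in_imset (f := g) (D := mem (~: S))) /=.
    apply: subset_leq_card; apply/subsetP=> _ /imsetP[x + ->].
    by rewrite inE => /inM xM; apply: pblock_mem.
  move=> x y; rewrite !in_setC => xS yS Eg; apply/eqP; apply: contraT => nxy.
  have xX : x \in g x by rewrite mem_pblock inM.
  have yX : y \in g x by rewrite Eg mem_pblock inM.
  have gM : g x \in M by apply: pblock_mem; apply: inM.
  have [z zX zuu'] := touch _ gM.
  have zS : z \in S by rewrite inE zuu' !orbT.
  have nxz : x != z by apply: contraNneq xS => ->.
  have nyz : y != z by apply: contraNneq yS => ->.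
  have : 2 < #|g x| by apply/card_gt2P; exists x, y, z; split; split; rewrite // eq_sym.
  by rewrite (matching_card2 e_irr mM gM).
have cS : col e S 1 by apply: col_one.
have [|clX] := boolP [exists x in ~: S, exists y in ~: S, f x y].
  case/exists_inP=> x xS /exists_inP[y yS xy]; apply: nocol.
  have nxy := f_neq xy.
  have cxy : col e [set x; y] 1.
    apply: col_one => a b; rewrite !inE => /orP[]/eqP-> /orP[]/eqP->; rewrite ?e_irr ?fN //.
    by rewrite f_sym.
  have cR := col_card e_irr (~: S :\ x :\ y).
  have := col_union cS (col_union cxy cR) => c.
  have Ec : #|~: S| = #|~: S :\ x :\ y|.+2.
    by rewrite (cardsD1 x) xS (cardsD1 y (_ :\ x)) 2!inE eq_sym nxy yS.
  apply: (@col_mono _ _ _ (1 + (1 + #|~: S :\ x :\ y|))); first by lia.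
  apply: col_sub c; apply/subsetP=> z _; rewrite !in_setU !in_setD !in_set1 in_setC.
  by case: (z \in S); case: (z == x); case: (z == y).
have cl : clique e (~: S).
  move=> x y xS yS nxy; rewrite fE //; apply: contra clX => xy.
  by apply/exists_inP; exists x => //; apply/exists_inP; exists y.
have ltS := small cl.
apply: nocol; have := col_union cS (col_card e_irr (~: S)); rewrite setUCr.
by apply: col_mono; rewrite add1n.
Qed.

(** Two matching edges without an edge of G between them cannot both be branch
    sets. *)
Definition conflict (X Y : {set T}) := [forall x in X, forall y in Y, f x y].
Definition bad (M : {set {set T}}) := [set X in M | [exists Y in M, (Y != X) && conflict X Y]].

Lemma conflictP (X Y : {set T}) : reflect (forall x y, x \in X -> y \in Y -> f x y) (conflict X Y).
Proof.
apply: (iffP forall_inP) => [H x y /H/forall_inP|H x xX]; first by apply.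
by apply/forall_inP=> y; apply: H.
Qed.

Lemma conflict_sym (X Y : {set T}) : conflict X Y = conflict Y X.
Proof. by apply/conflictP/conflictP=> H x y xX yY; rewrite f_sym H. Qed.

(** Replace P and R by px and p'y.  Neither new pair conflicts with the other, as
    p and p' are adjacent, nor with Q, since P and Q form a four-cycle of
    f, nor with any other member by hypothesis.  So conflicts only disappear, among them
    that of P. *)
Lemma swap_pairs (M : {set {set T}}) (P Q R : {set T}) p p' q q' x y :
  matching e M -> P \in M -> Q \in M -> R \in M -> P != Q -> P != R -> Q != R ->
  P = [set p; p'] -> Q = [set q; q'] -> R = [set x; y] ->
  e p p' -> e q q' -> e x y -> conflict P Q -> e p x -> e p' y ->
  (forall Z, Z \in M -> Z != P -> Z != Q -> Z != R -> ~~ conflict [set p; x] Z) ->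
  (forall Z, Z \in M -> Z != P -> Z != Q -> Z != R -> ~~ conflict [set p'; y] Z) ->
  exists M' : {set {set T}}, [/\ matching e M', #|M'| = #|M| & #|bad M'| < #|bad M|].
Proof.
move=> mM PM QM RM nPQ nPR nQR EP EQ ER pp' qq' xy cPQ px p'y nk1 nk2.
have [pP p'P] : p \in P /\ p' \in P by rewrite EP !inE !eqxx orbT.
have [qQ q'Q] : q \in Q /\ q' \in Q by rewrite EQ !inE !eqxx orbT.
have [xR yR] : x \in R /\ y \in R by rewrite ER !inE !eqxx orbT.
have nPx : x \notin P by apply: (matching_out mM RM PM) => //; rewrite eq_sym.
have nPy : y \notin P by apply: (matching_out mM RM PM) => //; rewrite eq_sym.
pose N := M :\ P :\ R; pose A := [set p; x]; pose B := [set p'; y].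
have mP : matching e (M :\ P) by apply: matching_sub mM; apply: subsetDl.
have RMP : R \in M :\ P by rewrite !inE eq_sym nPR.
have sN : N \subset M :\ P by apply: subsetDl.
have mN := matching_sub sN mP.
have pN : p \notin cover N by apply: (cover_subD sN); apply: notin_coverD mM PM pP.
have p'N : p' \notin cover N by apply: (cover_subD sN); apply: notin_coverD mM PM p'P.
have xN : x \notin cover N by apply: notin_coverD mP RMP xR.
have yN : y \notin cover N by apply: notin_coverD mP RMP yR.
have [mA AN] := matching_add mN px pN xN.
have npp' := e_neq e_irr pp'; have nxy := e_neq e_irr xy.
have np'A : p' \notin A.
  by rewrite !inE negb_or eq_sym npp'; apply: contraNneq nPx => <-.
have nyA : y \notin A.
  by rewrite !inE negb_or (eq_sym y x) nxy andbT; apply: contraNneq nPy => ->.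
have [mB BN] := matching_add mA p'y (cover_add np'A p'N) (cover_add nyA yN).
exists (B |: (A |: N)); split=> //.
  by rewrite cardsU1 BN cardsU1 AN (cardsD1 P M) PM (cardsD1 R (M :\ P)) RMP.
have noPQ a b c : a \in P -> e a c -> c != b -> a != b -> b \in P -> e a b -> f c q -> f c q' -> False.
  move=> aP ac ncb nab bP ab cq cq'; have /conflictP cPQ' := cPQ.
  have [aq aq'] := (cPQ' _ _ aP qQ, cPQ' _ _ aP q'Q).
  have [bq bq'] := (cPQ' _ _ bP qQ, cPQ' _ _ bP q'Q).
  have nac := e_neq e_irr ac; have nbc : b != c by rewrite eq_sym.
  have nqc : q != c by rewrite eq_sym f_neq.
  have nq'c : q' != c by rewrite eq_sym f_neq.
  have fbc : f b c.
    have fqa : f q a by rewrite f_sym.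
    have fqb : f q b by rewrite f_sym.
    have fqc : f q c by rewrite f_sym.
    have := lineF fqa fqb fqc nab nbc nac.
    by rewrite (eN ab) (eN ac) addbF.
  have := lineF bq bq' fbc (e_neq e_irr qq') nq'c nqc.
  by rewrite (eN qq') (f_sym q') (f_sym q) cq cq'.
have noA Y : Y \in B |: (A |: N) -> Y != A -> ~~ conflict A Y.
  move=> + nYA; case/setU1P=> [->|/setU1P[EY|YN]].
  - apply/conflictP=> c; have := c p p'; rewrite !inE !eqxx => /(_ isT isT).
    by rewrite (eN pp').
  - by rewrite EY eqxx in nYA.
  move: (YN); rewrite !inE => /and3P[nYR nYP YM].
  have [EY|nYQ] := eqVneq Y Q; last exact: nk1.
  apply/conflictP=> c; apply: (noPQ p p' x) => //.
  - by apply: contraNneq nPx => ->.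
  - by apply: c; rewrite ?EY ?qQ // !inE eqxx orbT.
  - by apply: c; rewrite ?EY ?q'Q // !inE eqxx orbT.
have noB Y : Y \in B |: (A |: N) -> Y != B -> ~~ conflict B Y.
  move=> + nYB; case/setU1P=> [EY|/setU1P[->|YN]].
  - by rewrite EY eqxx in nYB.
  - apply/conflictP=> c; have := c p' p; rewrite !inE !eqxx => /(_ isT isT).
    by rewrite f_sym (eN pp').
  move: (YN); rewrite !inE => /and3P[nYR nYP YM].
  have [EY|nYQ] := eqVneq Y Q; last exact: nk2.
  apply/conflictP=> c; apply: (noPQ p' p y) => //.
  - by apply: contraNneq nPy => ->.
  - by rewrite eq_sym.
  - by rewrite e_sym.
  - by apply: c; rewrite ?EY ?qQ // !inE eqxx orbT.
  - by apply: c; rewrite ?EY ?q'Q // !inE eqxx orbT.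
apply: proper_card; apply/properP; split; last first.
  exists P; first by rewrite inE PM; apply/exists_inP; exists Q; rewrite // eq_sym nPQ.
  rewrite inE negb_and; apply/orP; left.
  rewrite !in_setU1 !negb_or; apply/and3P; split.
  - by apply: contraNneq nPy => ->; rewrite !inE eqxx orbT.
  - by apply: contraNneq nPx => ->; rewrite !inE eqxx orbT.
  - by rewrite !in_setD1 eqxx andbF.
apply/subsetP=> X; rewrite inE => /andP[XM' /exists_inP[Y YM' /andP[nYX cXY]]].
have XNA : X != A by apply: contraTneq cXY => EX; rewrite EX noA // -EX.
have XNB : X != B by apply: contraTneq cXY => EX; rewrite EX noB // -EX.
have nXY : X != Y by rewrite eq_sym.
have YNA : Y != A by apply: contraTneq cXY => EY; rewrite conflict_sym EY noA // -EY.
have YNB : Y != B by apply: contraTneq cXY => EY; rewrite conflict_sym EY noB // -EY.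
have inM Z : Z \in B |: (A |: N) -> Z != A -> Z != B -> Z \in M.
  move=> h nA nB; move: h; rewrite in_setU1 (negPf nB) in_setU1 (negPf nA) /=.
  by rewrite !in_setD1 => /and3P[].
by rewrite inE inM //; apply/exists_inP; exists Y; rewrite ?inM ?nYX.
Qed.

(** In f, two conflicting pairs span a four-cycle with the pairs as its diagonals. *)
Definition four_cycle p p' q q' :=
  [&& e p p' && e q q', f p q, f p q', f p' q & f p' q'].

Lemma four_cycle_flip p p' q q' : four_cycle p p' q q' -> four_cycle p' p q q'.
Proof. by case/and5P=> /andP[? ?] *; apply/and5P; split; rewrite // e_sym; apply/andP. Qed.

Lemma four_cycle_turn p p' q q' : four_cycle p p' q q' -> four_cycle q q' p p'.
Proof. by case/and5P=> /andP[? ?] *; apply/and5P; split; rewrite // 1?f_sym //; apply/andP. Qed.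

(** By parity at the corners, a vertex that sees one corner of a four-cycle of f
    sees two consecutive ones and no others. *)
Lemma four_cycle_opp p p' q q' x : four_cycle p p' q q' -> x \notin [:: p; p'; q; q'] ->
  f x p || f x p' -> (f x p (+) f x p') /\ (f x q (+) f x q').
Proof.
case/and5P=> /andP[pp' qq'] pq pq' p'q p'q'; rewrite !inE !negb_or => /and4P[nxp nxp' nxq nxq'] t.
have h2 : f x q (+) f x q'.
  have aux a : f x a -> f a q -> f a q' -> f x q (+) f x q'.
    rewrite f_sym => ax aq aq'.
    by have := lineF ax aq aq' nxq (e_neq e_irr qq') nxq'; rewrite (eN qq') addbF.
  by case/orP: t => xa; apply: aux xa _ _.
split=> //.
have aux a : f x a -> f a p -> f a p' -> f x p (+) f x p'.
  rewrite f_sym => ax ap ap'.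
  by have := lineF ax ap ap' nxp (e_neq e_irr pp') nxp'; rewrite (eN pp') addbF.
have : f x q || f x q' by move: h2; case: (f x q).
by case/orP=> xa; apply: aux xa _ _; rewrite f_sym.
Qed.

(** A pair g, h in conflict with px consists of two f-neighbours of p, which lie on
    the two sides of p; one of them is on the side that x sees, and parity there
    would make x and p adjacent in f. *)
Lemma four_cycle_kill p p' q q' x g h : four_cycle p p' q q' ->
  x \notin [:: p; p'; q; q'] -> g \notin [:: p; p'; q; q'] -> h \notin [:: p; p'; q; q'] ->
  e p x -> f x p || f x p' -> e g h -> f g p -> f h p -> f g x -> f h x -> False.
Proof.
move=> C xC gC hC px tx gh gp hp gx hx.
have [_ xq] := four_cycle_opp C xC tx.
have fxp : f x p = false by rewrite f_sym eN.
have key a b : f p a -> f x a -> f b p -> f b x -> b != a -> f b a -> p != a -> False.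
  move=> pa xa bp bx nba ba npa.
  have [fap fax fab] : [/\ f a p, f a x & f a b] by split; rewrite f_sym.
  have nxp : x != p by apply: contraTneq px => ->; rewrite e_irr.
  by have := lineF fab fax fap (f_neq bx) nxp (f_neq bp); rewrite bx fxp bp.
have [fpq fpq'] : f p q /\ f p q' by case/and5P: C.
have [pg ph] : f p g /\ f p h by rewrite !(f_sym p).
have side a : a \in [:: q; q'] -> f p a -> f g a || f h a.
  move=> aQ pa; have := lineF pg ph pa (e_neq e_irr gh).
  rewrite (eN gh); have n z : z \notin [:: p; p'; q; q'] -> z != a.
    by move: aQ; rewrite !inE !negb_or => /orP[]/eqP-> /and4P[].
  by move/(_ (n h hC) (n g gC)); case: (f g a) => //; rewrite addbF.
have : f x q || f x q' by move: xq; case: (f x q).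
have [qQ q'Q] : q \in [:: q; q'] /\ q' \in [:: q; q'] by rewrite !inE !eqxx orbT.
case/orP=> xa; [case/orP: (side q qQ fpq)|case/orP: (side q' q'Q fpq')] => ba.
- exact: (key q g fpq xa gp gx (f_neq ba) ba (f_neq fpq)).
- exact: (key q h fpq xa hp hx (f_neq ba) ba (f_neq fpq)).
- exact: (key q' g fpq' xa gp gx (f_neq ba) ba (f_neq fpq')).
- exact: (key q' h fpq' xa hp hx (f_neq ba) ba (f_neq fpq')).
Qed.

(** x and y, being non-adjacent in f, do not see the same side of the four-cycle;
    a check of the remaining cases gives a legal exchange with one of the two
    pairs. *)
Lemma four_cycle_swap p p' q q' x y : four_cycle p p' q q' ->
  x \notin [:: p; p'; q; q'] -> y \notin [:: p; p'; q; q'] -> e x y ->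
  [|| e p x && e p' y, e p y && e p' x, e q x && e q' y | e q y && e q' x].
Proof.
move=> C xC yC xy.
have [/andP[pp' qq'] pq pq' p'q p'q'] := and5P C.
have ex z a : z \notin [:: p; p'; q; q'] -> a \in [:: p; p'; q; q'] -> e a z = ~~ f z a.
  by move=> zC aC; rewrite e_sym fE //; apply: contraNneq zC => ->.
rewrite !ex // ?inE ?eqxx ?orbT //.
have h z : z \notin [:: p; p'; q; q'] ->
    [|| f z p, f z p', f z q | f z q'] -> (f z p (+) f z p') && (f z q (+) f z q').
  move=> zC; rewrite orbA => /orP[/(four_cycle_opp C zC)[-> ->]//|].
  have zC' : z \notin [:: q; q'; p; p'].
    by apply: contra zC; rewrite !inE => /or4P[] ->; rewrite ?orbT.
  by case/(four_cycle_opp (four_cycle_turn C) zC') => -> ->.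
have corner a b : f a b -> ~~ [&& f x a, f x b, f y a & f y b].
  move=> ab; apply/negP=> /and4P[xa xb ya yb].
  have [ax ay] : f a x /\ f a y by rewrite !(f_sym a).
  have := lineF ax ay ab (e_neq e_irr xy) (f_neq yb) (f_neq xb).
  by rewrite (eN xy) yb xb.
move: (h x xC) (h y yC) (corner _ _ pq) (corner _ _ pq') (corner _ _ p'q) (corner _ _ p'q').
by case: (f x p); case: (f x p'); case: (f x q); case: (f x q');
   case: (f y p); case: (f y p'); case: (f y q); case: (f y q').
Qed.

Lemma swap_pairs_of (M : {set {set T}}) (P Q R : {set T}) p p' q q' x y :
  matching e M -> P \in M -> Q \in M -> R \in M -> P != Q -> P != R -> Q != R ->
  P = [set p; p'] -> Q = [set q; q'] -> R = [set x; y] -> four_cycle p p' q q' ->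
  e x y -> e p x -> e p' y ->
  (forall Z, Z \in M -> Z != P -> Z != Q -> Z != R ->
    (forall z, z \in Z -> f z p || f z p') ->
    (f x p || f x p') && (f y p || f y p')) ->
  exists M' : {set {set T}}, [/\ matching e M', #|M'| = #|M| & #|bad M'| < #|bad M|].
Proof.
move=> mM PM QM RM nPQ nPR nQR EP EQ ER C xy px p'y allt.
have [/andP[pp' qq'] pq pq' p'q p'q'] := and5P C.
have [xR yR] : x \in R /\ y \in R by rewrite ER !inE !eqxx orbT.
have cPQ : conflict P Q.
  apply/conflictP=> a b; rewrite EP EQ !inE.
  by case/orP=> /eqP-> /orP[]/eqP->.
have out Z z : Z \in M -> Z != P -> Z != Q -> z \in Z -> z \notin [:: p; p'; q; q'].
  move=> ZM nZP nZQ zZ; apply/negP=> zC.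
  have [zP|zQ] : z \in P \/ z \in Q.
    by rewrite EP EQ; move: zC; rewrite !inE => /or4P[]->; rewrite ?orbT; auto.
  - by move: (matching_out mM ZM PM nZP zZ); rewrite zP.
  - by move: (matching_out mM ZM QM nZQ zZ); rewrite zQ.
have xC : x \notin [:: p; p'; q; q'] by apply: (out R); rewrite // eq_sym.
have yC : y \notin [:: p; p'; q; q'] by apply: (out R); rewrite // eq_sym.
have perm z : z \notin [:: p; p'; q; q'] -> z \notin [:: p'; p; q; q'].
  by apply: contra; rewrite !inE => /or4P[] ->; rewrite ?orbT.
apply: (swap_pairs mM PM QM RM nPQ nPR nQR EP EQ ER) => // Z ZM nZP nZQ nZR;
  apply/conflictP=> K; have [g [h [EZ gh]]] := matching_edge mM ZM;
  have [gZ hZ] : g \in Z /\ h \in Z by rewrite EZ !inE !eqxx orbT.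
- have Kp z : z \in Z -> f z p by move=> zZ; rewrite f_sym K // !inE eqxx.
  have Kx z : z \in Z -> f z x by move=> zZ; rewrite f_sym K // !inE eqxx orbT.
  have /andP[tx _] : (f x p || f x p') && (f y p || f y p').
    by apply: (allt Z) => // z /Kp ->.
  exact: (four_cycle_kill C xC (out Z g _ _ _ _) (out Z h _ _ _ _) px tx gh (Kp g gZ) (Kp h hZ) (Kx g gZ) (Kx h hZ)).
- have Kp z : z \in Z -> f z p' by move=> zZ; rewrite f_sym K // !inE eqxx.
  have Ky z : z \in Z -> f z y by move=> zZ; rewrite f_sym K // !inE eqxx orbT.
  have /andP[_ ty] : (f x p || f x p') && (f y p || f y p').
    by apply: (allt Z) => // z /Kp ->; rewrite orbT.
  rewrite orbC in ty.
  exact: (four_cycle_kill (four_cycle_flip C) (perm _ yC) (perm _ (out Z g _ _ _ _)) (perm _ (out Z h _ _ _ _)) p'y ty gh (Kp g gZ) (Kp h hZ) (Ky g gZ) (Ky h hZ)).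
Qed.

(** As third edge R take one with both ends f-adjacent to the four-cycle, if there
    is one.  Then a pair Z in conflict with a new pair is again of this kind,
    hence so is R, and [four_cycle_kill] applies. *)
Lemma fewer_conflicts (M : {set {set T}}) : matching e M -> 2 < #|M| -> bad M != set0 ->
  exists M' : {set {set T}}, [/\ matching e M', #|M'| = #|M| & #|bad M'| < #|bad M|].
Proof.
move=> mM M3 /set0Pn[P]; rewrite inE => /andP[PM /exists_inP[Q QM /andP[nQP cPQ]]].
have nPQ : P != Q by rewrite eq_sym.
have [p [p' [EP pp']]] := matching_edge mM PM.
have [q [q' [EQ qq']]] := matching_edge mM QM.
have C : four_cycle p p' q q'.
  by have /conflictP c := cPQ; apply/and5P; split; rewrite ?pp' //; apply: c; rewrite ?EP ?EQ !inE eqxx ?orbT.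
pose t z := f z p || f z p'.
have out Z z : Z \in M -> Z != P -> Z != Q -> z \in Z -> z \notin [:: p; p'; q; q'].
  move=> ZM nZP nZQ zZ; apply/negP=> zC.
  have [zP|zQ] : z \in P \/ z \in Q.
    by rewrite EP EQ; move: zC; rewrite !inE => /or4P[]->; rewrite ?orbT; auto.
  - by move: (matching_out mM ZM PM nZP zZ); rewrite zP.
  - by move: (matching_out mM ZM QM nZQ zZ); rewrite zQ.
have tq z : z \notin [:: p; p'; q; q'] -> t z = f z q || f z q'.
  move=> zC; apply/idP/idP.
    by case/(four_cycle_opp C zC) => _; case: (f z q).
  have zC' : z \notin [:: q; q'; p; p'].
    by apply: contra zC; rewrite !inE => /or4P[] ->; rewrite ?orbT.
  by case/(four_cycle_opp (four_cycle_turn C) zC') => _; rewrite /t; case: (f z p).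
have [R [RM nRP nRQ allR]] : exists R, [/\ R \in M, R != P, R != Q &
    forall Z, Z \in M -> Z != P -> Z != Q -> (forall z, z \in Z -> t z) ->
    forall z, z \in R -> t z].
  have [/existsP[R /and4P[RM nRP nRQ /forall_inP tR]]|no] := boolP [exists R : {set T},
      [&& R \in M, R != P, R != Q & [forall z in R, t z]]].
    by exists R.
  have [R] : exists R, R \in M :\ P :\ Q.
    apply/set0Pn; rewrite -card_gt0; move: M3.
    by rewrite (cardsD1 P) PM (cardsD1 Q (_ :\ P)) !inE nQP QM.
  rewrite !inE => /and3P[nRQ nRP RM]; exists R; split=> // Z ZM nZP nZQ tZ.
  case/negP: no; apply/existsP; exists Z; rewrite ZM nZP nZQ /=.
  exact/forall_inP.
have [x [y [ER xy]]] := matching_edge mM RM.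
have [xR yR] : x \in R /\ y \in R by rewrite ER !inE !eqxx orbT.
have [nPR nQR] : P != R /\ Q != R by rewrite eq_sym nRP eq_sym.
have xC := out R x RM nRP nRQ xR; have yC := out R y RM nRP nRQ yR.
have yx : e y x by rewrite e_sym.
have ER' : R = [set y; x] by rewrite ER setUC.
case/or4P: (four_cycle_swap C xC yC xy) => /andP[h1 h2].
- apply: (swap_pairs_of mM PM QM RM nPQ nPR nQR EP EQ ER C xy h1 h2).
  by move=> Z ZM nZP nZQ nZR tZ; have a := allR Z ZM nZP nZQ tZ; rewrite -!/(t _) !a.
- apply: (swap_pairs_of mM PM QM RM nPQ nPR nQR EP EQ ER' C yx h1 h2).
  by move=> Z ZM nZP nZQ nZR tZ; have a := allR Z ZM nZP nZQ tZ; rewrite -!/(t _) !a.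
- apply: (swap_pairs_of mM QM PM RM nQP nQR nPR EQ EP ER (four_cycle_turn C) xy h1 h2).
  move=> Z ZM nZQ nZP nZR tZ; rewrite -!tq //.
  have tZ' z : z \in Z -> t z by move=> zZ; rewrite tq; [apply: tZ|apply: (out Z)].
  by have a := allR Z ZM nZP nZQ tZ'; rewrite !a.
- apply: (swap_pairs_of mM QM PM RM nQP nQR nPR EQ EP ER' (four_cycle_turn C) yx h1 h2).
  move=> Z ZM nZQ nZP nZR tZ; rewrite -!tq //.
  have tZ' z : z \in Z -> t z by move=> zZ; rewrite tq; [apply: tZ|apply: (out Z)].
  by have a := allR Z ZM nZP nZQ tZ'; rewrite !a.
Qed.

Lemma no_conflicts : 2 < k.+1 -> exists M : {set {set T}}, [/\ matching e M, k < #|M| & bad M = set0].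
Proof.
move=> k3; have [M mM cM] := large_matching.
have [n] := ubnP #|bad M|; elim: n M mM cM => // n IH M mM cM.
rewrite ltnS => ltn; have [b0|ne] := eqVneq (bad M) set0; first by exists M.
have [M' [mM' cM' lt]] := fewer_conflicts mM (leq_trans k3 cM) ne.
by apply: (IH M') => //; [rewrite cM'|apply: leq_trans lt ltn].
Qed.


Lemma conflict_free_model : 1 < k -> model e setT k.+1.
Proof.
move=> k1; have [//|M [mM cM bM]] := no_conflicts.
have card2 := matching_card2 e_irr mM.
apply: (model_family cM) => [X XM|X Y XM YM nXY|X Y XM YM nXY|X Y XM].
- have [x [y [EX xy]]] := matching_edge mM XM.
  by split; [exact: subsetT|rewrite -card_gt0 card2|rewrite EX; exact: linked2].
- exact: (matching_disjoint mM).
- have [/existsP[u /existsP[v /and3P[uX vY uv]]]|no] :=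
    boolP [exists u, exists v, [&& u \in X, v \in Y & e u v]]; first by exists u, v.
  have : X \in bad M; last by rewrite bM inE.
  rewrite inE XM; apply/exists_inP; exists Y => //; rewrite eq_sym nXY.
  apply/conflictP=> x y xX yY; rewrite /f /nonadj.
  have -> /= : x != y by apply: contraTneq yY => <-; apply: (matching_out mM XM YM nXY).
  by apply: contra no => xy; apply/existsP; exists x; apply/existsP; exists y; apply/and3P.
- by rewrite card2.
Qed.

End CoLine.

(** Without a clique of size k there are enough vertices for a matching with k+1
    edges. *)
Lemma co_line_like (T : finType) (e : rel T) k : symmetric e -> irreflexive e ->
  line_like (nonadj e) -> linked (nonadj e) setT -> critical e k ->
  (exists2 Q : {set T}, clique e Q & k <= #|Q|) \/ model e setT k.+1.
Proof.
move=> e_sym e_irr lineF linkF crit.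
have [/existsP[Q /andP[/forall_inP clQ kQ]]|no] := boolP [exists Q : {set T},
    [forall x in Q, forall y in Q, (x != y) ==> e x y] && (k <= #|Q|)].
  left; exists Q => // x y xQ yQ nxy.
  by move/forall_inP: (clQ x xQ) => /(_ y yQ)/implyP->.
have small (Q : {set T}) : clique e Q -> #|Q| < k.
  move=> clQ; rewrite ltnNge; apply: contra no => kQ; apply/existsP; exists Q.
  rewrite kQ andbT; apply/forall_inP=> x xQ; apply/forall_inP=> y yQ.
  by apply/implyP; apply: clQ.
right; have cT := co_line_card e_sym e_irr lineF linkF crit small.
apply: (conflict_free_model e_sym e_irr lineF crit.1 small cT).
have /card_gt0P[x _] : 0 < #|T| by [lia].
have := small [set x]; rewrite cards1; apply=> y z /set1P-> /set1P->.
by rewrite eqxx.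
Qed.

(** * Critical graphs with a clique of size k *)

Section LargeClique.
Variables (T : finType) (e : rel T) (k : nat).
Hypotheses (e_sym : symmetric e) (e_irr : irreflexive e) (crit : critical e k).
Variable K : {set T}.
Hypotheses (clK : clique e K) (cK : #|K| = k).

Lemma clique_colours (c : T -> nat) i : (forall x, x \in K -> c x < k) ->
  (forall x y, x \in K -> y \in K -> e x y -> c x != c y) -> i < k ->
  exists2 v, v \in K & c v = i.
Proof.
move=> ck cP ik.
have un : uniq (map c (enum K)).
  rewrite map_inj_in_uniq ?enum_uniq // => x y; rewrite !mem_enum => xK yK Ec.
  apply/eqP; apply: contraT => nxy.
  by have := cP x y xK yK (clK xK yK nxy); rewrite Ec eqxx.
have sb : {subset map c (enum K) <= iota 0 k}.
  by move=> _ /mapP[x + ->]; rewrite mem_enum mem_iota => /ck.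
have [|_ E] := uniq_min_size un sb; first by rewrite size_iota size_map -cardE cK.
have : i \in map c (enum K) by rewrite E mem_iota.
by case/mapP=> v; rewrite mem_enum => vK ->; exists v.
Qed.

Lemma outside_nonempty : ~: K != set0.
Proof.
apply/eqP=> E; apply: crit.1; rewrite -cK.
have -> : [set: T] = K by rewrite -(setCK K) E setC0.
exact: col_card.
Qed.

(** If the outside of K falls into two parts without edges between them, K with
    either part has a k-colouring.  Both use each colour exactly once on K, so the
    colours of the second can be renamed to agree with the first on K. *)
Lemma outside_linked : linked e (~: K).
Proof.
move=> B x y xK yK xB yB.
have [/existsP[u /existsP[v /and5P[*]]]|no] := boolP [exists u, exists v,
   [&& u \in ~: K, v \in ~: K, u \in B, v \notin B & e u v]]; first by exists u, v.
exfalso; apply: crit.1; rewrite !in_setC in xK yK.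
have noe u v : u \notin K -> v \notin K -> u \in B -> v \notin B -> ~~ e u v.
  move=> uK vK uB vB; apply: contra no => uv; apply/existsP; exists u.
  by apply/existsP; exists v; rewrite !in_setC uK vK uB vB.
have [|c1 [ck1 cP1]] := crit.2 (K :|: B).
  by apply/eqP=> /setP/(_ y); rewrite !inE (negPf yK) (negPf yB).
have [|c2 [ck2 cP2]] := crit.2 (K :|: ~: B).
  by apply/eqP=> /setP/(_ x); rewrite !inE (negPf xK) xB.
have k1 z : z \in K -> c1 z < k by move=> zK; apply: ck1; rewrite inE zK.
have p1 u v : u \in K -> v \in K -> e u v -> c1 u != c1 v.
  by move=> uK vK; apply: cP1; rewrite inE ?uK ?vK.
have k2 z : z \in K -> c2 z < k by move=> zK; apply: ck2; rewrite inE zK.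
have p2 u v : u \in K -> v \in K -> e u v -> c2 u != c2 v.
  by move=> uK vK; apply: cP2; rewrite inE ?uK ?vK.
pose s i := odflt x [pick v in K | c2 v == i].
have sP i : i < k -> s i \in K /\ c2 (s i) = i.
  move=> ik; rewrite /s; case: pickP => [v /andP[vK /eqP]//|none].
  have [v vK cv] := clique_colours k2 p2 ik.
  by have := none v; rewrite /= vK cv eqxx.
have sK v : v \in K -> s (c2 v) = v.
  move=> vK; have [sK Es] := sP _ (k2 v vK); apply/eqP; apply: contraT => nsv.
  by have := p2 _ _ sK vK (clK sK vK nsv); rewrite Es eqxx.
have B2 z : z \notin B -> z \in K :|: ~: B by rewrite !inE => ->; rewrite orbT.
have B1 z : z \in B -> z \in K :|: B by rewrite !inE => ->; rewrite orbT.
exists (fun z => if z \in B then c1 z else c1 (s (c2 z))); split=> [z _|].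
  case: ifP => [/B1/ck1//|/negbT/B2 zB]; apply: k1.
  by case: (sP _ (ck2 z zB)).
have mixed u v : u \in B -> v \notin B -> e u v -> c1 u != c1 (s (c2 v)).
  move=> uB vB uv; have [vK|vK] := boolP (v \in K).
    by rewrite sK //; apply: cP1 => //; [exact: B1|rewrite inE vK].
  have [uK|uK] := boolP (u \in K); last by rewrite (negPf (noe u v uK vK uB vB)) in uv.
  have [sv Es] := sP _ (ck2 v (B2 v vB)).
  apply: p1 => //; apply: clK => //; apply/eqP=> E.
  have : c2 u != c2 v by apply: cP2 => //; [rewrite inE uK|exact: B2].
  by rewrite E Es eqxx.
move=> u v _ _ uv; case: ifP => [uB|/negbT uB]; case: ifP => [vB|/negbT vB].
- by apply: cP1; rewrite ?B1.
- exact: mixed.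
- by rewrite eq_sym; apply: mixed => //; rewrite e_sym.
have [[su Eu] [sv Ev]] := (sP _ (ck2 u (B2 u uB)), sP _ (ck2 v (B2 v vB))).
apply: p1 => //; apply: clK => //; apply/eqP=> E.
have : c2 u != c2 v by apply: cP2; rewrite ?B2.
by rewrite -Eu -Ev E eqxx.
Qed.

(** A vertex of K without outside neighbours has fewer than k neighbours. *)
Lemma outside_neighbour v : v \in K -> exists2 z, z \notin K & e v z.
Proof.
move=> vK; have [/existsP[z /andP[zK vz]]|no] := boolP [exists z, (z \notin K) && e v z].
  by exists z.
exfalso; apply: crit.1.
have [|c [ck cP]] := crit.2 (~: [set v]).
  by apply/eqP=> /setP/(_ v); rewrite !inE eqxx.
have [|b bk bP] := unused_colour c (A := K :\ v) (k := k).
  by rewrite -cK (cardsD1 v K) vK.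
have nb z : e v z -> c z != b.
  move=> vz; apply: bP; rewrite !inE; apply/andP; split.
    by apply: contraTneq vz => ->; rewrite e_irr.
  by apply: contraT => zK; case/negP: no; apply/existsP; exists z; rewrite zK.
exists (fun z => if z == v then b else c z); split=> [z _|x y _ _ xy].
  by case: eqP => // /eqP zv; apply: ck; rewrite !inE.
have [Ex|nx] := eqVneq x v; have [Ey|ny] := eqVneq y v.
- by rewrite Ex Ey e_irr in xy.
- by rewrite eq_sym nb // -Ex.
- by rewrite nb // -Ey e_sym.
- by apply: cP; rewrite ?inE.
Qed.

Lemma clique_outside_model : model e setT k.+1.
Proof.
pose F := ~: K |: [set [set x] | x in K].
have cF : k < #|F|.
  rewrite cardsU1 card_imset; last exact: set1_inj.
  rewrite cK (_ : _ \notin _) //; apply/imsetP=> [[x xK E]].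
  by have := set11 x; rewrite -E inE xK.
have FP X : X \in F -> X = ~: K \/ exists2 x, x \in K & X = [set x].
  by case/setU1P=> [->|/imsetP[x xK ->]]; [left|right; exists x].
apply: (model_family cF) => [X /FP[->|[x xK ->]]|X Y|X Y|X Y].
- by split; [exact: subsetT|exact: outside_nonempty|exact: outside_linked].
- by split; [exact: subsetT|apply/set0Pn; exists x; rewrite inE|exact: linked1].
- move=> /FP[->|[x xK ->]] /FP[->|[y yK ->]] nXY; first by rewrite eqxx in nXY.
  + by rewrite disjoint_sym disjoints1 inE yK.
  + by rewrite disjoints1 inE xK.
  + by rewrite disjoints1 inE; apply: contraNneq nXY => ->.
- move=> /FP[->|[x xK ->]] /FP[->|[y yK ->]] nXY; first by rewrite eqxx in nXY.
  + have [z zK yz] := outside_neighbour yK.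
    by exists z, y; rewrite !inE e_sym zK eqxx.
  + have [z zK xz] := outside_neighbour xK.
    by exists x, z; rewrite !inE zK eqxx.
  + exists x, y; rewrite !inE !eqxx; split=> //; apply: clK => //.
    by apply: contraNneq nXY => ->.
- by move=> /FP[->|[x xK ->]] /FP[->|[y yK ->]]; rewrite ?cards1.
Qed.

End LargeClique.

Lemma clique_model (T : finType) (e : rel T) k (Q : {set T}) : symmetric e -> irreflexive e ->
  critical e k -> clique e Q -> k <= #|Q| -> model e setT k.+1.
Proof.
move=> e_sym e_irr crit clQ kQ.
have [K sKQ cK] : exists2 K : {set T}, K \subset Q & #|K| = k.
  exists [set x in take k (enum Q)].
    by apply/subsetP=> x; rewrite inE => /mem_take; rewrite mem_enum.
  rewrite cardsE (card_uniqP _) ?take_uniq ?enum_uniq // size_take -cardE.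
  by case: ltngtP kQ.
apply: (clique_outside_model e_sym e_irr crit (K := K)) => // x y xK yK.
by apply: clQ; apply: (subsetP sKQ).
Qed.

(** * Critical co-connected graphs are prime *)

Section Palette.
Variable T : finType.
Implicit Types (c : T -> nat) (A B : {set T}).

Definition palette c A := undup [seq c x | x in A].

Lemma paletteP c A i : reflect (exists2 x, x \in A & c x = i) (i \in palette c A).
Proof.
rewrite mem_undup; apply: (iffP mapP) => [[x xA ->]|[x xA <-]].
  by exists x => //; rewrite -mem_enum.
by exists x; rewrite ?mem_enum.
Qed.

Lemma mem_palette c A x : x \in A -> c x \in palette c A.
Proof. by move=> xA; apply/paletteP; exists x. Qed.

Lemma palette_setU c A B : size (palette c (A :|: B)) <= size (palette c A) + size (palette c B).
Proof.
rewrite -size_cat; apply: uniq_leq_size; first exact: undup_uniq.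
move=> i /paletteP[x /setUP xAB <-]; rewrite mem_cat; apply/orP.
by case: xAB => ?; [left|right]; apply: mem_palette.
Qed.

Lemma palette_setU_disjoint c A B : (forall x y, x \in A -> y \in B -> c x != c y) ->
  size (palette c A) + size (palette c B) <= size (palette c (A :|: B)).
Proof.
move=> dif; rewrite -size_cat; apply: uniq_leq_size.
  rewrite cat_uniq !undup_uniq andbT; apply/hasPn=> _ /paletteP[y yB <-].
  by apply/paletteP=> [[x xA E]]; have := dif x y xA yB; rewrite E eqxx.
move=> i; rewrite mem_cat => /orP[]/paletteP[x xA <-]; apply: mem_palette.
  by rewrite inE xA.
by rewrite inE xA orbT.
Qed.

Lemma palette_bound c A k : (forall x, x \in A -> c x < k) -> size (palette c A) <= k.
Proof.
move=> ck; rewrite -[k](size_iota 0); apply: uniq_leq_size; first exact: undup_uniq.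
by move=> _ /paletteP[x xA <-]; rewrite mem_iota ck.
Qed.

Lemma palette_eq c c' A : {in A, c =1 c'} -> palette c A = palette c' A.
Proof.
by move=> E; rewrite /palette; congr undup; apply/eq_in_map => x; rewrite mem_enum => /E.
Qed.

Lemma palette_comp c (g : nat -> nat) A :
  size (palette (fun x => g (c x)) A) <= size (palette c A).
Proof.
rewrite -[X in _ <= X](size_map g); apply: uniq_leq_size; first exact: undup_uniq.
by move=> _ /paletteP[x xA <-]; apply: map_f; apply: mem_palette.
Qed.

End Palette.

(** X is a module containing the edge pq, and N is the set of its neighbours; a
    vertex outside both sees nothing of X. *)
Section Module.
Variables (T : finType) (e : rel T) (k : nat).
Hypotheses (e_sym : symmetric e) (e_irr : irreflexive e).
Let f := nonadj e.
Let f_sym : symmetric f := nonadj_sym e_sym.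
Hypotheses (kiteF : kite_free e).
Variable X : {set T}.
Hypothesis modX : forall v x y, v \notin X -> x \in X -> y \in X -> e v x -> e v y.
Variables p q : T.
Hypotheses (pX : p \in X) (qX : q \in X) (pq : e p q).
Let N := [set v | (v \notin X) && e v p].

(** Otherwise p, q, r, s and t induce a kite. *)
Lemma module_neighbour_antiedge r s t : r \in N -> s \in N -> f r s -> t \notin X -> t \notin N ->
  e t r -> e t s.
Proof.
rewrite !inE => /andP[rX rp] /andP[sX sp] /andP[_ rs] tX; rewrite tX /= => tp tr.
apply: contraT => ts; exfalso.
have rq := modX rX pX qX rp; have sq := modX sX pX qX sp.
have tq : ~~ e q t by rewrite e_sym; apply: contra tp => tq; apply: modX tq.
apply: (@kiteF p q r s t) => //; rewrite 1?e_sym //.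
Qed.

(** By [module_neighbour_antiedge] a vertex outside an anticomponent W of N that
    sees one vertex of W sees all of W.  Hence W may be recoloured with any of
    its own colours: if psi needs fewer of them, imitate psi.  Distinct
    anticomponents are joined, so their palettes are disjoint, and the savings
    add up. *)
Lemma recolour (psi : T -> nat) (N' : {set T}) :
  (forall x y, x \in N -> y \in N -> e x y -> psi x != psi y) ->
  N' \subset N -> (forall x y, x \in N' -> y \in N -> f x y -> y \in N') ->
  col e (~: X) k ->
  exists c : T -> nat, [/\ forall x, x \notin X -> c x < k,
    forall x y, x \notin X -> y \notin X -> e x y -> c x != c y &
    size (palette c N') <= size (palette psi N')].
Proof.
move=> psiP; have [n] := ubnP #|N'|; elim: n N' => // n IH N' /ltnSE leN sN' clN' colX.
have [->|[w wN']] := set_0Vmem N'.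
  case: colX => c [ck cP]; exists c; split=> [x xX|x y xX yX|].
  - by apply: ck; rewrite inE.
  - by apply: cP; rewrite inE.
  - by rewrite /palette /image_mem enum_set0.
have [W [sW wW linkW clW]] := component f_sym wN'.
have clWN x y : x \in W -> y \in N -> f x y -> y \in W.
  by move=> xW yN xy; apply: (clW x) => //; apply: (clN' x) => //; apply: (subsetP sW).
have sNX x : x \in N -> x \notin X by rewrite inE => /andP[].
have WN x : x \in W -> x \in N by move=> /(subsetP sW)/(subsetP sN').
have EN' : N' = (N' :\: W) :|: W.
  apply/setP=> x; rewrite !inE; have := subsetP sW x; case: (x \in W) => /=; last by rewrite orbF.
  by move=> ->.
have [||||c [ck cP le]] := IH (N' :\: W).
- apply: leq_trans leN; apply: proper_card; apply/properP; split; first exact: subsetDl.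
  by exists w; rewrite // inE wW.
- exact: subset_trans (subsetDl _ _) sN'.
- move=> x y /setDP[xN' xW] yN xy; apply/setDP; split; first exact: (clN' x).
  by apply: contra xW => yW; apply: (clWN y) => //; [apply: (subsetP sN')|rewrite f_sym].
- exact: colX.
have all_or_none z u v : z \notin X -> z \notin W -> u \in W -> v \in W -> e z u -> e z v.
  move=> zX zW uW vW zu.
  have : W \subset [set v | e z v].
    apply: (linked_sub linkW uW); rewrite ?inE // => a b aW bW; rewrite !inE => za ab.
    have [zN|zN] := boolP (z \in N); last first.
      exact: module_neighbour_antiedge (WN a aW) (WN b bW) ab zX zN za.
    apply: contraT => zb; case/negP: zW; apply: (clWN b) => //.
    rewrite f_sym /f /nonadj zb andbT; apply: contraTneq za => ->.
    by rewrite e_sym; case/andP: ab.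
  by move/subsetP/(_ v vW); rewrite inE.
have psiW : size (palette psi (N' :\: W)) + size (palette psi W) <= size (palette psi N').
  rewrite {2}EN'; apply: palette_setU_disjoint => x y; rewrite inE => /andP[xW xN'] yW.
  have xN := subsetP sN' x xN'; apply: psiP (xN) (WN y yW) _.
  apply: contraT => xy; case/negP: (xW); apply: (clWN y) => //.
  by rewrite f_sym /f /nonadj xy andbT; apply: contraNneq xW => ->.
have [leW|ltW] := leqP (size (palette c W)) (size (palette psi W)).
  exists c; split=> //; rewrite EN'; apply: leq_trans (palette_setU _ _ _) _.
  by rewrite -EN'; lia.
pose d x := nth 0 (palette c W) (index (psi x) (palette psi W)).
have ix x : x \in W -> index (psi x) (palette psi W) < size (palette c W).
  by move=> xW; apply: leq_ltn_trans ltW; exact: index_size.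
have dW x : x \in W -> exists2 y, y \in W & c y = d x.
  by move=> xW; apply/paletteP; apply: mem_nth; apply: ix.
exists (fun x => if x \in W then d x else c x).
have cross x y : x \in W -> y \notin W -> y \notin X -> e x y -> d x != c y.
  move=> xW yW yX xy; have [z zW <-] := dW x xW.
  apply: cP => //; first by apply/sNX/WN.
  by rewrite e_sym; apply: (all_or_none y x z) => //; rewrite e_sym.
split=> [x xX|x y xX yX xy|].
- case: ifP => [/dW[y yW <-]|_]; last exact: ck.
  by apply/ck/sNX/WN.
- case: ifP => [xW|/negbT xW]; case: ifP => [yW|/negbT yW].
  + rewrite nth_uniq ?undup_uniq ?ix //; apply/eqP=> E.
    have := psiP x y (WN x xW) (WN y yW) xy.
    by rewrite -(nth_index 0 (mem_palette psi xW)) E nth_index ?eqxx ?mem_palette.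
  + exact: cross.
  + by rewrite eq_sym; apply: cross => //; rewrite e_sym.
  + exact: cP.
rewrite {1}EN'; apply: leq_trans (palette_setU _ _ _) _; apply: leq_trans psiW.
apply: leq_add.
  rewrite (@palette_eq _ _ c) // => x; rewrite inE => /andP[/negPf-> _] //.
rewrite (@palette_eq _ _ d); last by move=> x ->.
exact: (palette_comp psi (fun i => nth 0 (palette c W) (index i (palette psi W)))).
Qed.

(** A k-colouring of X and N uses a colours on X and b others on N.  A k-colouring
    of the outside of X can be brought to use at most b colours on N by
    [recolour], which leaves a colours for X. *)
Lemma module_col t : t \notin X -> t \notin N -> critical e k -> False.
Proof.
move=> tX tN [nocol crit]; apply: nocol.
have joinXN x y : x \in X -> y \in N -> e x y.
  by move=> xX; rewrite inE => /andP[yX yp]; rewrite e_sym; apply: modX yp.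
have colXN : col e (X :|: N) k.
  by apply: crit; apply/eqP=> /setP/(_ t); rewrite in_setU in_setT (negPf tX) (negPf tN).
have colCX : col e (~: X) k.
  by apply: crit; apply/eqP=> /setP/(_ p); rewrite !inE pX.
have [a [b [abk [theta [ta tP]] [psi [pb pP]]]]] := col_join joinXN colXN.
have clN x y : x \in N -> y \in N -> f x y -> y \in N by [].
have [c [ck cP le]] := recolour pP (subxx N) clN colCX.
have leb := leq_trans le (palette_bound pb).
pose U := [seq i <- iota 0 k | i \notin palette c N].
have Usize : a <= size U.
  have : size [seq i <- iota 0 k | i \in palette c N] <= b.
    apply: leq_trans leb; apply: uniq_leq_size; first by rewrite filter_uniq ?iota_uniq.
    by move=> i; rewrite mem_filter => /andP[].
  have := count_predC [in palette c N] (iota 0 k); rewrite size_iota !size_filter.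
  by rewrite (eq_count (a1 := predC _) (a2 := fun i => i \notin palette c N)) //; lia.
have UP x : x \in X -> nth 0 U (theta x) \in U.
  by move=> /ta xa; apply: mem_nth; apply: leq_trans xa Usize.
exists (fun x => if x \in X then nth 0 U (theta x) else c x).
have cross x y : x \in X -> y \notin X -> e x y -> nth 0 U (theta x) != c y.
  move=> xX yX xy; have := UP x xX; rewrite mem_filter => /andP[+ _].
  apply: contraNneq => ->; apply: mem_palette; rewrite inE yX.
  by apply: modX (xX) pX _ => //; rewrite e_sym.
split=> [x _|x y _ _ xy].
  case: ifP => [xX|/negbT]; last exact: ck.
  by have := UP x xX; rewrite mem_filter mem_iota => /andP[].
case: ifP => [xX|/negbT xX]; case: ifP => [yX|/negbT yX].
- by rewrite nth_uniq ?filter_uniq ?iota_uniq ?(leq_trans (ta _ _) Usize) ?tP.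
- exact: cross.
- by rewrite eq_sym cross // e_sym.
- exact: cP.
Qed.

End Module.

(** A module containing an edge is excluded by [module_col]; in a stable one each
    vertex dominates each other. *)
Lemma critical_prime (T : finType) (e : rel T) k : symmetric e -> irreflexive e ->
  kite_free e -> critical e k -> linked (nonadj e) setT -> prime e.
Proof.
move=> e_sym e_irr kiteF crit linkF X z X1 zX.
have [/existsP[v /existsP[x /existsP[y /and5P[*]]]]|no] := boolP [exists v, exists x, exists y,
    [&& v \notin X, x \in X, y \in X, e v x & ~~ e v y]].
  by exists v, x, y.
exfalso.
have modX v x y : v \notin X -> x \in X -> y \in X -> e v x -> e v y.
  move=> vX xX yX vx; apply: contraT => vy; case/negP: no.
  by apply/existsP; exists v; apply/existsP; exists x; apply/existsP; exists y; apply/and5P.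
have [/exists_inP[p pX /exists_inP[q qX pq]]|st] := boolP [exists p in X, exists q in X, e p q].
  have [u [v [_ _ uX vX /andP[nuv uv]]]] := linkF X p z (in_setT p) (in_setT z) pX zX.
  apply: (module_col e_sym kiteF modX pX qX pq vX _ crit).
  by rewrite inE vX /=; apply: contra uv => vp; rewrite e_sym; apply: modX vp.
have /card_gt1P[a [v [aX vX nav]]] := X1.
have stX x y : x \in X -> y \in X -> ~~ e x y.
  by move=> xX yX; apply: contra st => xy; apply/exists_inP; exists x => //; apply/exists_inP; exists y.
apply: (critical_dominated e_sym e_irr crit nav (stX _ _ aX vX)) => w aw.
rewrite e_sym; apply: (modX w a v); rewrite // 1?e_sym //.
by apply: contraTN aw => wX; apply: stX.
Qed.

(** If the non-neighbours of some a contain an edge, a vertex splitting the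
    component of that edge completes an induced path starting at a.  If they are
    stable for each a, a vertex dominates each of its non-neighbours. *)
Lemma critical_P4 (T : finType) (e : rel T) k : symmetric e -> irreflexive e ->
  critical e k -> 0 < k -> linked (nonadj e) setT -> prime e ->
  exists a b c d, is_P4 e a b c d.
Proof.
move=> e_sym e_irr crit k0 linkF primeP.
have [/existsP[a /existsP[p /existsP[q /and3P[ap aq pq]]]]|st] :=
    boolP [exists a, exists p, exists q, [&& nonadj e a p, nonadj e a q & e p q]].
  have pM : p \in [set z | nonadj e a z] by rewrite inE.
  have [K [sK pK linkK clK]] := component e_sym pM.
  have qK : q \in K by apply: (clK p); rewrite ?inE.
  have KM z : z \in K -> (a != z) && ~~ e a z by move/(subsetP sK); rewrite inE.
  have K1 : 1 < #|K|.
    by apply/card_gt1P; exists p, q; split=> //; apply: contraTneq pq => ->; rewrite e_irr.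
  have aK : a \notin K by apply/negP=> /KM; rewrite eqxx.
  have [v [x [y [vK xK yK vx vy]]]] := primeP K a K1 aK.
  have av : e a v.
    apply: contraT => nav; case/negP: vK; apply: (clK x); rewrite // 1?e_sym // inE.
    rewrite /nonadj nav andbT; apply: contraTneq vx => <-.
    by case/andP: (KM x xK).
  have [||u [w [uK wK]]] := linkK [set z | e v z] x y xK yK; rewrite ?inE //.
  move=> vu vw uw; exists a, v, u, w.
  have [/andP[_ au] /andP[_ aw]] := (KM u uK, KM w wK).
  by rewrite /is_P4 av vu uw au aw vw.
exfalso.
have stable a p q : nonadj e a p -> nonadj e a q -> ~~ e p q.
  move=> ap aq; apply: contra st => pq.
  by apply/existsP; exists a; apply/existsP; exists p; apply/existsP; exists q; apply/and3P.
have [/existsP[a /existsP[b ab]]|no] := boolP [exists a, exists b, nonadj e a b].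
  case/andP: (ab) => nab eab.
  apply: (critical_dominated e_sym e_irr crit nab eab) => z az.
  apply: contraT => bz; suff : ~~ e a z by rewrite az.
  apply: (stable b); first by rewrite nonadj_sym.
  by rewrite /nonadj bz andbT; apply: contraNneq eab => ->.
apply: crit.1; exists (fun=> 0); split=> // x y _ _ xy.
have nyx : y \notin [set x] by rewrite inE; apply: contraTneq xy => ->; rewrite e_irr.
have [u [v [_ _ _ _ uv]]] := linkF [set x] x y (in_setT x) (in_setT y) (set11 x) nyx.
by case/negP: no; apply/existsP; exists u; apply/existsP; exists v.
Qed.

(** * Joins *)

Section Join.
Variables (T : finType) (e : rel T).
Hypotheses (e_sym : symmetric e) (e_irr : irreflexive e).
Variables A B : {set T}.
Hypothesis AB : forall x y, x \in A -> y \in B -> e x y.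

Let disAB x : x \in A -> x \in B -> False.
Proof. by move=> xA xB; have := AB xA xB; rewrite e_irr. Qed.

(** The only two branch sets that may be large lie on different sides.  Replace
    them by two edges across, each with one end in either of them: such an edge
    is adjacent to everything. *)
Lemma model_exchange t (C : nat -> {set T}) i0 j0 :
  i0 < t -> j0 < t -> i0 != j0 ->
  (forall i, i < t -> [/\ C i \subset A \/ C i \subset B, C i != set0 & linked e (C i)]) ->
  (forall i j, i < t -> j < t -> i != j -> [disjoint C i & C j]) ->
  (forall i j, i < t -> j < t -> i != j -> exists u v, [/\ u \in C i, v \in C j & e u v]) ->
  (forall i, i < t -> 2 < #|C i| -> i = i0 \/ i = j0) ->
  C i0 \subset A -> C j0 \subset B -> 1 < #|C i0| -> 1 < #|C j0| ->
  model e (A :|: B) t.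
Proof.
move=> i0t j0t n0 hC hD hE hS CA CB /card_gt1P[x1 [x2 [x1C x2C nx]]] /card_gt1P[y1 [y2 [y1C y2C ny]]].
have xA x : x \in C i0 -> x \in A by apply: (subsetP CA).
have yB y : y \in C j0 -> y \in B by apply: (subsetP CB).
have xy x y : x \in C i0 -> y \in C j0 -> e x y by move=> /xA xA' /yB; apply: AB.
pose D i := if i == i0 then [set x1; y1] else if i == j0 then [set x2; y2] else C i.
have D0 x y : x \in C i0 -> y \in C j0 -> [/\ [set x; y] \subset A :|: B, [set x; y] != set0
    & linked e [set x; y]].
  move=> xC yC; split.
  - by apply/subsetP=> z /set2P[]->; apply/setUP; [left; apply: xA|right; apply: yB].
  - by apply/set0Pn; exists x; rewrite !inE eqxx.
  - exact/linked2/xy.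
have dis0 x y i : x \in C i0 -> y \in C j0 -> i < t -> i != i0 -> i != j0 -> [disjoint [set x; y] & C i].
  move=> xC yC it ni ni'; rewrite disjoint_sym; apply/pred0P=> z /=.
  apply/negP=> /andP[zC /set2P[]zE]; rewrite zE in zC.
  - by have := disjointFr (hD _ _ it i0t ni) zC; rewrite xC.
  - by have := disjointFr (hD _ _ it j0t ni') zC; rewrite yC.
have adj0 x y i : x \in C i0 -> y \in C j0 -> i < t -> exists u v, [/\ u \in [set x; y], v \in C i & e u v].
  move=> xC yC it; have [CAB /set0Pn[z zC] _] := hC i it.
  case: CAB => /subsetP/(_ z zC) zAB.
    by exists y, z; split; [rewrite !inE eqxx orbT| |rewrite e_sym; apply: AB zAB (yB _ yC)].
  by exists x, z; split; [rewrite !inE eqxx| |apply: AB (xA _ xC) zAB].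
exists D; split.
- move=> i it; rewrite /D; case: (i == i0); first exact: D0.
  case: (i == j0); first exact: D0.
  have [CAB ? ?] := hC i it; split=> //.
  by case: CAB => s; apply: subset_trans s _; [apply: subsetUl|apply: subsetUr].
- have d12 : [disjoint [set x1; y1] & [set x2; y2]].
    apply/pred0P=> z /=; apply/negP=> /andP[/set2P[]-> /set2P[]E].
    + by rewrite E eqxx in nx.
    + by apply: (@disAB x1); [apply: xA|rewrite E yB].
    + by apply: (@disAB y1); [rewrite E xA|apply: yB].
    + by rewrite E eqxx in ny.
  move=> i j it jt nij; rewrite /D.
  have [Ei|ni] := eqVneq i i0; have [Ej|nj] := eqVneq j i0.
  + by rewrite Ei Ej eqxx in nij.
  + by have [Ej'|nj'] := eqVneq j j0; last exact: dis0.
  + have [Ei'|ni'] := eqVneq i j0; first by rewrite disjoint_sym.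
    by rewrite disjoint_sym; apply: dis0.
  have [Ei'|ni'] := eqVneq i j0; have [Ej'|nj'] := eqVneq j j0.
  + by rewrite Ei' Ej' eqxx in nij.
  + exact: dis0.
  + by rewrite disjoint_sym; apply: dis0.
  + exact: hD.
- move=> i j it jt nij; rewrite /D.
  have e12 : exists u v, [/\ u \in [set x1; y1], v \in [set x2; y2] & e u v].
    by exists x1, y2; rewrite !inE !eqxx orbT xy.
  have sw P Q : (exists u v, [/\ u \in P, v \in Q & e u v]) -> exists u v, [/\ u \in Q, v \in P & e u v].
    by case=> u [v [uP vQ uv]]; exists v, u; rewrite e_sym.
  have [Ei|ni] := eqVneq i i0; have [Ej|nj] := eqVneq j i0.
  + by rewrite Ei Ej eqxx in nij.
  + by have [Ej'|nj'] := eqVneq j j0; last exact: adj0.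
  + by apply: sw; have [Ei'|ni'] := eqVneq i j0; last exact: adj0.
  have [Ei'|ni'] := eqVneq i j0; have [Ej'|nj'] := eqVneq j j0.
  + by rewrite Ei' Ej' eqxx in nij.
  + exact: adj0.
  + by apply: sw; apply: adj0.
  + exact: hE.
- have small i : i < t -> ~~ (2 < #|D i|).
    move=> it; rewrite /D; case: eqVneq => [_|ni]; first by rewrite cards2; case: (x1 != y1).
    case: eqVneq => [_|nj]; first by rewrite cards2; case: (x2 != y2).
    by apply/negP=> /(hS i it)[]E; [rewrite E eqxx in ni|rewrite E eqxx in nj].
  by move=> i j it jt b; have := small i it; rewrite b.
Qed.

Lemma model_join a b : model e A a -> model e B b -> model e (A :|: B) (a + b).
Proof.
move=> [S [hS dS aS bS]] [R [hR dR aR bR]].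
pose C i := if i < a then S i else R (i - a).
have lt i : i < a + b -> ~~ (i < a) -> i - a < b by lia.
have CP i : i < a + b -> [/\ C i \subset A \/ C i \subset B, C i != set0 & linked e (C i)].
  move=> it; rewrite /C; case: ifP => [/hS[]|/negbT/(lt i it)/hR[]]; first by split; [left|..].
  by split; [right|..].
have CD i j : i < a + b -> j < a + b -> i != j -> [disjoint C i & C j].
  have cross i' j' : i' < a -> j' < b -> [disjoint S i' & R j'].
    move=> /hS[/subsetP sA _ _] /hR[/subsetP sB _ _]; apply/pred0P=> z /=.
    by apply/negP=> /andP[/sA zA /sB zB]; apply: disAB zA zB.
  move=> it jt nij; rewrite /C; have := (lt i it, lt j jt).
  case: (ltnP i a) => ia; case: (ltnP j a) => ja /= [li lj].
  - exact: dS.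
  - by apply: cross => //; apply: lj.
  - by rewrite disjoint_sym; apply: cross => //; apply: li.
  - by apply: dR; rewrite ?li ?lj //; lia.
have CE i j : i < a + b -> j < a + b -> i != j -> exists u v, [/\ u \in C i, v \in C j & e u v].
  have cross i' j' : i' < a -> j' < b -> exists u v, [/\ u \in S i', v \in R j' & e u v].
    move=> /hS[/subsetP sA /set0Pn[u uS] _] /hR[/subsetP sB /set0Pn[v vR] _].
    by exists u, v; split=> //; apply: AB; [apply: sA|apply: sB].
  move=> it jt nij; rewrite /C; have := (lt i it, lt j jt).
  case: (ltnP i a) => ia; case: (ltnP j a) => ja /= [li lj].
  - exact: aS.
  - by apply: cross => //; apply: lj.
  - have [//||u [v [uS vR uv]]] := cross j (i - a); first exact: li.
    by exists v, u; rewrite e_sym.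
  - by apply: aR; rewrite ?li ?lj //; lia.
have [/existsP[i0 bi]|noS] := boolP [exists i : 'I_a, 2 < #|S i|]; last first.
  exists C; split=> //.
    move=> i it; have [CAB ? ?] := CP i it; split=> //.
    by case: CAB => s; apply: subset_trans s _; [apply: subsetUl|apply: subsetUr].
  move=> i j it jt; rewrite /C; have := (lt i it, lt j jt).
  case: (ltnP i a) => ia; first by move=> _ ?; case/existsP: noS; exists (Ordinal ia).
  case: (ltnP j a) => ja; first by move=> _ _ ?; case/existsP: noS; exists (Ordinal ja).
  by move=> [li lj] b1 b2; have := bR _ _ (li isT) (lj isT) b1 b2; lia.
have [/existsP[j0 bj]|noR] := boolP [exists j : 'I_b, 2 < #|R j|]; last first.
  exists C; split=> //.
    move=> i it; have [CAB ? ?] := CP i it; split=> //.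
    by case: CAB => s; apply: subset_trans s _; [apply: subsetUl|apply: subsetUr].
  move=> i j it jt; rewrite /C; have := (lt i it, lt j jt).
  case: (ltnP i a) => ia [li lj]; last first.
    by move=> bi'; case/existsP: noR; exists (Ordinal (li isT)).
  case: (ltnP j a) lj => ja lj; last first.
    by move=> _ bj'; case/existsP: noR; exists (Ordinal (lj isT)).
  exact: bS.
have Ci0 : C i0 = S i0 by rewrite /C ltn_ord.
have Cj0 : C (a + j0) = R j0 by rewrite /C ltnNge leq_addr /= addKn.
have [i0a j0b] := (ltn_ord i0, ltn_ord j0).
apply: (@model_exchange (a + b) C i0 (a + j0)) => //; rewrite ?Ci0 ?Cj0 ?(ltnW bi) ?(ltnW bj) //.
- by lia.
- by lia.
- by lia.
- move=> i it; rewrite /C; have := lt i it; case: (ltnP i a) => ia li bi'.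
    by left; apply: bS.
  by right; have := bR _ _ (li isT) j0b bi' bj; lia.
- by case: (hS i0 i0a).
- by case: (hR j0 j0b).
Qed.

End Join.

(** * The induction *)

(** A decidable form of [col]; the spare colour k keeps the type of colours
    inhabited. *)
Definition colb (T : finType) (e : rel T) (A : {set T}) k :=
  [exists c : {ffun T -> 'I_k.+1}, [forall x in A, c x < k] &&
    [forall x in A, forall y in A, e x y ==> (c x != c y)]].

Lemma colP (T : finType) (e : rel T) (A : {set T}) k : reflect (col e A k) (colb e A k).
Proof.
apply: (iffP existsP) => [[c /andP[/forall_inP ck /forall_inP cP]]|[c [ck cP]]].
  exists (fun x => val (c x)); split=> // x y xA yA xy.
  by move/forall_inP: (cP x xA) => /(_ y yA)/implyP/(_ xy).
have inE' x : x \in A -> (inord (c x) : 'I_k.+1) = c x :> nat.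
  by move=> xA; rewrite inordK // ltnS ltnW // ck.
exists [ffun x => inord (c x)]; apply/andP; split; apply/forall_inP=> x xA.
  by rewrite ffunE inE' ?ck.
apply/forall_inP=> y yA; apply/implyP=> xy; rewrite !ffunE -val_eqE /=.
by rewrite !inE' // cP.
Qed.

Lemma model_sub (T : finType) (e : rel T) (A B : {set T}) t : A \subset B ->
  model e A t -> model e B t.
Proof.
move=> sAB [S [h1 h2 h3 h4]]; exists S; split=> // i /h1[s ? ?].
by split=> //; apply: subset_trans s sAB.
Qed.

Lemma model_mono (T : finType) (e : rel T) (A : {set T}) t t' : t' <= t ->
  model e A t -> model e A t'.
Proof.
move=> le [S [h1 h2 h3 h4]].
have lt i : i < t' -> i < t by move=> h; apply: leq_trans h le.
by exists S; split=> [i /lt/h1//|i j /lt it /lt jt|i j /lt it /lt jt|i j /lt it /lt jt];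
  [apply: h2|apply: h3|apply: h4].
Qed.

Section Restriction.
Variables (T : finType) (e : rel T) (A : {set T}).
Let U := {x : T | x \in A}.
Definition restr : rel U := fun x y => e (val x) (val y).

Lemma col_restr k : col restr setT k -> col e A k.
Proof.
move=> [c [ck cP]]; exists (fun x => if insub x is Some u then c u else 0).
split=> [x xA|x y xA yA xy]; first by rewrite insubT; apply: ck.
by rewrite !insubT; apply: cP.
Qed.

Lemma model_restr t : model restr setT t -> model e A t.
Proof.
move=> [S [h1 h2 h3 h4]]; exists (fun i => val @: S i); split.
- move=> i /h1[_ /set0Pn[u uS] linkS]; split.
  + by apply/subsetP=> _ /imsetP[x _ ->]; apply: valP.
  + by apply/set0Pn; exists (val u); apply: imset_f.
  + move=> B _ _ /imsetP[x xS ->] /imsetP[y yS ->] xB yB.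
    have [||a [b [aS bS]]] := linkS [set z | val z \in B] x y xS yS; rewrite ?inE //.
    by move=> aB bB ab; exists (val a), (val b); split; rewrite ?imset_f.
- move=> i j it jt nij; apply/pred0P=> z /=; apply/negP=> /andP[/imsetP[x xS ->]].
  by rewrite mem_imset; [rewrite (disjointFr (h2 i j it jt nij) xS)|exact: val_inj].
- move=> i j it jt nij; have [u [v [uS vS uv]]] := h3 i j it jt nij.
  by exists (val u), (val v); split; rewrite ?imset_f.
- by move=> i j it jt; rewrite !card_imset; [apply: h4|exact: val_inj..].
Qed.

End Restriction.

Lemma noncolourable_model (T : finType) (e : rel T) k :
  symmetric e -> irreflexive e -> fork_free e -> kite_free e ->
  ~ col e setT k -> model e setT k.+1.
Proof.
have [n] := ubnP #|T|; elim: n T e k => // n IH T e k /ltnSE leT e_sym e_irr forkF kiteF nocol.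
have sub_model (A : {set T}) j : A != setT -> ~ col e A j -> model e A j.+1.
  move=> AT nA; apply: model_restr; apply: IH.
  - rewrite card_sig; apply: leq_trans leT; rewrite -cardsT; apply: proper_card.
    by rewrite properT.
  - by move=> x y; rewrite /restr e_sym.
  - by move=> x; rewrite /restr e_irr.
  - by move=> a b c d f ab ac ad df nbc; apply: (forkF _ _ _ _ _ ab ac ad df); rewrite -val_eqE in nbc.
  - by move=> p q r s t; apply: kiteF.
  - by move/col_restr.
have [/existsP[A /andP[AT /colP nA]]|nA] := boolP [exists A, (A != setT) && ~~ colb e A k].
  by apply: model_sub (subsetT A) _; apply: sub_model.
have crit : critical e k.
  split=> // A AT; apply/colP; apply: contraT => nc; case/negP: nA.
  by apply/existsP; exists A; rewrite AT.
have [k0|k_gt0] := posnP k.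
  apply: (clique_model (Q := set0) e_sym e_irr crit); last by rewrite k0.
  by move=> x y; rewrite inE.
have [x _|T0] := pickP (mem [set: T]); last first.
  by exfalso; apply: nocol; exists (fun=> 0); split=> // x y _; have := T0 x; rewrite /= inE.
have f_sym := nonadj_sym e_sym.
have [W [_ xW linkW clW]] := component f_sym (in_setT x).
have [WT|WT] := eqVneq W setT.
  rewrite WT in linkW.
  have primeP := critical_prime e_sym e_irr kiteF crit linkW.
  have [a [b [c [d P4]]]] := critical_P4 e_sym e_irr crit k_gt0 linkW primeP.
  case: (prime_line_like_or_co e_sym e_irr forkF kiteF primeP P4) => [lineE|lineF].
    have [Q clQ kQ] := vizing_clique e_sym e_irr lineE crit.
    exact: (clique_model e_sym e_irr crit clQ kQ).
  have [[Q clQ kQ]|//] := co_line_like e_sym e_irr lineF linkW crit.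
  exact: (clique_model e_sym e_irr crit clQ kQ).
have opt (A : {set T}) : A != setT -> exists2 a, col e A a & model e A a.
  move=> AT; have ex : exists a, colb e A a by exists #|A|; apply/colP/col_card.
  case: (ex_minnP ex) => a /colP cA minA; exists a => //.
  case: a cA minA => [|a] cA minA; first by exists (fun=> set0); split.
  by apply: sub_model => // /colP/minA; rewrite ltnn.
have CT : ~: W != setT by apply/eqP=> /setP/(_ x); rewrite !inE xW.
have [a colW modW] := opt W WT; have [b colC modC] := opt (~: W) CT.
have := col_union colW colC; rewrite setUCr => colT.
have ltk : k.+1 <= a + b by rewrite ltnNge; apply/negP=> le; apply: nocol (col_mono le colT).
apply: (model_mono ltk); rewrite -(setUCr W); apply: model_join => // y z yW.
rewrite inE => zW; apply: contraT => yz; case/negP: (zW); apply: (clW y); rewrite ?in_setT //.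
by rewrite /nonadj yz andbT; apply: contraTneq yW => ->.
Qed.

(** * Induced subgraphs up to isomorphism and branch sets *)

Section Bridge.
Variable G : graph.

Lemma embedding_isomorphic (H : graph) (g : H -> G) : injective g ->
  {mono g : x y / adj x y} -> isomorphic (induced (g @: [set: H])) H.
Proof.
move=> g_inj g_mono; pose A := g @: [set: H].
have gA x : g x \in A by apply: imset_f.
pose h x : induced A := exist _ (g x) (gA x).
have h_inj : injective h by move=> x y [] /g_inj.
have h_surj (u : induced A) : exists x, h x == u.
  by case: u => u uA; have /imsetP[x _ Eu] := uA; exists x; rewrite -val_eqE /= Eu.
pose f u := xchoose (h_surj u).
have hf u : h (f u) = u by apply/eqP/(xchooseP (h_surj u)).
exists f; last by move=> u v; rewrite -[in RHS](hf u) -[in RHS](hf v) /= /induced_rel /= g_mono.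
by exists h => // x; apply: h_inj; rewrite hf.
Qed.

Lemma adj_neq (x y : G) : adj x y -> x != y.
Proof. by apply: contraTneq => ->; rewrite adj_irrefl. Qed.

Lemma adj_sep (x y z : G) : adj x y -> ~~ adj x z -> y != z.
Proof. by move=> xy; apply: contraNneq => <-. Qed.

Lemma nth_embedding n (E : rel 'I_n) E_sym E_irr (s : seq G) x0 :
  size s = n -> uniq s -> (forall i j : 'I_n, adj (nth x0 s i) (nth x0 s j) = E i j) ->
  exists A : {set G}, isomorphic (induced A) (@Graph 'I_n E E_sym E_irr).
Proof.
move=> sn us mono.
exists ((fun i : @Graph 'I_n E E_sym E_irr => nth x0 s (i : 'I_n)) @: [set: _]).
apply: embedding_isomorphic => // i j /eqP.
by rewrite nth_uniq ?sn ?ltn_ord // => /eqP/val_inj.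
Qed.

Hypothesis freeG : free_of (fun H : graph => H = fork \/ H = antifork) G.

Lemma fork_free_adj : fork_free (@adj G).
Proof.
move=> a b c d f ab ac ad df nbc bc bd cd af bf cf.
have [ba fd] : adj b a /\ adj f d by rewrite !(@adj_sym G _ a, @adj_sym G f).
have us : uniq [:: a; b; c; d; f].
  have [nfb nfc] : ~~ adj f b /\ ~~ adj f c by rewrite !(@adj_sym G f).
  have [nbd ncd] := (adj_sep fd nfb, adj_sep fd nfc); rewrite eq_sym in nbd; rewrite eq_sym in ncd.
  rewrite /= !inE !negb_or nbc nbd ncd (adj_neq ab) (adj_neq ac) (adj_neq ad) (adj_neq df).
  by rewrite (adj_sep ba bf) (adj_sep ab af) (adj_sep ac af).
have [|A] := @nth_embedding 5 _ (@adj_sym fork) (@adj_irrefl fork) [:: a; b; c; d; f] a erefl us;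
  last exact: (freeG (or_introl (erefl _))).
have off (x y : G) : ~~ adj x y -> (adj x y = false) * (adj y x = false).
  by rewrite [adj y x]adj_sym => /negbTE.
have on (x y : G) : adj x y -> (adj x y = true) * (adj y x = true) by rewrite [adj y x]adj_sym.
have tab := (on _ _ ab, on _ _ ac, on _ _ ad, on _ _ df, (off _ _ bc, off _ _ bd, off _ _ cd),
  (off _ _ af, off _ _ bf, off _ _ cf), @adj_irrefl G).
by case=> [[|[|[|[|[|//]]]]] i5] [[|[|[|[|[|//]]]]] j5]; rewrite /= tab.
Qed.

Lemma kite_free_adj : kite_free (@adj G).
Proof.
move=> p q r s t pq pr ps qr qs rt rs pt qt st.
have us : uniq [:: t; p; q; s; r].
  have sp : adj s p by rewrite adj_sym.
  have sq : adj s q by rewrite adj_sym.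
  have tr : adj t r by rewrite adj_sym.
  have ts : ~~ adj t s by rewrite adj_sym.
  rewrite /= !inE !negb_or (adj_neq pq) (adj_neq ps) (adj_neq pr) (adj_neq qs) (adj_neq qr).
  rewrite (adj_neq tr) [t == p]eq_sym [t == q]eq_sym [t == s]eq_sym [s == r]eq_sym.
  by rewrite (adj_sep sp st) (adj_sep sq st) (adj_sep qs qt) (adj_sep tr ts).
have [|A] := @nth_embedding 5 _ (@adj_sym antifork) (@adj_irrefl antifork) [:: t; p; q; s; r] t erefl us;
  last exact: (freeG (or_intror (erefl _))).
have off (x y : G) : ~~ adj x y -> (adj x y = false) * (adj y x = false).
  by rewrite [adj y x]adj_sym => /negbTE.
have on (x y : G) : adj x y -> (adj x y = true) * (adj y x = true) by rewrite [adj y x]adj_sym.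
have tab := (on _ _ pq, on _ _ pr, on _ _ ps, on _ _ qr, (on _ _ qs, on _ _ rt, off _ _ rs),
  (off _ _ pt, off _ _ qt, off _ _ st), @adj_irrefl G).
by case=> [[|[|[|[|[|//]]]]] i5] [[|[|[|[|[|//]]]]] j5]; rewrite /= tab.
Qed.

Lemma linked_connected (A : {set G}) : linked (@adj G) A -> connected A.
Proof.
move=> linkA; apply/forallP=> x; apply/forallP=> y; apply: contraT => nxy.
pose B := [set val z | z in [set z : induced A | connect (@adj (induced A)) x z]].
have inB (z : induced A) : (val z \in B) = connect (@adj (induced A)) x z.
  by rewrite mem_imset ?inE //; apply: val_inj.
have [||u [v [uA vA uB vB uv]]] := linkA B (val x) (val y) (valP x) (valP y).
- by rewrite inB connect0.
- by rewrite inB.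
case/negP: vB; case/imsetP: uB => z; rewrite inE => xz Eu.
have Ev : v = val (Sub v vA : induced A) by [].
rewrite Ev inB; apply: connect_trans xz (connect1 _).
by rewrite /= /induced_rel /= -Eu.
Qed.

Lemma model_had2plus t : model (@adj G) setT t -> t <= had2plus G.
Proof.
move=> [S [h1 h2 h3 h4]]; rewrite /had2plus; case: ex_maxnP => m _; apply.
apply/existsP; exists [ffun i : complete t => S (i : 'I_t)]; apply/andP; split.
  apply/and3P; split; apply/forallP=> i; rewrite ?ffunE.
  - by have [_ -> /linked_connected->] := h1 i (ltn_ord i).
  - by apply/forallP=> j; apply/implyP=> nij; rewrite !ffunE h2.
  - apply/forallP=> j; apply/implyP=> nij; rewrite !ffunE.
    have [u [v [uS vS uv]]] := h3 i j (ltn_ord i) (ltn_ord j) nij.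
    by apply/exists_inP; exists u => //; apply/exists_inP; exists v.
apply/card_le1_eqP=> i j; rewrite !inE !ffunE => bi bj.
exact: ord_inj (h4 j i (ltn_ord j) (ltn_ord i) bj bi).
Qed.

Lemma col_colorable k : col (@adj G) setT k -> colorable G k.
Proof.
move=> [c [ck cP]]; apply/existsP; exists [ffun x => Ordinal (ck x (in_setT x))].
apply/forallP=> x; apply/forallP=> y; apply/implyP=> xy.
by rewrite !ffunE -val_eqE /= cP.
Qed.

End Bridge.

Theorem theorem1p4 (G : graph)
  (hG : free_of (fun H : graph => H = fork \/ H = antifork) G) :
  chi G <= had2plus G.
Proof.
apply: model_had2plus; rewrite /chi; case: ex_minnP => k _ min_k.
case: k min_k => [|k] min_k; first by exists (fun=> set0); split.
apply: noncolourable_model (@adj_sym G) (@adj_irrefl G) _ _ _.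
- exact: fork_free_adj.
- exact: kite_free_adj.
- by move/col_colorable/min_k; rewrite ltnn.
Qed.
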